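(* Let $1<q<p$, let $(X,\mu)$ be a non-atomic probability space, let $\mathcal{T}$ be a tree on $X$ with maximal operator $\mathcal{M}_{\mathcal{T}}$, and for positive $f,A,F,\lambda$ let $$B_1(f,A,F,\lambda)=\sup\Big\{\mu(\{\mathcal{M}_{\mathcal{T}}\phi\ge\lambda\}):\ \phi\ge 0,\ \int_X\phi\,d\mu=f,\ \int_X\phi^q\,d\mu=A,\ \|\phi\|_{p,\infty}\le F\Big\}.$$ Let $D_1$ be the set of triples $(f,A,F)$ of positive reals such that $0<f\le\frac{p}{p-1}F$ and $A_2(f,F)\le A\le A_1(f,F)$, where $$A_1(f,F)=\Big(\frac{p-1}{p}\Big)^{\frac{p-q}{p-1}}\frac{p}{p-q}\,f^{\frac{p-q}{p-1}}F^{\frac{p(q-1)}{p-1}},$$ $$A_2(f,F)=\begin{cases} f^q, & 0<f\le F,\\[2pt] \dfrac{F^q}{p-q}\Big\{p-q\Big[p\Big(1-\frac{p-1}{p}\cdot\frac fF\Big)\Big]^{\frac{p-q}{p-1}}\Big\}, & F<f\le\frac{p}{p-1}F.\end{cases}$$ Then $D_1$ is the domain of the extremal problem: for positive $f,A,F$, a measurable $\phi:X\to[0,\infty)$ with $\int_X\phi\,d\mu=f$, $\int_X\phi^q\,d\mu=A$, $\|\phi\|_{p,\infty}\le F$ exists if and only if $(f,A,F)\in D_1$. Moreover, if $(f,A,F)\in D_1$ and $A>A_2(f,F)$, put $f_1=\frac{p-1}{p}\cdot\frac fF$, $A'=\big(\frac{p-1}{pF}\big)^qA$, $\Gamma=\big(\frac{p-1}{p}\big)^q\frac{p}{p-q}$,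 and $\lambda'=\frac{p-1}{p}\cdot\frac{\lambda}{F}$ for $\lambda>0$. Then, for every $\lambda>0$, $$B_1(f,A,F,\lambda)=\begin{cases}1, & \lambda\le f,\\ f/\lambda, & f<\lambda\le\frac{p}{p-1}F\lambda_3',\\ \delta', & \frac{p}{p-1}F\lambda_3'<\lambda\le\frac{p}{p-1}F\lambda_1',\\ \Big[\dfrac{pF/(p-1)}{\lambda}\Big]^p, & \lambda>\frac{p}{p-1}F\lambda_1',\end{cases}$$ where, with $T_{\lambda'}$, $F_{\lambda'}$ and $\Delta$ the functions and interval (associated with $f_1$) defined in the context: (a) $\lambda_1'$ is the unique solution $\lambda'\ge(1/f_1)^{1/(p-1)}$ of $F_{\lambda'}\big(\tfrac{1}{(\lambda')^p}\big)+\frac{\Gamma}{(\lambda')^{p-q}}=A'$; (b) $\lambda_3'$ is the unique root of $T_{\lambda'}(f_1/\lambda')=A'$ in $\big[f_1,(1/f_1)^{1/(p-1)}\big]$; (c) $\delta'$ is the unique solution $\delta'\in\Delta$ of $T_{\lambda'}(\delta')+F_{\lambda'}(\delta')=A'$, where $\lambda'=\frac{p-1}{p}\cdot\frac{\lambda}{F}$.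
   Context: Tree: a set $\mathcal{T}$ of measurable subsets of $X$ is a tree if (i) $X\in\mathcal{T}$ and $\mu(I)>0$ for every $I\in\mathcal{T}$; (ii) to every $I\in\mathcal{T}$ corresponds a finite or countable $C(I)\subseteq\mathcal{T}$ with at least two elements, which are subsets of $I$ with pairwise intersections of measure zero, and $I=\bigcup C(I)$; (iii) $\mathcal{T}=\bigcup_{m\ge0}\mathcal{T}_{(m)}$ where $\mathcal{T}_{(0)}=\{X\}$, $\mathcal{T}_{(m+1)}=\bigcup_{I\in\mathcal{T}_{(m)}}C(I)$; (iv) $\lim_{m\to\infty}\sup_{I\in\mathcal{T}_{(m)}}\mu(I)=0$. Maximal operator: $\mathcal{M}_{\mathcal{T}}\phi(x)=\sup\{\frac1{\mu(I)}\int_I|\phi|\,d\mu:\ x\in I\in\mathcal{T}\}$. Quasi-norm: $\|\phi\|_{p,\infty}=\sup\{\lambda\,\mu(\{|\phi|\ge\lambda\})^{1/p}:\lambda>0\}$. Functions $T_{\lambda'},F_{\lambda'}$ associated with $f_1\in(0,1]$ (write $\ell=\lambda'$). For $\ell\ge f_1$ and $\alpha\in[0,1/\ell^p]$, $$T_\ell(\alpha)=\begin{cases}\ell^q\alpha, & \alpha\le\big[\frac{(p-1)/p}{\ell}\big]^p,\\ \big(\frac{p-1}{p}\big)^q\frac1{p-q}\Big\{p\,\alpha^{1-q/p}-q\big[p(\alpha^{1-1/p}-\ell\alpha)\big]^{\frac{p-q}{p-1}}\Big\}, & \big[\frac{(p-1)/p}{\ell}\big]^p<\alpha\le\frac1{\ell^p}.\end{cases}$$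 For $\ell>f_1$ and $\alpha\in[0,f_1/\ell]$ with $f_1-\ell\alpha\le1-\alpha^{1-1/p}$: if $0<f_1\le\frac{p-1}p$, then $F_\ell(\alpha)=\frac{(f_1-\ell\alpha)^q}{(1-\alpha)^{q-1}}$; if $\frac{p-1}p<f_1\le1$, then $$F_\ell(\alpha)=\begin{cases}\frac{(f_1-\ell\alpha)^q}{(1-\alpha)^{q-1}}, & \frac{f_1-\frac{p-1}p}{\ell-\frac{p-1}p}\le\alpha\le\frac{f_1}{\ell},\\ \big(\frac{p-1}p\big)^qc^{-q/p}(c-\alpha)+\Gamma\,(1-c^{1-q/p}), & \alpha\le\frac{f_1-\frac{p-1}p}{\ell-\frac{p-1}p},\end{cases}$$ where $c\in[\alpha,1]$, $c>0$, is the solution of $\frac1pc^{1-1/p}+(1-\frac1p)\alpha c^{-1/p}=1-(f_1-\ell\alpha)$. Interval $\Delta$ (depending on $f_1$ and $\ell$, for $\ell>f_1$): let $m=\min\{f_1/\ell,1/\ell^p\}$. If $0<f_1\le\frac{p-1}p$, $\Delta=[0,m]$. If $\frac{p-1}p<f_1\le1$, let $K(\beta)=f_1-1+\beta^{1-1/p}-\ell\beta$ on $[0,1/\ell^p]$ and $\beta_0=\big[\frac{(p-1)/p}{\ell}\big]^p$ (the maximum point of $K$); then $\Delta=[0,m]$ if $K(\beta_0)<0$, $\Delta=[\beta_0,m]$ if $K(\beta_0)=0$, and $\Delta=[\beta_2,m]$ if $K(\beta_0)>0$, where $\beta_2$ is the larger of the two zeros of $K$ in $[0,1/\ell^p]$.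 *)

(* Defs.v *)
From mathcomp Require Import all_boot all_order all_algebra.
From mathcomp Require Import all_classical all_reals all_analysis.

Set Implicit Arguments.
Unset Strict Implicit.
Unset Printing Implicit Defensive.

Import Order.TTheory GRing.Theory Num.Theory.
Import numFieldNormedType.Exports.

Local Open Scope classical_set_scope.
Local Open Scope ring_scope.

Section trees.
Context (R : realType) (d : measure_display) (X : measurableType d).
Variable mu : {measure set X -> \bar R}.

Definition nonatomic : Prop :=
  forall A : set X, measurable A -> (0 < mu A)%E ->
    exists B : set X,
      [/\ measurable B, B `<=` A, (0 < mu B)%E & (mu B < mu A)%E].

Fixpoint tree_level (C : set X -> set (set X)) (m : nat) : set (set X) :=
  match m with
  | 0 => [set setT]
  | m'.+1 => \bigcup_(I in tree_level C m') C I
  end.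

(* Distinct members of [C I] may overlap in a null set. *)
Record tree_with (T : set (set X)) (C : set X -> set (set X)) : Prop := {
  tree_measurable : forall I, T I -> measurable I;
  tree_setT : T setT;
  tree_gt0 : forall I, T I -> (0 < mu I)%E;
  tree_childS : forall I, T I -> C I `<=` T;
  tree_child_countable : forall I, T I -> countable (C I);
  tree_child_ge2 : forall I, T I -> exists J K, [/\ C I J, C I K & J <> K];
  tree_child_sub : forall I J, T I -> C I J -> J `<=` I;
  tree_child_null : forall I J K, T I -> C I J -> C I K -> J <> K ->
    mu (J `&` K) = 0%E;
  tree_cover : forall I, T I -> I = \bigcup_(J in C I) J;
  tree_levels : T = \bigcup_m tree_level C m;
  tree_mesh : ereal_sup [set mu I | I in tree_level C m] @[m --> \oo] --> 0%E
}.

Definition is_tree (T : set (set X)) : Prop := exists C, tree_with T C.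

Definition tree_maximal (T : set (set X)) (phi : X -> R) (x : X) : \bar R :=
  ereal_sup [set ((mu I)^-1 * \int[mu]_(y in I) `|(phi y)%:E|)%E
            | I in [set I | T I /\ I x]].

Definition weak_norm (p : R) (phi : X -> R) : \bar R :=
  ereal_sup [set (l%:E * mu [set x | (l <= `|phi x|)%R] `^ (p^-1)%R)%E
            | l in [set l : R | 0 < l]].

Definition admissible (p q f A F : R) (phi : X -> R) : Prop :=
  [/\ measurable_fun setT phi,
      forall x, 0 <= phi x,
      (\int[mu]_x (phi x)%:E = f%:E)%E,
      (\int[mu]_x (phi x `^ q)%:E = A%:E)%E &
      (weak_norm p phi <= F%:E)%E].

Definition B1 (T : set (set X)) (p q f A F lambda : R) : \bar R :=
  ereal_sup [set mu [set x | (lambda%:E <= tree_maximal T phi x)%E]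
            | phi in admissible p q f A F].

End trees.

Section functions.
Context (R : realType).
Variables p q : R.

Definition A1 (f F : R) : R :=
  ((p - 1) / p) `^ ((p - q) / (p - 1)) * (p / (p - q)) *
  f `^ ((p - q) / (p - 1)) * F `^ (p * (q - 1) / (p - 1)).

Definition A2 (f F : R) : R :=
  if f <= F then f `^ q else
  F `^ q / (p - q) *
  (p - q * (p * (1 - (p - 1) / p * (f / F))) `^ ((p - q) / (p - 1))).

Definition D1 (f A F : R) : Prop :=
  [/\ 0 < f, 0 < A, 0 < F, f <= p / (p - 1) * F & A2 f F <= A <= A1 f F].

Definition Gam : R := ((p - 1) / p) `^ q * (p / (p - q)).

Definition beta0 (l : R) : R := ((p - 1) / p / l) `^ p.

(* Used only for [f1 <= l] and [0 <= alpha <= (l `^ p)^-1]. *)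
Definition Tfun (l alpha : R) : R :=
  if alpha <= beta0 l then l `^ q * alpha else
  ((p - 1) / p) `^ q / (p - q) *
  (p * alpha `^ (1 - q / p) -
   q * (p * (alpha `^ (1 - p^-1) - l * alpha)) `^ ((p - q) / (p - 1))).

(* [xget 0] picks the solution when there is one, and returns 0 otherwise. *)
Definition croot (f1 l alpha : R) : R :=
  xget 0 [set c | [/\ alpha <= c <= 1, 0 < c &
    p^-1 * c `^ (1 - p^-1) + (1 - p^-1) * alpha * c `^ (- p^-1) =
    1 - (f1 - l * alpha)]].

(* Used only for [f1 < l], [0 <= alpha <= f1 / l] and
   [f1 - l * alpha <= 1 - alpha `^ (1 - p^-1)]; the two formulas for
   [(p - 1) / p < f1] agree at the common endpoint of their ranges. *)
Definition Ffun (f1 l alpha : R) : R :=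
  if (f1 <= (p - 1) / p) ||
     ((f1 - (p - 1) / p) / (l - (p - 1) / p) <= alpha)
  then (f1 - l * alpha) `^ q / (1 - alpha) `^ (q - 1)
  else let c := croot f1 l alpha in
    ((p - 1) / p) `^ q * c `^ (- (q / p)) * (c - alpha) +
    Gam * (1 - c `^ (1 - q / p)).

Definition Kfun (f1 l beta : R) : R :=
  f1 - 1 + beta `^ (1 - p^-1) - l * beta.

Definition Kzeros (f1 l : R) : set R :=
  [set b | 0 <= b <= (l `^ p)^-1 /\ Kfun f1 l b = 0].

Definition beta2 (f1 l : R) : R :=
  xget 0 [set b | Kzeros f1 l b /\ forall b', Kzeros f1 l b' -> b' <= b].

Definition Delta_min (f1 l : R) : R :=
  if f1 <= (p - 1) / p then 0
  else if Kfun f1 l (beta0 l) < 0 then 0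
  else if Kfun f1 l (beta0 l) == 0 then beta0 l
  else beta2 f1 l.

Definition Delta (f1 l : R) : set R :=
  [set a | Delta_min f1 l <= a <= Num.min (f1 / l) (l `^ p)^-1].

End functions.

(* Main.v *)
Require Import Defs.
From mathcomp Require Import all_boot all_order all_algebra.
From mathcomp Require Import all_classical all_reals all_analysis.
From mathcomp Require Import measurable_realfun.
From mathcomp Require Import ring lra.

Set Implicit Arguments.
Unset Strict Implicit.
Unset Printing Implicit Defensive.

Import Order.TTheory GRing.Theory Num.Theory.
Import numFieldNormedType.Exports.

Local Open Scope classical_set_scope.
Local Open Scope ring_scope.

(** Multiply everything by [(p - 1) / (p F)].  The bound on the weak norm then
    says that [phi] has a smaller tail than [w(s) = (1 - 1/p) s^(-1/p)] on
    [(0, 1]], a function of integral 1 ([wtail], [dominated]); the mean becomes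
    [f1] and the level [l].

    Let [E] be the set where the maximal function is at least [l], and [de] its
    measure.  As [E] is a union of almost disjoint tree elements on which [phi]
    has average about [l], the integral of [phi] over [E] is at least [l de]
    ([weak_type]).  Conversely, every nonincreasing function on [(0, 1]] with
    average [l] on [(0, de]] can be rearranged on the space so that its maximal
    function is at least [l] on a set of measure nearly [de] ([realize]).  The
    problem therefore is to find the largest [de] for which some function
    dominated by [w], of mean [f1] and with integral at least [l de] over a set
    of measure [de], has energy (integral of the [q]-th power) [A'].

    For fixed [de] the least energy is found with Lagrange multipliers.  The
    candidates ([profile]) are constant on [(0, b]], equal to [w] on [(b, de]],
    constant on [(de, c]] and equal to [w] afterwards; their energy is
    [T_l(de) + F_l(de)] ([optimal_profile]).  The two constants are the
    multipliers of the integrals over [E] and over its complement, and the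
    pointwise constraint is paid for with a nondecreasing function of [phi], whose
    expectation is largest for [w] itself ([dominated_le],
    [energy_lower_bound]).  The same inequality with the multipliers of one [de]
    and the minimizer of another shows that the least energy has an affine
    minorant at each point ([energy_compare]).  So it is convex and lower
    semicontinuous, takes all intermediate values ([convex_IVT]), and increases
    strictly on [Delta] because the multiplier of the measure of [E] is positive
    ([slope_gt0]).  Hence the largest [de] is the one where the least energy
    equals [A'] ([B1_middle]).

    Two other regimes occur when [A'] exceeds all least energies on [Delta].
    Either the mean [f1] is the obstruction, and [de = f1 / l]; this happens as
    long as [A'] is at least the least energy of the functions supported on a set
    of that measure, which is [T_l(f1 / l)] ([B1_linear], [Tfull]).  Or the bound
    [w] is the obstruction, and [de = l^(-p)]; this happens as long as [A'] is at
    least the least energy of the functions equal to [w] on [(0, l^(-p)]]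
    ([B1_level], [Hsat]).  Both value functions are strictly monotone, so that
    the regimes are separated by the thresholds [l3] and [l1].  For [Hsat] this is
    again duality: the multiplier of one point is used at another, and the
    Lagrangian with a frozen multiplier is strictly increasing ([slab_gt0]).

    The domain of the problem is the range of the energies of dominated functions
    of mean [f1] ([energy_ge_base], [energy_upper_bound], [Tfull_root]). *)

(** * Powers and truncated tangents *)

Section powers.
Context {R : realType}.
Implicit Types x y v a b t : R.

Lemma powRDx x r s : 0 < x -> x `^ (r + s) = x `^ r * x `^ s.
Proof. by move=> x0; rewrite powRD// (gt_eqF x0) implybT. Qed.

Lemma powRK (k x : R) : 0 <= x -> k != 0 -> (x `^ k) `^ k^-1 = x.
Proof. by move=> x0 k0; rewrite -powRrM mulfV// powRr1. Qed.

Lemma powRVK (k x : R) : 0 <= x -> k != 0 -> (x `^ k^-1) `^ k = x.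
Proof. by move=> x0 k0; rewrite -powRrM mulVf// powRr1. Qed.

(** Young's inequality for the exponents [q] and [q / (q - 1)]. *)
Lemma powR_tangent (q x y : R) : 1 < q -> 0 <= x -> 0 <= y ->
  y `^ q + q * y `^ (q - 1) * (x - y) <= x `^ q.
Proof.
move=> q1 x0 y0.
have q0 : 0 < q by lra.
have q10 : 0 < q - 1 by lra.
have := @conjugate_powR R x (y `^ (q - 1)) q (q / (q - 1)) x0 (powR_ge0 _ _) q0.
rewrite divr_gt0// => /(_ isT).
have -> : q^-1 + (q / (q - 1))^-1 = 1 by field; rewrite !gt_eqF.
move=> /(_ erefl).
rewrite -powRrM.
have -> : (q - 1) * (q / (q - 1)) = q by field; rewrite gt_eqF.
rewrite -(ler_pM2l q0).
have -> : q * (x `^ q / q + y `^ q / (q / (q - 1))) = x `^ q + (q - 1) * y `^ q.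
  by field; rewrite !gt_eqF.
have -> : q * y `^ (q - 1) * (x - y) = q * (x * y `^ (q - 1)) - q * (y * y `^ (q - 1)).
  by ring.
rewrite mulr_powRB1//; lra.
Qed.

Lemma powR_lt q x y : 0 < q -> 0 <= x -> x < y -> x `^ q < y `^ q.
Proof.
by move=> q0 x0 xy; apply: gt0_ltr_powR => //; rewrite nnegrE//; lra.
Qed.

Lemma powR_le q x y : 0 <= q -> 0 <= x -> x <= y -> x `^ q <= y `^ q.
Proof.
by move=> q0 x0 xy; apply: ge0_ler_powR => //; rewrite nnegrE//; lra.
Qed.

(** Strictness comes from passing through the midpoint of [x] and [y]. *)
Lemma powR_tangent_lt (q x y : R) : 1 < q -> 0 <= x -> 0 <= y -> x != y ->
  y `^ q + q * y `^ (q - 1) * (x - y) < x `^ q.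
Proof.
move=> q1 x0 y0 xy; have q10 : 0 < q - 1 by lra.
pose u := (x + y) / 2.
have u0 : 0 <= u by rewrite /u; lra.
have h1 := powR_tangent q1 u0 y0.
have h2 := powR_tangent q1 x0 u0.
have xu : x - u = (x - y) / 2 by rewrite /u; field.
have uy : u - y = (x - y) / 2 by rewrite /u; field.
suff : 0 < q * (u `^ (q - 1) - y `^ (q - 1)) * ((x - y) / 2).
  by rewrite xu in h2; rewrite uy in h1; lra.
rewrite -mulrA; apply: mulr_gt0; first lra.
case: (ltgtP x y) xy => // xy _.
- rewrite nmulr_lgt0; last lra.
  by rewrite subr_lt0 powR_lt// /u; lra.
- by apply: mulr_gt0; [rewrite subr_gt0 powR_lt// /u; lra|lra].
Qed.

(** The tangent inequality of the convex power [k^-1], read at [x^k] and [y^k]. *)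
Lemma powR_concave_lt (k x y : R) : 0 < k < 1 -> 0 <= x -> 0 < y -> x != y ->
  x `^ k < y `^ k + k * y `^ (k - 1) * (x - y).
Proof.
move=> /andP[k0 k1] x0 y0 xy.
have k1' : 1 < k^-1 by rewrite invf_gt1.
have h := powR_tangent_lt k1' (powR_ge0 x k) (powR_ge0 y k).
have k0' : k != 0 by rewrite gt_eqF.
move: h; rewrite !powRK ?(ltW y0)// -powRrM => h.
have xk : x `^ k != y `^ k.
  case: (ltgtP x y) xy => // xy _; first by rewrite lt_eqF// powR_lt.
  by rewrite gt_eqF// powR_lt// ltW.
move: (h xk).
have -> : k * (k^-1 - 1) = 1 - k by field; rewrite gt_eqF.
have y1 : y `^ (1 - k) * y `^ (k - 1) = 1.
  rewrite -powRDx//; have -> : 1 - k + (k - 1) = 0 by ring.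
  by rewrite powRr0.
have yk := powR_gt0 (k - 1) y0.
rewrite -(ltr_pM2r (mulr_gt0 k0 yk)).
have -> : (y + k^-1 * y `^ (1 - k) * (x `^ k - y `^ k)) * (k * y `^ (k - 1)) =
  k * (y * y `^ (k - 1)) + k^-1 * k * (y `^ (1 - k) * y `^ (k - 1)) * (x `^ k - y `^ k).
  by ring.
rewrite y1 mulVf ?gt_eqF// mulr_powRB1// ?(ltW y0)//.
have -> : k * y `^ (k - 1) * (x - y) = x * (k * y `^ (k - 1)) - k * (y * y `^ (k - 1)) by ring.
by rewrite mulr_powRB1// ?(ltW y0)//; lra.
Qed.

Lemma powR_concave (k x y : R) : 0 < k < 1 -> 0 <= x -> 0 < y ->
  x `^ k <= y `^ k + k * y `^ (k - 1) * (x - y).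
Proof.
move=> k01 x0 y0; have [->|xy] := eqVneq x y; first by lra.
exact/ltW/powR_concave_lt.
Qed.

End powers.

(** [rtan q v w] is the largest value of [q v^(q-1) y - y^q] over [0 <= y <= w]:
    what a function bounded by [w] can gain against the multiplier [q v^(q-1)]. *)
Definition rtan {R : realType} (q v y : R) : R :=
  q * v `^ (q - 1) * Num.min v y - (Num.min v y) `^ q.

Section truncated_tangent.
Context {R : realType}.
Variable q : R.
Hypothesis q1 : 1 < q.
Implicit Types x y v w : R.

Ltac slra := have ? := q1; lra.

Lemma rtanE v y : y <= v -> rtan q v y = q * v `^ (q - 1) * y - y `^ q.
Proof. by move=> yv; rewrite /rtan min_r. Qed.

Lemma rtan_ge v y : 0 <= v -> v <= y -> rtan q v y = (q - 1) * v `^ q.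
Proof.
move=> v0 vy; rewrite /rtan min_l//.
have -> : q * v `^ (q - 1) * v = q * (v * v `^ (q - 1)) by ring.
by rewrite mulr_powRB1//; [ring|slra].
Qed.

Lemma rtan_line v x y : 0 <= x -> x <= y -> y <= v ->
  y `^ q - x `^ q <= q * v `^ (q - 1) * (y - x).
Proof.
move=> x0 xy yv.
have := powR_tangent q1 x0 (le_trans x0 xy).
have : q * y `^ (q - 1) * (y - x) <= q * v `^ (q - 1) * (y - x).
  rewrite ler_wpM2r ?subr_ge0// ler_wpM2l; first by [].
    slra.
  by apply: powR_le; slra.
slra.
Qed.

Lemma rtan_homo v x y : 0 <= v -> 0 <= x -> x <= y -> rtan q v x <= rtan q v y.
Proof.
move=> v0 x0 xy; rewrite /rtan.
have h : Num.min v x <= Num.min v y by rewrite le_min !ge_min lexx xy orbT.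
have h0 : 0 <= Num.min v x by rewrite le_min v0 x0.
have hv : Num.min v y <= v by rewrite ge_min lexx.
by have := rtan_line h0 h hv; slra.
Qed.

Lemma rtan_ge0 v y : 0 <= v -> 0 <= y -> 0 <= rtan q v y.
Proof.
move=> v0 y0; apply: le_trans (rtan_homo v0 (lexx 0) y0).
by rewrite /rtan min_r// powR0 ?mulr0 ?subrr//; slra.
Qed.

Lemma rtan_gt0 v y : 0 < v -> 0 < y -> 0 < rtan q v y.
Proof.
move=> v0 y0; rewrite /rtan.
set m := Num.min v y.
have m0 : 0 < m by rewrite /m lt_min v0 y0.
have mv : m <= v by rewrite /m ge_min lexx.
have h : m `^ (q - 1) <= v `^ (q - 1) by apply: powR_le => //; slra.
have <- : m * m `^ (q - 1) = m `^ q by rewrite mulr_powRB1//; slra.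
have mq : 0 < m `^ (q - 1) by rewrite powR_gt0.
have -> : q * v `^ (q - 1) * m - m * m `^ (q - 1) =
  m * ((q - 1) * m `^ (q - 1)+ q * (v `^ (q - 1) - m `^ (q - 1))) by ring.
apply: mulr_gt0 => //; apply: ltr_wpDr.
  by apply: mulr_ge0; slra.
by apply: mulr_gt0; slra.
Qed.

Lemma rtan_max v y : 0 <= v -> 0 <= y -> q * v `^ (q - 1) * y - y `^ q <= rtan q v y.
Proof.
move=> v0 y0; rewrite /rtan; case: (leP v y) => // vy.
have := powR_tangent q1 y0 v0; slra.
Qed.

(** A larger multiplier profits more from a larger bound. *)
Lemma rtan_sub_homo v v' x y : 0 <= v' -> v' <= v -> 0 <= x -> x <= y ->
  rtan q v x - rtan q v' x <= rtan q v y - rtan q v' y.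
Proof.
move=> v'0 v'v x0 xy; have v0 : 0 <= v by slra.
have low a b : 0 <= a -> a <= b -> b <= v' ->
    rtan q v a - rtan q v' a <= rtan q v b - rtan q v' b.
  move=> a0 ab bv'; rewrite !rtanE; [|slra..].
  have : q * v' `^ (q - 1) * (b - a) <= q * v `^ (q - 1) * (b - a).
    by rewrite ler_wpM2r ?subr_ge0// ler_wpM2l//; [slra|apply: powR_le; slra].
  slra.
have high a b : v' <= a -> a <= b ->
    rtan q v a - rtan q v' a <= rtan q v b - rtan q v' b.
  move=> va ab; rewrite (rtan_ge v'0 va) (rtan_ge v'0 (le_trans va ab)).
  by rewrite lerB// rtan_homo//; slra.
have [yv'|v'y] := leP y v'; first exact: low.
have [v'x|xv'] := leP v' x; first exact: high.
apply: (@le_trans _ _ (rtan q v v' - rtan q v' v')); first by apply: low => //; exact: ltW.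
by apply: high => //; exact: ltW.
Qed.

End truncated_tangent.

(** * Integrals of powers *)

Section distribution_functions.
Context {R : realType}.

(** The rays are stable under intersection and generate the Borel sets. *)
Lemma rays_determine (m1 m2 : {measure set (measurableTypeR R) -> \bar R}) :
  (m1 setT < +oo)%E -> (m2 setT < +oo)%E ->
  (forall t, m1 `]-oo, t]%classic = m2 `]-oo, t]%classic) ->
  forall A, measurable A -> m1 A = m2 A.
Proof.
move=> f1 f2 h A mA.
have fin (m : {measure set (measurableTypeR R) -> \bar R}) (B : set R) :
    (m setT < +oo)%E -> measurable B -> (m B < +oo)%E.
  by move=> mf mB; apply: le_lt_trans mf; apply: le_measure => //; rewrite inE.
have mitv (a b : R) : measurable (`]a, b]%classic : set (measurableTypeR R)).
  exact: measurable_itv.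
have mray (a : R) : measurable (`]-oo, a]%classic : set (measurableTypeR R)).
  exact: measurable_itv.
apply: (@measure_unique _ R (measurableTypeR R) (@ocitv R)
  (fun k => `]- k%:R, k%:R]%classic)).
- by [].
- exact: ocitvI.
- by move=> i; exists (- i%:R, i%:R).
- apply/seteqP; split => // x _.
  exists (Num.truncn `|x|).+1 => //=; rewrite in_itv/=.
  have h1 := truncnS_gt `|x|; have h2 := ler_norm x; have h3 := ler_norm (- x).
  by rewrite normrN in h3; apply/andP; split; lra.
- move=> _ [[a b] /= _ <-].
  have [ab|ba] := leP a b; last first.
    by rewrite set_itv_ge ?measure0// bnd_simp -leNgt ltW.
  have : `]a, b]%classic = `]-oo, b] `\` `]-oo, a] => [|->].
    by rewrite -[RHS]setCK setCD setCitvl setUC -[LHS]setCK setCitv.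
  rewrite !measureD//; [|exact: fin..].
  rewrite setIidr; last exact: subset_itvl.
  by congr (_ - _)%E; exact: h.
- by move=> k; exact: fin.
- by [].
Qed.

End distribution_functions.

Section power_integral.
Context {R : realType}.
Local Notation leb := (@lebesgue_measure R).

Lemma measurable_powRV (r : R) (D : set R) : measurable_fun D (EFin \o (fun s : R => s `^ r)).
Proof.
by apply/measurable_EFinP; apply: measurable_funTS; exact: measurable_powR.
Qed.

Lemma continuous_powR (r x : R) : 0 < x -> {for x, continuous (@powR R ^~ r)}.
Proof.
move=> x0; apply: differentiable_continuous; apply/derivable1_diffP.
by apply: derivable_powR; rewrite in_itv/= x0.
Qed.

Lemma integral_powR_cc (r a b : R) : 0 < r < 1 -> 0 < a -> a < b ->
  (\int[leb]_(s in `[a, b]) (s `^ (- r))%:E =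
   ((b `^ (1 - r) - a `^ (1 - r)) / (1 - r))%:E)%E.
Proof.
move=> /andP[r0 r1] a0 ab; have r1' : 1 - r != 0 by rewrite gt_eqF; lra.
pose F (s : R) := (1 - r)^-1 * s `^ (1 - r).
have dF (x : R) : 0 < x -> is_derive x 1 F (x `^ (- r)).
  move=> x0.
  have -> : x `^ (- r) = (1 - r)^-1 * ((1 - r) * x `^ ((1 - r) - 1)).
    by rewrite mulrA mulVf// mul1r; congr (_ `^ _); ring.
  apply: (is_deriveZ (1 - r)^-1 (is_derive1_powR (1 - r) x0)).
rewrite (@continuous_FTC2 _ _ F)//.
- by rewrite -EFinB /F; congr EFin; field.
- apply: continuous_in_subspaceT => x; rewrite inE/= in_itv/= => /andP[ax xb].
  by apply: continuous_powR; lra.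
- split => /=.
  + by move=> x; rewrite in_itv/= => /andP[ax _]; case: (dF x) => //; lra.
  + apply: cvg_at_right_filter; apply: differentiable_continuous.
    by apply/derivable1_diffP; case: (dF a).
  + apply: cvg_at_left_filter; apply: differentiable_continuous.
    by apply/derivable1_diffP; case: (dF b) => //; lra.
- move=> x; rewrite in_itv/= => /andP[ax _].
  by rewrite derive1E; apply: derive_val; apply: dF; lra.
Qed.

(** Monotone convergence on the intervals [[1 / n, b]], since the integrand is
    unbounded at 0. *)
Lemma integral_powR (r b : R) : 0 < r < 1 -> 0 <= b ->
  (\int[leb]_(s in `]0%R, b]) (s `^ (- r))%:E = (b `^ (1 - r) / (1 - r))%:E)%E.
Proof.
move=> r01; have /andP[r0 r1] := r01; rewrite le_eqVlt => /predU1P[<-|b0].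
  rewrite set_itvoc0 integral_set0 powR0 ?mul0r//.
  by rewrite gt_eqF; lra.
pose D (n : nat) : set R := `[b / n.+2%:R, b]%classic.
have -> : `]0, b]%classic = \bigcup_n D n.
  apply/seteqP; split => x /=.
  - rewrite in_itv/= => /andP[x0 xb].
    exists (Num.truncn (b / x)) => //; rewrite /D/= in_itv/= xb andbT.
    rewrite ler_pdivrMr// mulrC -ler_pdivrMr//.
    have := truncnS_gt (b / x) => /ltW/le_trans; apply.
    by rewrite ler_nat.
  - move=> [n _]; rewrite /D/= !in_itv/= => /andP[h ->]; rewrite andbT.
    by apply: lt_le_trans h; rewrite divr_gt0.
have c1 : (\int[leb]_(s in D n) (s `^ (- r))%:E @[n --> \oo] -->
   \int[leb]_(s in \bigcup_n D n) (s `^ (- r))%:E)%E.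
  apply: ge0_nondecreasing_set_cvg_integral => //.
  - apply/nondecreasing_seqP => n; rewrite subsetEset => x; rewrite /D/= !in_itv/=.
    move=> /andP[h ->]; rewrite andbT; apply: le_trans h.
    by rewrite ler_pM2l// lef_pV2 ?posrE// ler_nat.
  - by move=> n; exact: measurable_itv.
  - by move=> n; exact: measurable_powRV.
  - by move=> n x _; rewrite lee_fin powR_ge0.
apply: (cvg_unique _ c1) => //.
have -> : (fun n => \int[leb]_(s in D n) (s `^ (- r))%:E)%E =
  (fun n : nat => ((b `^ (1 - r) - (b / n.+2%:R) `^ (1 - r)) / (1 - r))%:E).
  apply/funext => n; rewrite /D integral_powR_cc//; first by rewrite divr_gt0.
  by rewrite ltr_pdivrMr// ltr_pMr// ltr1n.
apply: cvg_EFin; first exact: nearW.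
apply: cvgMl.
rewrite -[X in _ --> X]subr0; apply: cvgB; first exact: cvg_cst.
have /cvg_at_rightP := @powR_cvg0 R (1 - r) ltac:(lra).
apply; split; first by move=> n; rewrite divr_gt0.
rewrite -(mulr0 b); apply: cvgMr.
by have := @cvg_harmonic R; rewrite -cvg_shiftS.
Qed.

End power_integral.

(** * Expectations and uniform variables *)

Section expectation.
Context {R : realType} {d : measure_display} {X : measurableType d}.
Variable mu : probability X R.
Implicit Types (f g : X -> R) (P : X -> bool).
Local Notation E := (Rintegral mu setT).
Local Notation int f := (mu.-integrable setT (EFin \o f)).

Lemma int_measurable f : int f -> measurable_fun setT f.
Proof. by move=> /integrableP[/measurable_EFinP]. Qed.

Lemma E_EFin f : int f -> (\int[mu]_x (f x)%:E)%E = (E f)%:E.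
Proof. by move=> fi; rewrite /Rintegral fineK//; exact: integrable_fin_num. Qed.

Lemma int_ge0 f a : measurable_fun setT f -> (forall x, 0 <= f x) ->
  (\int[mu]_x (f x)%:E = a%:E)%E -> int f /\ E f = a.
Proof.
move=> mf f0 fa; split; last by rewrite /Rintegral fa.
apply/integrableP; split; first exact/measurable_EFinP.
under eq_integral do rewrite /= ger0_norm//.
by rewrite fa ltry.
Qed.

Lemma E_D f g : int f -> int g -> E (fun x => f x + g x) = E f + E g.
Proof. by move=> fi gi; exact: RintegralD. Qed.

Lemma E_B f g : int f -> int g -> E (fun x => f x - g x) = E f - E g.
Proof. by move=> fi gi; exact: RintegralB. Qed.

Lemma E_Z (k : R) f : int f -> E (fun x => k * f x) = k * E f.
Proof. by move=> fi; exact: RintegralZl. Qed.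

Lemma E_le f g : int f -> int g -> (forall x, f x <= g x) -> E f <= E g.
Proof. by move=> fi gi fg; apply: le_Rintegral => // x _; exact: fg. Qed.

Lemma int_D f g : int f -> int g -> int (fun x => f x + g x).
Proof. by move=> fi gi; have := integrableD measurableT fi gi. Qed.

Lemma int_B f g : int f -> int g -> int (fun x => f x - g x).
Proof. by move=> fi gi; have := integrableB measurableT fi gi. Qed.

Lemma int_Z (k : R) f : int f -> int (fun x => k * f x).
Proof. by move=> fi; have := integrableZl measurableT k fi; apply. Qed.

Lemma int_cst (k : R) : int (fun=> k).
Proof. exact: finite_measure_integrable_cst. Qed.

Lemma int_le f g : measurable_fun setT f -> int g ->
  (forall x, 0 <= f x <= g x) -> int f.
Proof.
move=> mf gi fg; apply: le_integrable gi => //; first exact/measurable_EFinP.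
move=> x _ /=; rewrite lee_fin; have /andP[f0 h] := fg x.
by rewrite !ger0_norm// (le_trans f0).
Qed.

Lemma measurable_fun_ind P : measurable [set x | P x] ->
  measurable_fun setT (fun x => (P x)%:R : R).
Proof.
move=> mP.
have -> : (fun x => (P x)%:R : R) = \1_[set x | P x].
  apply/funext => x; rewrite indicE.
  by have -> : (x \in [set x | P x]) = P x by apply/idP/idP; rewrite inE.
exact: measurable_indic.
Qed.

Lemma int_ind P : measurable [set x | P x] -> int (fun x => (P x)%:R).
Proof.
move=> mP; apply: (int_le _ (int_cst 1)); first exact: measurable_fun_ind.
by move=> x; case: (P x); rewrite ?ler01 ?lexx.
Qed.

Lemma E_ind P : measurable [set x | P x] ->
  E (fun x => (P x)%:R) = fine (mu [set x | P x]).
Proof.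
move=> mP; rewrite /Rintegral; congr fine.
rewrite -[in RHS](setIT [set x | P x]) -integral_indic//.
apply: eq_integral => x _; rewrite indicE.
by have -> : (x \in [set x | P x]) = P x by apply/idP/idP; rewrite inE.
Qed.

Lemma int_Mind f P : measurable [set x | P x] -> (forall x, 0 <= f x) ->
  int f -> int (fun x => f x * (P x)%:R).
Proof.
move=> mP f0 fi; apply: (int_le _ fi).
  by apply: measurable_funM; [exact: int_measurable|exact: measurable_fun_ind].
by move=> x; case: (P x); rewrite ?mulr1 ?mulr0 ?lexx f0.
Qed.

Lemma eq_E f g : f =1 g -> E f = E g.
Proof. by move=> /funext ->. Qed.

End expectation.

Section uniform.
Context {R : realType} {d : measure_display} {X : measurableType d}.
Variable mu : probability X R.
Local Notation E := (Rintegral mu setT).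
Local Notation int f := (mu.-integrable setT (EFin \o f)).
Local Notation leb := (@lebesgue_measure R).

Definition uniform01 (S : X -> R) := [/\ measurable_fun setT S,
  forall x, 0 < S x <= 1 &
  forall t, 0 <= t <= 1 -> mu [set x | S x <= t] = t%:E].

Variable S : X -> R.
Hypothesis uS : uniform01 S.

Lemma measurable_uniform_le t : measurable [set x | S x <= t].
Proof.
have [mS _ _] := uS; have := mS measurableT `]-oo, t]%classic (measurable_itv _).
rewrite setTI; congr measurable; apply/seteqP; split => x /=; by rewrite in_itv.
Qed.

Lemma E_uniform_le t : 0 <= t <= 1 -> E (fun x => (S x <= t)%R%:R) = t.
Proof.
have [_ _ h] := uS => t01; rewrite E_ind; last exact: measurable_uniform_le.
by rewrite h.
Qed.

(** The law of [S] and the Lebesgue measure of the unit interval agree on rays. *)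
Lemma uniform_law (h : R -> \bar R) : measurable_fun setT h -> (forall t, 0 <= h t)%E ->
  (\int[mu]_x h (S x) = \int[leb]_(s in `[0%R, 1%R]) h s)%E.
Proof.
move=> mh h0; have [mS S01 St] := uS.
have mS' : measurable_fun setT (S : X -> measurableTypeR R) := mS.
pose Sf : {mfun X >-> measurableTypeR R} := @mfun_Sub _ _ X (measurableTypeR R) S (mem_set mS').
have L (u : R) : 0 <= u -> leb `[0%R, u]%classic = u%:E.
  move=> u0; rewrite lebesgue_measure_itv/= lte_fin; case: ltP => h'; last first.
    by congr EFin; lra.
  by rewrite -EFinD subr0.
have key (A : set (measurableTypeR R)) : measurable A ->
    pushforward mu Sf A = uniform_prob (@ltr01 R) A.
  apply: rays_determine.
  - exact: (eq_ind_r (fun z => (z < +oo)%E) (ltry 1) (probability_setT mu)).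
  - exact: (eq_ind_r (fun z => (z < +oo)%E) (ltry 1) (probability_setT (uniform_prob (@ltr01 R)))).
  - move=> t; change (mu (S @^-1` `]-oo, t]%classic) =
      \int[leb]_(x in `]-oo, t]) (uniform_pdf 0 1 x)%:E)%E.
    have -> : S @^-1` `]-oo, t] = [set x | S x <= t].
      by apply/seteqP; split => x /=; rewrite in_itv.
    rewrite integral_uniform_pdf.
    rewrite (eq_integral (fun=> 1%:E)); last first.
      move=> x; rewrite inE/= !in_itv/= => -[_ x01].
      by rewrite /uniform_pdf x01 subr0 invr1.
    rewrite integral_cst ?mul1e; last by apply: measurableI; exact: measurable_itv.
    have [t0|t0] := ltP t 0.
      have -> : [set x | S x <= t] = set0.
        rewrite -subset0 => x /= Sxt; have := S01 x => /andP[? ?]; lra.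
      rewrite measure0; have -> : `]-oo, t] `&` `[0%R, 1%R] = set0.
        by rewrite -subset0 => x []/=; rewrite !in_itv/= => h1 /andP[h2 _]; lra.
      by rewrite measure0.
    have [t1|t1] := leP t 1.
      rewrite St ?t0//.
      have -> : `]-oo, t] `&` `[0%R, 1%R] = `[0%R, t]%classic.
        apply/seteqP; split => x /=; rewrite !in_itv/=.
          by move=> [-> /andP[->]].
        by move=> /andP[-> xt]; split => //=; lra.
      by apply/esym; exact: L.
    have -> : [set x | S x <= t] = setT.
      apply/seteqP; split => // x _ /=; have := S01 x => /andP[? ?]; lra.
    rewrite probability_setT.
    have -> : `]-oo, t] `&` `[0%R, 1%R] = `[0%R, 1%R]%classic.
      apply/seteqP; split => x /=; rewrite !in_itv/=.
        by move=> [].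
      by move=> /andP[-> xt]; split => //=; lra.
    by apply/esym; exact: (L _ ler01).
transitivity (\int[pushforward mu Sf]_y h y)%E.
  by rewrite ge0_integral_pushforward.
transitivity (\int[uniform_prob (@ltr01 R)]_y h y)%E.
  apply: eq_measure_integral => /= A mA _; exact: key.
by rewrite integral_uniform// subr0 invr1 mul1e.
Qed.

Lemma E_uniform_powR r b : 0 < r < 1 -> 0 <= b <= 1 ->
  int (fun x => (S x) `^ (- r) * (S x <= b)%R%:R) /\
  E (fun x => (S x) `^ (- r) * (S x <= b)%R%:R) = b `^ (1 - r) / (1 - r).
Proof.
move=> r01 /andP[b0 b1]; have [mS S01 St] := uS.
apply: int_ge0.
- apply: measurable_funM; last by apply: measurable_fun_ind; exact: measurable_uniform_le.
  by apply: (measurableT_comp (measurable_powR (- r))).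
- by move=> x; rewrite mulr_ge0 ?powR_ge0.
rewrite -integral_powR//.
have /= := @uniform_law (fun s => (s `^ (- r) * (s <= b)%R%:R)%:E).
move=> ->.
- rewrite [RHS]integral_mkcond [LHS]integral_mkcond; apply: eq_integral => s _.
  rewrite !patchE !mem_setE !in_itv/=.
  have [->|s0] := eqVneq s 0.
    by rewrite ltxx/= powR0 ?mul0r ?if_same//; lra.
  have [sb|bs] := leP s b; last by rewrite andbF mulr0 if_same.
  by rewrite mulr1 andbT (le_trans sb b1) andbT lt_neqAle eq_sym s0.
- apply/measurable_EFinP; apply: measurable_funM; first exact: measurable_powR.
  apply: measurable_fun_ind.
  have -> : [set x : R | (x <= b)%R : bool] = `]-oo, b]%classic.
    by apply/seteqP; split => x /=; rewrite in_itv.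
  exact: measurable_itv.
- by move=> t; rewrite lee_fin mulr_ge0 ?powR_ge0.
Qed.

End uniform.

(** * Functions below a power tail *)

Section weak_lp.
Context {R : realType} {d : measure_display} {X : measurableType d}.
Variable mu : probability X R.
Variables p q : R.
Hypotheses (q1 : 1 < q) (qp : q < p).
Local Notation E := (Rintegral mu setT).
Local Notation int f := (mu.-integrable setT (EFin \o f)).
Local Notation k := ((p - 1) / p).

Ltac plra := have ? := q1; have ? := qp; lra.

(** The largest nonincreasing function on [(0, 1]] allowed by the tail bound of
    [dominated].  Its integral is 1, which is what the factor [(p - 1) / p] is for. *)
Definition wtail (s : R) : R := k * s `^ (- p^-1).
Local Notation w := wtail.

Definition dominated (phi : X -> R) := [/\ measurable_fun setT phi,
  forall x, 0 <= phi x &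
  forall t, 0 < t -> (mu [set x | (t <= phi x)%R] <= ((k / t) `^ p)%:E)%E].

Let p0 : 0 < p. Proof. by plra. Qed.
Let k0 : 0 < k. Proof. by apply: divr_gt0; plra. Qed.
Let ip0 : 0 < p^-1. Proof. by rewrite invr_gt0. Qed.

Lemma wtail_ge0 s : 0 <= w s.
Proof. by rewrite mulr_ge0 ?powR_ge0// ltW. Qed.

Lemma wtail_gt0 s : 0 < s -> 0 < w s.
Proof. by move=> s0; rewrite mulr_gt0 ?powR_gt0. Qed.

Lemma powRN_lt r (s t : R) : 0 < r -> 0 < s -> s < t -> t `^ (- r) < s `^ (- r).
Proof.
move=> r0 s0 st; rewrite !powRN ltf_pV2 ?posrE ?powR_gt0//; last exact: lt_trans st.
by rewrite powR_lt// ltW.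
Qed.

Lemma wtail_lt s t : 0 < s -> s < t -> w t < w s.
Proof. by move=> s0 st; rewrite ltr_pM2l// powRN_lt. Qed.

Lemma wtail_le s t : 0 < s -> s <= t -> w t <= w s.
Proof.
by move=> s0; rewrite le_eqVlt => /predU1P[->//|st]; exact/ltW/wtail_lt.
Qed.

Lemma wtailK v : 0 < v -> w ((k / v) `^ p) = v.
Proof.
move=> v0; rewrite /w -powRrM mulrN mulfV ?gt_eqF// powR_inv1; last first.
  by rewrite divr_ge0// ltW.
by rewrite invf_div mulrCA mulfV ?mulr1// gt_eqF.
Qed.

Lemma lt_wtail v s : 0 < v -> 0 < s -> (v < w s) = (s < (k / v) `^ p).
Proof.
move=> v0 s0; have b0 : 0 < (k / v) `^ p := powR_gt0 p (divr_gt0 k0 v0).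
apply/idP/idP => h.
- rewrite ltNge; apply/negP => /(wtail_le b0); rewrite wtailK// leNgt.
  by rewrite h.
- by rewrite -{1}(wtailK v0) wtail_lt.
Qed.

Lemma measurable_wtail : measurable_fun setT w.
Proof. by apply: measurable_funM => //; exact: measurable_powR. Qed.

Variable S : X -> R.
Hypothesis uS : uniform01 mu S.
Let mS : measurable_fun setT S. Proof. by case: uS. Qed.
Let S0 x : 0 < S x. Proof. by case: uS => _ /(_ x)/andP[]. Qed.

Lemma measurable_wS : measurable_fun setT (w \o S).
Proof. exact: measurableT_comp measurable_wtail mS. Qed.

(** The tail of [w \o S] saturates the bound of [dominated], except at levels
    so low that it is everything. *)
Lemma wS_tail s : 0 <= s -> (1 <= mu [set x | (s < w (S x))%R])%E \/
  0 < s /\ (((k / s) `^ p)%:E <= mu [set x | (s < w (S x))%R])%E.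
Proof.
move=> s0; have mW : measurable [set x | s < w (S x)].
  have := measurable_wS measurableT (measurable_itv `]s, +oo[).
  rewrite setTI; congr measurable; apply/seteqP; split => x /=; by rewrite in_itv/= andbT.
have [_ _ hS] := uS.
have key b : 0 < b <= 1 -> (forall t, 0 < t < b -> s < w t) ->
    (b%:E <= mu [set x | (s < w (S x))%R])%E.
  move=> /andP[b0 b1] h; apply/lee_subgt0Pr => e e0.
  pose t := Num.max (b - e) (b / 2).
  have tb : t < b by rewrite /t gt_max; apply/andP; split; lra.
  have t0 : 0 < t by rewrite /t lt_max; apply/orP; right; lra.
  apply: (@le_trans _ _ t%:E); first by rewrite -EFinD lee_fin /t le_max lexx.
  rewrite -hS; last by lra.
  apply: le_measure; rewrite ?inE//; first exact: measurable_uniform_le uS _.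
  by move=> x /= xt; apply: h; rewrite S0; lra.
have [s00|s00] := leP s 0.
  left; apply: key; first by rewrite ltr01 lexx.
  by move=> t /andP[t0 _]; apply: le_lt_trans s00 _; exact: wtail_gt0.
have b0 : 0 < (k / s) `^ p := powR_gt0 p (divr_gt0 k0 s00).
have [b1|b1] := leP ((k / s) `^ p) 1.
  right; split => //; apply: key; first by rewrite b0.
  by move=> t /andP[t0 tb]; rewrite lt_wtail.
left; apply: key; first by rewrite ltr01 lexx.
by move=> t /andP[t0 t1]; rewrite lt_wtail// (lt_trans t1).
Qed.

(** Stochastic domination: the superlevel sets of [M] are rays, on which
    [phi] has at most the mass of [w \o S], and an expectation is the integral of
    the masses of the superlevel sets. *)
Lemma dominated_le (M : R -> R) phi : dominated phi -> measurable_fun setT M ->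
  (forall x, 0 <= x -> 0 <= M x) -> (forall x y, 0 <= x -> x <= y -> M x <= M y) ->
  int (M \o w \o S) -> int (M \o phi) /\ E (M \o phi) <= E (M \o w \o S).
Proof.
move=> [mphi phi0 phit] mM M0 Mnd iW.
have mMphi : measurable_fun setT (M \o phi) by exact: measurableT_comp mphi.
have mMW : measurable_fun setT (M \o w \o S) := int_measurable iW.
pose X1 : {RV mu >-> R} := mfun_Sub (mem_set mMphi).
pose X2 : {RV mu >-> R} := mfun_Sub (mem_set mMW).
have h : (\int[mu]_x ((M \o phi) x)%:E <= \int[mu]_x ((M \o w \o S) x)%:E)%E.
  have e1 : forall x, 0 <= X1 x by move=> x; exact: M0.
  have e2 : forall x, 0 <= X2 x by move=> x; apply: M0; exact: wtail_ge0.
  have E1 := ge0_expectation_ccdf e1; have E2 := ge0_expectation_ccdf e2.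
  rewrite expectation_def in E1; rewrite expectation_def in E2.
  rewrite [leLHS](_ : _ = (\int[@lebesgue_measure R]_(r in `[0%R, +oo[) ccdf X1 r)%E); last exact: E1.
  rewrite [leRHS](_ : _ = (\int[@lebesgue_measure R]_(r in `[0%R, +oo[) ccdf X2 r)%E); last exact: E2.
  apply: ge0_le_integral => //.
  - by apply: measurable_funTS; exact: ccdf_measurable.
  - by apply: measurable_funTS; exact: ccdf_measurable.
  move=> r; rewrite /= in_itv/= andbT => r0.
  have mphr : measurable [set x | r < M (phi x)].
    have := mMphi measurableT _ (measurable_itv `]r, +oo[).
    rewrite setTI; congr measurable; apply/seteqP; split => x /=; by rewrite in_itv/= andbT.
  have mWr : measurable [set x | r < M (w (S x))].
    have := mMW measurableT _ (measurable_itv `]r, +oo[).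
    rewrite setTI; congr measurable; apply/seteqP; split => x /=; by rewrite in_itv/= andbT.
  suff : (mu [set x | (r < M (phi x))%R] <= mu [set x | (r < M (w (S x)))%R])%E.
    rewrite /ccdf /distribution /pushforward; congr (_ <= _)%E; congr (mu _);
      by apply/seteqP; split => x /=; rewrite in_itv/= andbT.
  pose U := [set y | 0 <= y /\ r < M y].
  have [U0|/set0P[y0 Uy0]] := eqVneq U set0.
    have -> : [set x | (r < M (phi x))%R] = set0.
      rewrite -subset0 => x /= h'; have : U (phi x) by split.
      by rewrite U0.
    by rewrite measure0.
  have lbU : lbound U 0 by move=> y [].
  pose s := inf U.
  have s0 : 0 <= s by apply: lb_le_inf => //; exists y0.
  have Us y : U y -> s <= y by move=> Uy; apply: ge_inf => //; exists 0.
  have sU y : s < y -> U y.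
    move=> sy; have [z [z0 rz] zy] := inf_lt (ex_intro _ y0 Uy0) sy.
    by split; [lra|apply: lt_le_trans rz _; apply: Mnd => //; exact: ltW].
  have mWs : measurable [set x | (s < w (S x))%R].
    have := measurable_wS measurableT (measurable_itv `]s, +oo[).
    rewrite setTI; congr measurable; apply/seteqP; split => x /=; by rewrite in_itv/= andbT.
  have mphs : measurable [set x | (s <= phi x)%R].
    have := mphi measurableT _ (measurable_itv `[s, +oo[).
    rewrite setTI; congr measurable; apply/seteqP; split => x /=; by rewrite in_itv/= andbT.
  apply: (@le_trans _ _ (mu [set x | (s <= phi x)%R])).
    by apply: le_measure; rewrite ?inE// => x /= h; apply: Us; split.
  apply: (@le_trans _ _ (mu [set x | (s < w (S x))%R])); last first.
    by apply: le_measure; rewrite ?inE// => x /= /sU[].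
  have [h|[s1 h]] := wS_tail s0; first by apply: le_trans h; exact: probability_le1.
  by apply: le_trans h; exact: phit.
have iphi : int (M \o phi).
  apply/integrableP; split; first exact/measurable_EFinP.
  under eq_integral do rewrite /= ger0_norm ?M0//.
  apply: le_lt_trans h _; rewrite (E_EFin iW); exact: ltry.
split => //; rewrite -lee_fin -!E_EFin//.
Qed.

End weak_lp.

(** * The minimal energy under a pointwise price *)

Section price.
Context {R : realType}.
Variables q v v' om : R.
Hypotheses (q1 : 1 < q) (v'0 : 0 <= v') (v'v : v' <= v) (om0 : 0 < om).

Let v0 : 0 <= v. Proof. exact: le_trans v'0 v'v. Qed.

(** What the pointwise bound on a function taking the value [y] is worth, when
    [v] is the multiplier of the integral over the exceptional set and [v'] that
    of the integral over its complement; [om] is the threshold between the two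
    parts.  It is nondecreasing, so that stochastic domination applies to it. *)
Definition price (y : R) : R :=
  Num.max (rtan q v y - rtan q v om) 0 + rtan q v' (Num.min y om).

Lemma price_ge0 y : 0 <= y -> 0 <= price y.
Proof.
move=> y0; rewrite /price addr_ge0// ?le_max ?lexx ?orbT// rtan_ge0//.
by rewrite le_min y0 ltW.
Qed.

Lemma price_homo x y : 0 <= x -> x <= y -> price x <= price y.
Proof.
move=> x0 xy; rewrite /price lerD//.
  by rewrite ge_max !le_max lexx orbT lerB// rtan_homo.
rewrite rtan_homo//; first by rewrite le_min x0 ltW.
by rewrite le_min !ge_min xy lexx orbT.
Qed.

Lemma measurable_rtan u : measurable_fun setT (rtan q u).
Proof.
have mm : measurable_fun setT (fun y : R => Num.min u y) by apply: measurable_minr.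
apply: measurable_funB; first exact: measurable_funM.
exact: (measurableT_comp (measurable_powR q)).
Qed.

Lemma measurable_price : measurable_fun setT price.
Proof.
apply: measurable_funD.
  by apply: measurable_maxr => //; apply: measurable_funB => //; exact: measurable_rtan.
by apply: (measurableT_comp (measurable_rtan v')); apply: measurable_minr.
Qed.

Lemma price_hi y : om <= y -> price y = rtan q v y - (rtan q v om - rtan q v' om).
Proof.
move=> omy; rewrite /price max_l ?subr_ge0 ?rtan_homo// ?(ltW om0)//.
by rewrite min_r//; ring.
Qed.

Lemma price_lo y : 0 <= y -> y <= om -> price y = rtan q v' y.
Proof.
move=> y0 yom; rewrite /price max_r ?subr_le0 ?rtan_homo//.
by rewrite min_l// add0r.
Qed.

Lemma price_ge (b : bool) y : 0 <= y ->
  q * v `^ (q - 1) * (y * b%:R) - (rtan q v om - rtan q v' om) * b%:R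
  + q * v' `^ (q - 1) * (y - y * b%:R) - y `^ q <= price y.
Proof.
move=> y0; have hv := rtan_max q1 v0 y0; have hv' := rtan_max q1 v'0 y0.
case: b; rewrite ?mulr1 ?mulr0 ?subrr ?mulr0 ?subr0 ?addr0 ?sub0r ?oppr0 ?add0r.
- have [yom|/ltW omy] := leP y om; last by rewrite price_hi// addrAC lerD2r.
  rewrite price_lo//.
  have := rtan_sub_homo q1 v'0 v'v y0 yom; lra.
- have [yom|/ltW omy] := leP y om; first by rewrite price_lo.
  rewrite price_hi//.
  have := rtan_sub_homo q1 v'0 v'v (ltW om0) omy; lra.
Qed.

End price.

Section extremal_energy.
Context {R : realType} {d : measure_display} {X : measurableType d}.
Variable mu : probability X R.
Variables p q : R.
Hypotheses (q1 : 1 < q) (qp : q < p).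
Local Notation E := (Rintegral mu setT).
Local Notation int f := (mu.-integrable setT (EFin \o f)).
Local Notation k := ((p - 1) / p).
Local Notation kk := (1 - p^-1).
Local Notation kq := (1 - q / p).
Local Notation G := (Gam p q).
Local Notation w := (wtail p).
Local Notation dom := (dominated mu p).

Ltac plra := have ? := q1; have ? := qp; lra.

Let p0 : 0 < p. Proof. by plra. Qed.
Let k0 : 0 < k. Proof. by apply: divr_gt0; plra. Qed.
Let kE : k = kk. Proof. by field; rewrite gt_eqF. Qed.
Let ip01 : 0 < p^-1 < 1. Proof. by rewrite invr_gt0 p0 invf_lt1//; plra. Qed.
Let qp01 : 0 < q / p < 1.
Proof. by rewrite divr_gt0 ?ltr_pdivrMr ?mul1r//; plra. Qed.

Ltac plra ::= have ? := q1; have ? := qp; have ? := ip01; have ? := qp01; lra.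

Variable S : X -> R.
Hypothesis uS : uniform01 mu S.
Let mS : measurable_fun setT S. Proof. by case: uS. Qed.
Let S0 x : 0 < S x. Proof. by case: uS => _ /(_ x)/andP[]. Qed.
Let S1 x : S x <= 1. Proof. by case: uS => _ /(_ x)/andP[]. Qed.

Ltac int_tac := repeat first [exact: int_cst | assumption | apply: int_B
  | apply: int_D | apply: int_Z].

Ltac E_tac := repeat (match goal with
  | |- context [Rintegral _ _ (fun x => @?f x - @?g x)] =>
      rewrite (@E_B _ _ _ mu f g); [|by int_tac|by int_tac]
  | |- context [Rintegral _ _ (fun x => @?f x + @?g x)] =>
      rewrite (@E_D _ _ _ mu f g); [|by int_tac|by int_tac]
  | |- context [Rintegral _ _ (fun x => ?a * @?f x)] =>
      rewrite (@E_Z _ _ _ mu a f); [|by int_tac]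
  end; cbv beta).

Local Notation below b := (fun x => (S x <= b)%R%:R : R).

Lemma wtail_powRq s : 0 < s -> (w s) `^ q = k `^ q * s `^ (- (q / p)).
Proof.
move=> s0; rewrite /wtail powRM ?powR_ge0 ?(ltW k0)// -powRrM.
by congr (_ * _ `^ _); rewrite mulNr mulrC.
Qed.

Lemma int_ind_le b : int (below b).
Proof. by apply: int_ind; exact: measurable_uniform_le uS _. Qed.

Lemma E_wS b : 0 <= b <= 1 -> int (fun x => w (S x) * (below b) x) /\
  E (fun x => w (S x) * (below b) x) = b `^ kk.
Proof.
move=> b01; have [i e] := E_uniform_powR uS ip01 b01.
have -> : (fun x => w (S x) * (below b) x) = (fun x => k * (S x `^ (- p^-1) * (below b) x)).
  by apply/funext => x; rewrite /wtail mulrA.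
split; first by int_tac.
by rewrite E_Z// e -kE mulrCA divff ?mulr1// gt_eqF.
Qed.

Lemma E_wSq b : 0 <= b <= 1 -> int (fun x => (w (S x)) `^ q * (below b) x) /\
  E (fun x => (w (S x)) `^ q * (below b) x) = G * b `^ kq.
Proof.
move=> b01; have [i e] := E_uniform_powR uS qp01 b01.
have -> : (fun x => (w (S x)) `^ q * (below b) x) =
    (fun x => k `^ q * (S x `^ (- (q / p)) * (below b) x)).
  by apply/funext => x; rewrite wtail_powRq// mulrA.
split; first by int_tac.
rewrite E_Z// e /Gam; field.
by apply/andP; split; rewrite gt_eqF//; plra.
Qed.

Lemma int_wS : int (w \o S).
Proof.
have [+ _] := @E_wS 1 ltac:(lra); congr (mu.-integrable _ (_ \o _)).
by apply/funext => x; rewrite S1 mulr1.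
Qed.

Lemma dominated_int phi : dom phi -> int phi /\ E phi <= 1.
Proof.
move=> dphi.
have [] := @dominated_le _ _ _ mu p q q1 qp S uS id phi dphi => //.
- exact: int_wS.
move=> i h; split=> //; apply: (le_trans h).
have [_ e] := @E_wS 1 ltac:(lra).
rewrite powR1 in e; rewrite -e.
by rewrite le_eqVlt; apply/orP; left; apply/eqP/eq_E => x /=; rewrite S1 mulr1.
Qed.

(** Only the part of [phi] above [w dl] exceeds [w dl] times the mass of the set,
    and stochastic domination bounds it by the part of [w] above [w dl]. *)
Lemma dominated_set phi (P : X -> bool) dl : dom phi -> measurable [set x | P x] ->
  mu [set x | P x] = dl%:E -> 0 < dl <= 1 -> E (fun x => phi x * (P x)%:R) <= dl `^ kk.
Proof.
move=> dphi mP muP /andP[dl0 dl1].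
have [mphi phi0 _] := dphi; have [iphi _] := dominated_int dphi.
pose K := w dl; pose M (y : R) := Num.max (y - K) 0.
have mM : measurable_fun setT M.
  by apply: measurable_maxr => //; apply: measurable_funB.
have dl01 : 0 <= dl <= 1 by lra.
have [iW eW] := E_wS dl01.
have i1 := int_ind_le dl.
have MW : M \o w \o S = (fun x => w (S x) * (below dl) x - K * (below dl) x).
  apply/funext => x /=; rewrite /M; have [h|h] := leP (S x) dl.
    by rewrite !mulr1 max_l// subr_ge0 (wtail_le q1 qp).
  by rewrite !mulr0 subr0 max_r// subr_le0 (wtail_le q1 qp)// ltW.
have iMW : int (M \o w \o S) by rewrite MW; int_tac.
have M0 x : 0 <= M x by rewrite /M le_max lexx orbT.
have Mnd x y : 0 <= x -> x <= y -> M x <= M y.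
  by move=> _ xy; rewrite /M; rewrite ge_max !le_max lexx orbT lerB.
have [iM] := dominated_le q1 qp uS dphi mM (fun x _ => M0 x) Mnd iMW.
rewrite MW E_B; [|by int_tac..].
rewrite E_Z// eW E_uniform_le//.
have iP := int_ind mu mP.
have iphiP := int_Mind mP phi0 iphi.
have : E (fun x => phi x * (P x)%:R) <= E (fun x => K * (P x)%:R + (M \o phi) x).
  apply: E_le => //; first by int_tac.
  move=> x /=; rewrite /M; case: (P x); rewrite ?mulr1 ?mulr0.
    by rewrite -lerBlDl le_max lexx.
  by rewrite add0r le_max lexx orbT.
rewrite E_D; [|by int_tac..]; rewrite E_Z// E_ind// muP /=.
by move=> h1 h2; have := le_trans h1 (lerD (lexx _) h2); rewrite addrCA subrr addr0.
Qed.

(** The tangent line at the extremal function with multiplier [K] dominates the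
    power: [y^q <= K y + (y^q - K y)^+], and the positive part is increasing. *)
Lemma energy_upper_bound phi : dom phi -> int (fun x => phi x `^ q) -> 0 < E phi ->
  E (fun x => phi x `^ q) <= G * (E phi) `^ (kq / kk).
Proof.
move=> dphi iphiq f0.
have [mphi phi0 _] := dphi; have [iphi f1] := dominated_int dphi.
have kk0 : 0 < kk by plra.
pose be := (E phi) `^ (kk^-1).
have be0 : 0 < be by rewrite powR_gt0.
have be1 : be <= 1.
  have : 0 <= kk^-1 by rewrite invr_ge0 ltW.
  by move=> /powR_le /(_ (ltW f0) f1); rewrite powR1.
have be01 : 0 <= be <= 1 by lra.
have bek : be `^ kk = E phi by rewrite /be powRVK ?gt_eqF// ltW.
have wb0 := wtail_gt0 q1 qp be0.
pose K := (w be) `^ (q - 1); pose M (y : R) := Num.max (y `^ q - K * y) 0.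
have [iW eW] := E_wS be01; have [iWq eWq] := E_wSq be01.
have mM : measurable_fun setT M.
  apply: measurable_maxr => //; apply: measurable_funB; first exact: measurable_powR.
  exact: measurable_funM.
have low y : 0 <= y -> y <= w be -> y `^ q - K * y <= 0.
  move=> y0 yw; rewrite -mulr_powRB1//; last by plra.
  by rewrite mulrC -mulrBl mulr_le0_ge0// subr_le0 powR_le//; plra.
have high y z : 0 <= y -> w be <= y -> y <= z -> y `^ q - K * y <= z `^ q - K * z.
  move=> y0 wy yz; have q0 : 0 < q by plra.
  have h : y `^ (q - 1) <= z `^ (q - 1) by rewrite powR_le//; plra.
  have h' : K <= y `^ (q - 1) by rewrite powR_le// ?(ltW wb0)//; plra.
  rewrite -(mulr_powRB1 y0)// -(mulr_powRB1 (le_trans y0 yz))//.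
  rewrite ![K * _]mulrC -!mulrBr; apply: ler_pM => //; first by rewrite subr_ge0.
  by rewrite lerB.
have MW : M \o w \o S = (fun x => (w (S x)) `^ q * (below be) x - K * (w (S x) * (below be) x)).
  apply/funext => x /=; rewrite /M; have [h|h] := leP (S x) be.
    rewrite max_l; first by rewrite /=; ring.
    have := high _ _ (ltW wb0) (lexx _) (wtail_le q1 qp (S0 x) h).
    by rewrite /K -{1}(mulr_powRB1 (ltW wb0)) ?[w be * _]mulrC ?subrr//; plra.
  rewrite max_r; first by rewrite /=; ring.
  apply: low; first exact: wtail_ge0 q1 qp _.
  by rewrite (wtail_le q1 qp)// ltW.
have iMW : int (M \o w \o S) by rewrite MW; int_tac.
have M0 x : 0 <= M x by rewrite /M le_max lexx orbT.
have Mnd x y : 0 <= x -> x <= y -> M x <= M y.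
  move=> x0 xy; have [xw|/ltW xw] := leP x (w be).
    by rewrite {1}/M max_r// low.
  rewrite /M ge_max; apply/andP; split; last by rewrite le_max lexx orbT.
  by rewrite le_max high.
have [iM] := dominated_le q1 qp uS dphi mM (fun x _ => M0 x) Mnd iMW.
rewrite MW E_B; [|by int_tac..].
rewrite E_Z// eW eWq bek => h.
have h2 : E (fun x => phi x `^ q) <= E (fun x => K * phi x + (M \o phi) x).
  apply: E_le => //; first by int_tac.
  by move=> x /=; rewrite -lerBlDl /M le_max lexx.
rewrite E_D in h2; [|by int_tac..]; rewrite E_Z// in h2.
have -> : (E phi) `^ (kq / kk) = be `^ kq by rewrite /be -powRrM mulrC.
lra.
Qed.

(** Lagrangian bound.  The candidate minimizer takes the value [v] on [(0, b]],
    follows [w] on [(b, al]], takes the value [v'] on [(al, c]] and follows [w]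
    again on [(c, 1]]. *)
Lemma energy_lower_bound phi (P : X -> bool) v v' b al c :
  dom phi -> int (fun x => phi x `^ q) -> measurable [set x | P x] ->
  0 < b -> b <= al -> al <= c -> c <= 1 -> 0 <= v' -> v' <= v ->
  v <= w b -> (b < al -> w b <= v) ->
  (al < c -> v' <= w c) -> (c < 1 -> w c <= v') ->
  v `^ q * b + G * (al `^ kq - b `^ kq) + v' `^ q * (c - al) + G * (1 - c `^ kq)
  + q * v `^ (q - 1) *
    (E (fun x => phi x * (P x)%:R) - (v * b + al `^ kk - b `^ kk))
  + q * v' `^ (q - 1) *
    (E phi - E (fun x => phi x * (P x)%:R) - (v' * (c - al) + 1 - c `^ kk))
  - (fine (mu [set x | P x]) - al) * (rtan q v (w al) - rtan q v' (w al))
  <= E (fun x => phi x `^ q).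
Proof.
move=> dphi iphiq mP b0 bal alc c1 v'0 v'v vb bv v'c cv'.
have [mphi phi0 _] := dphi; have [iphi _] := dominated_int dphi.
have v0 : 0 <= v by lra.
have al0 : 0 < al by lra.
pose om := w al; have om0 : 0 < om := wtail_gt0 q1 qp al0.
pose M := price q v v' om; pose lead := rtan q v om - rtan q v' om.
have MW : M \o w \o S = (fun x => (q - 1) * v `^ q * (below b) x
    + q * v `^ (q - 1) * (w (S x) * (below al) x - w (S x) * (below b) x)
    - (w (S x) `^ q * (below al) x - w (S x) `^ q * (below b) x) - lead * (below al) x
    + (q - 1) * v' `^ q * ((below c) x - (below al) x)
    + q * v' `^ (q - 1) * (w (S x) * (below 1) x - w (S x) * (below c) x)
    - (w (S x) `^ q * (below 1) x - w (S x) `^ q * (below c) x)).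
  apply/funext => x; rewrite /= S1 /M /lead.
  have [Sal|alS] := leP (S x) al.
    rewrite (price_hi q1 v'0 v'v om0); last by rewrite (wtail_le q1 qp).
    rewrite (le_trans Sal alc).
    have [Sb|bS] := leP (S x) b.
      rewrite rtan_ge//; last by apply: le_trans vb _; rewrite (wtail_le q1 qp).
      by rewrite /=; ring.
    rewrite rtanE//; first by rewrite /=; ring.
    by apply: le_trans (bv _); [rewrite (wtail_le q1 qp)// ltW|lra].
  rewrite (price_lo q1 v'0 v'v) ?(wtail_ge0 q1 qp)//; last by rewrite (wtail_le q1 qp)// ltW.
  rewrite (lt_geF (le_lt_trans bal alS)).
  have [Sc|cS] := leP (S x) c.
    rewrite rtan_ge//; first by rewrite /=; ring.
    by apply: le_trans (v'c _) _; [lra|rewrite (wtail_le q1 qp)].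
  rewrite rtanE//; first by rewrite /=; ring.
  apply: le_trans (cv' _); last by have := S1 x; lra.
  by rewrite (wtail_le q1 qp)//; lra.
have b01 : 0 <= b <= 1 by lra.
have al01 : 0 <= al <= 1 by lra.
have c01 : 0 <= c <= 1 by lra.
have [iWb eWb] := E_wS b01; have [iWqb eWqb] := E_wSq b01.
have [iWa eWa] := E_wS al01; have [iWqa eWqa] := E_wSq al01.
have [iWc eWc] := E_wS c01; have [iWqc eWqc] := E_wSq c01.
have i01 : 0 <= (1 : R) <= 1 by rewrite ler01 lexx.
have [iW1 eW1] := E_wS i01.
have [iWq1 eWq1] := E_wSq i01.
have ib := int_ind_le b; have ia := int_ind_le al; have ic := int_ind_le c.
have eb := E_uniform_le uS b01; have ea := E_uniform_le uS al01.
have ec := E_uniform_le uS c01.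
have iMW : int (M \o w \o S) by rewrite MW; int_tac.
have [||iM] := dominated_le q1 qp uS dphi (measurable_price q v v' om) _ _ iMW.
- by move=> y; exact: price_ge0.
- by move=> y z; exact: price_homo.
rewrite MW.
E_tac.
rewrite eWb eWa eWc eW1 eWqb eWqa eWqc eWq1 eb ea ec !powR1.
have iP := int_ind mu mP.
have iphiP := int_Mind mP phi0 iphi.
have low : E (fun x => q * v `^ (q - 1) * (phi x * (P x)%:R) - lead * (P x)%:R
     + q * v' `^ (q - 1) * (phi x - phi x * (P x)%:R) - phi x `^ q) <= E (M \o phi).
  apply: E_le => //; first by int_tac.
  by move=> x; exact: price_ge.
move: low.
E_tac.
rewrite (E_ind mu mP).
have vv : v * v `^ (q - 1) = v `^ q by rewrite mulr_powRB1// (lt_trans ltr01 q1).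
have vv' : v' * v' `^ (q - 1) = v' `^ q by rewrite mulr_powRB1// (lt_trans ltr01 q1).
rewrite -/om -/lead -vv -vv'.
move=> h1 h2; have h3 := le_trans h1 h2.
lra.
Qed.

(** The shape of the minimizers: constant [v] on [(0, b]], the bound [w] on
    [(b, al]], constant [v'] on [(al, c]], the bound [w] again up to 1. *)
Definition profile (v b al v' c s : R) : R :=
  if s <= b then v else if s <= al then w s else if s <= c then v' else w s.

(** The conditions that make [profile] monotone, below [w], and optimal for the
    multipliers [v] and [v']; degenerate plateaus make some of them void. *)
Record is_profile (v b al v' c : R) : Prop := {
  profile_b0 : 0 <= b;
  profile_b_al : b <= al;
  profile_al_c : al <= c;
  profile_c0 : 0 < c;
  profile_c1 : c <= 1;
  profile_v0 : 0 <= v;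
  profile_v'0 : 0 <= v';
  profile_vb : 0 < b -> v <= w b;
  profile_bv : 0 < b -> b < al -> w b <= v;
  profile_v'c : al < c -> v' <= w c;
  profile_cv' : c < 1 -> w c <= v';
  profile_v'v : 0 < b -> v' <= v;
  profile_v'al : b < al -> v' <= w al }.

(** The integrals of [profile] over [(0, al]] and over [(al, 1]]. *)
Definition head (v b al : R) : R := v * b + al `^ kk - b `^ kk.
Definition rest (al v' c : R) : R := v' * (c - al) + 1 - c `^ kk.
(** The integral of [profile ^ q]. *)
Definition energy (v b al v' c : R) : R :=
  v `^ q * b + G * (al `^ kq - b `^ kq) + v' `^ q * (c - al) + G * (1 - c `^ kq).

Section one_profile.
Variables v b al v' c : R.
Hypothesis hP : is_profile v b al v' c.
Local Notation g := (profile v b al v' c).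

Lemma profile_ge0 s : 0 <= g s.
Proof.
rewrite /profile; case: ifP => _; first exact: profile_v0 hP.
case: ifP => _; first exact: wtail_ge0 q1 qp _.
by case: ifP => _; [exact: profile_v'0 hP|exact: wtail_ge0 q1 qp _].
Qed.

Lemma measurable_profile : measurable_fun setT g.
Proof.
have mle (t : R) : measurable_fun setT (fun s : R => s <= t).
  by apply: measurable_fun_ler.
apply: measurable_fun_ifT => //; apply: measurable_fun_ifT => //.
  exact: measurable_wtail.
by apply: measurable_fun_ifT => //; exact: measurable_wtail.
Qed.

Lemma profile_le_wtail s : 0 < s -> g s <= w s.
Proof.
move=> s0; rewrite /profile; case: ifP => [sb|_].
  by apply: le_trans (profile_vb hP _) _; [lra|exact: (wtail_le q1 qp)].
case: ifPn => // als; case: ifP => // sc; rewrite -ltNge in als.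
by apply: le_trans (profile_v'c hP _) _; [lra|exact: (wtail_le q1 qp)].
Qed.

Lemma profile_nonincreasing s t : 0 < s -> s <= t -> t <= 1 -> g t <= g s.
Proof.
move=> s0 st t1; have h2 := profile_b_al hP; have h3 := profile_al_c hP.
have wst := wtail_le q1 qp s0 st.
have late x : c < x -> x <= 1 -> w x <= v'.
  move=> cx x1; have c0 := profile_c0 hP.
  apply: le_trans (profile_cv' hP _); last by lra.
  by apply: (wtail_le q1 qp) => //; exact: ltW.
rewrite /profile; have [sb|bs] := leP s b.
  have b0 : 0 < b by lra.
  have v'v := profile_v'v hP b0.
  have [//|bt] := leP t b; have [tal|alt] := leP t al.
    by apply: le_trans (profile_bv hP b0 _); [apply: (wtail_le q1 qp) => //; exact: ltW|lra].
  by have [//|ct] := leP t c; apply: le_trans v'v; exact: late.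
rewrite (lt_geF (lt_le_trans bs st)); have [sal|als] := leP s al.
  have [//|alt] := leP t al; have [tc|ct] := leP t c => //.
  by apply: le_trans (profile_v'al hP _) _; [lra|exact: (wtail_le q1 qp)].
rewrite (lt_geF (lt_le_trans als st)); have [sc|cs] := leP s c.
  by have [//|ct] := leP t c; exact: late.
by rewrite (lt_geF (lt_le_trans cs st)).
Qed.

(** A function of a profile is integrated piecewise, so that it suffices to know
    the integrals [Psi] of its values along [w]. *)
Lemma E_profile_comp (F Psi : R -> R) :
  (forall t, 0 <= t <= 1 -> int (fun x => F (w (S x)) * below t x) /\
     E (fun x => F (w (S x)) * below t x) = Psi t) ->
  int (F \o g \o S) /\
  E (F \o g \o S) = F v * b + (Psi al - Psi b) + F v' * (c - al) + (Psi 1 - Psi c).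
Proof.
move=> hF; have h1 := profile_b0 hP; have h2 := profile_b_al hP.
have h3 := profile_al_c hP; have h4 := profile_c1 hP.
have b01 : 0 <= b <= 1 by lra.
have al01 : 0 <= al <= 1 by lra.
have c01 : 0 <= c <= 1 by lra.
have [ib eb] := hF _ b01; have [ia ea] := hF _ al01; have [ic ec] := hF _ c01.
have [i1 e1] := hF 1 ltac:(lra).
have jb := int_ind_le b; have ja := int_ind_le al; have jc := int_ind_le c.
have fb := E_uniform_le uS b01; have fa := E_uniform_le uS al01.
have fc := E_uniform_le uS c01.
have -> : F \o g \o S = (fun x => F v * below b x
   + (F (w (S x)) * below al x - F (w (S x)) * below b x)
   + F v' * (below c x - below al x)
   + (F (w (S x)) * below 1 x - F (w (S x)) * below c x)).
  apply/funext => x /=; rewrite S1 /profile.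
  have [Sb|bS] := leP (S x) b.
    by rewrite (le_trans Sb h2) (le_trans Sb (le_trans h2 h3)) /=; ring.
  have [Sal|alS] := leP (S x) al; first by rewrite (le_trans Sal h3) /=; ring.
  by have [Sc|cS] := leP (S x) c; rewrite /=; ring.
split; first by int_tac.
by E_tac; rewrite eb ea ec e1 fb fa fc.
Qed.

Lemma E_profile : int (g \o S) /\ E (g \o S) = head v b al + rest al v' c.
Proof.
have [] := @E_profile_comp id (fun t => t `^ kk).
  by move=> t t01; exact: (E_wS t01).
by move=> i e; split => //; rewrite e powR1 /head /rest /=; ring.
Qed.

Lemma E_profile_q : int (fun x => (g \o S) x `^ q) /\
  E (fun x => (g \o S) x `^ q) = energy v b al v' c.
Proof.
have [] := @E_profile_comp (fun y => y `^ q) (fun t => G * t `^ kq).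
  by move=> t t01; exact: (E_wSq t01).
by move=> i e; split => //; rewrite e powR1 /energy /=; ring.
Qed.

Lemma E_profile_head : E (fun x => (g \o S) x * below al x) = head v b al.
Proof.
have h1 := profile_b0 hP; have h2 := profile_b_al hP.
have h3 := profile_al_c hP; have h4 := profile_c1 hP.
have b01 : 0 <= b <= 1 by lra.
have al01 : 0 <= al <= 1 by lra.
have [ib eb] := E_wS b01; have [ia ea] := E_wS al01.
have jb := int_ind_le b; have fb := E_uniform_le uS b01.
have -> : (fun x => (g \o S) x * below al x) = (fun x => v * below b x
   + (w (S x) * below al x - w (S x) * below b x)).
  apply/funext => x /=; rewrite /profile.
  have [Sb|bS] := leP (S x) b; first by rewrite (le_trans Sb h2) /=; ring.
  by have [Sal|alS] := leP (S x) al; rewrite /=; ring.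
by E_tac; rewrite eb ea fb /head; ring.
Qed.

Lemma dominated_profile : dom (g \o S).
Proof.
split.
- exact: (measurableT_comp measurable_profile mS).
- by move=> x; exact: profile_ge0.
move=> t t0; have kt : 0 < k / t := divr_gt0 k0 t0.
have b0 : 0 <= (k / t) `^ p by exact: powR_ge0.
have mle := measurable_uniform_le uS ((k / t) `^ p).
have mg : measurable [set x | t <= (g \o S) x].
  have := (measurableT_comp measurable_profile mS) measurableT _ (measurable_itv `[t, +oo[).
  by rewrite setTI; congr measurable; apply/seteqP; split => x /=; rewrite in_itv/= andbT.
apply: (@le_trans _ _ (mu [set x | S x <= (k / t) `^ p])).
  apply: le_measure; rewrite ?inE// => x /= h.
  rewrite leNgt; apply/negP => h'.
  have := le_trans h (profile_le_wtail (S0 x)); rewrite leNgt; move/negP; apply.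
  by rewrite -[X in _ < X](wtailK q1 qp t0); apply: (wtail_lt q1 qp) => //; exact: powR_gt0.
have [b1|b1] := leP ((k / t) `^ p) 1.
  by case: uS => _ _ ->//; rewrite b0.
by apply: le_trans (probability_le1 _ mle) _; rewrite lee_fin ltW.
Qed.

End one_profile.

(** One profile provides the multipliers, the other the competitor.  As a
    function of the second, the left-hand side is an affine minorant. *)
Lemma energy_compare v b al v' c v2 b2 al2 v2' c2 :
  is_profile v b al v' c -> 0 < b -> is_profile v2 b2 al2 v2' c2 ->
  energy v b al v' c + q * v `^ (q - 1) * (head v2 b2 al2 - head v b al)
  + q * v' `^ (q - 1) * (rest al2 v2' c2 - rest al v' c)
  - (al2 - al) * (rtan q v (w al) - rtan q v' (w al))
  <= energy v2 b2 al2 v2' c2.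
Proof.
move=> hP b0 hP2.
have [i2 e2] := E_profile hP2; have [iq2 eq2] := E_profile_q hP2.
have := @energy_lower_bound _ (fun x => S x <= al2) v v' b al c
  (dominated_profile hP2) iq2 (measurable_uniform_le uS _) b0
  (profile_b_al hP) (profile_al_c hP) (profile_c1 hP) (profile_v'0 hP)
  (profile_v'v hP b0) (profile_vb hP b0) (profile_bv hP b0) (profile_v'c hP) (profile_cv' hP).
rewrite eq2 e2 E_profile_head// => h.
have al201 : 0 <= al2 <= 1.
  have := profile_b0 hP2; have := profile_b_al hP2.
  by have := profile_al_c hP2; have := profile_c1 hP2; lra.
have := E_uniform_le uS al201; rewrite E_ind; last exact: measurable_uniform_le uS _.
move=> e3; rewrite e3 in h; apply: le_trans h.
by rewrite /energy /head /rest; lra.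
Qed.

End extremal_energy.

(** * Ranks of an atomless variable *)

Section measure_helpers.
Context {R : realType} {d : measure_display} {X : measurableType d}.
Variable mu : probability X R.
Implicit Types (A B N : set X).

Lemma invn_lt (e : R) : 0 < e -> exists n : nat, n.+1%:R^-1 < e.
Proof.
move=> e0; exists (Num.truncn e^-1).
by rewrite invf_plt ?posrE// truncnS_gt.
Qed.

Lemma mu_bigcup_le (F : nat -> set X) a : (forall n, measurable (F n)) ->
  (forall n, F n `<=` F n.+1) -> (forall n, (mu (F n) <= a)%E) ->
  (mu (\bigcup_n F n) <= a)%E.
Proof.
move=> mF ndF h.
have nd : nondecreasing_seq F by apply/nondecreasing_seqP => n; apply/subsetPset.
apply: cvge_le (nondecreasing_cvg_mu mF (bigcup_measurable (fun k _ => mF k)) nd).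
by apply: nearW => n; exact: h.
Qed.

Lemma mu_bigcap_ge (F : nat -> set X) a : (forall n, measurable (F n)) ->
  (forall n, F n.+1 `<=` F n) -> (forall n, (a <= mu (F n))%E) ->
  (a <= mu (\bigcap_n F n))%E.
Proof.
move=> mF niF h.
have ni : nonincreasing_seq F by apply/nonincreasing_seqP => n; apply/subsetPset.
have F0 : (mu (F 0%N) < +oo)%E.
  by apply: le_lt_trans (probability_le1 mu (mF 0%N)) _; exact: ltry.
apply: cvge_ge (nonincreasing_cvg_mu F0 mF (bigcap_measurable _ (fun k _ => mF k)) ni).
  by apply: nearW => n; exact: h.
by exists 0%N.
Qed.

Lemma mu_U A B : measurable A -> measurable B -> A `&` B = set0 ->
  mu (A `|` B) = (mu A + mu B)%E.
Proof. exact: measureU. Qed.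

Lemma mu_le_null A B N : measurable A -> measurable B -> measurable N ->
  mu N = 0%E -> A `<=` B `|` N -> (mu A <= mu B)%E.
Proof.
move=> mA mB mN N0 AB; rewrite -[leRHS]adde0 -N0.
apply: (@le_trans _ _ (mu (B `|` N))); last exact: measureU2.
by apply: le_measure; rewrite ?inE//; exact: measurableU.
Qed.

Lemma mu_eq_null A B N : measurable A -> measurable B -> measurable N ->
  mu N = 0%E -> A `<=` B `|` N -> B `<=` A `|` N -> mu A = mu B.
Proof.
move=> mA mB mN N0 AB BA; apply/eqP; rewrite eq_le.
by rewrite (mu_le_null mA mB mN)// (mu_le_null mB mA mN).
Qed.

Lemma mu_sub_null A N : measurable A -> measurable N -> mu N = 0%E -> A `<=` N ->
  mu A = 0%E.
Proof.
by move=> mA mN N0 AN; apply/eqP; rewrite eq_le measure_ge0 andbT -N0 le_measure ?inE.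
Qed.

Lemma measurable_le (V : X -> R) v : measurable_fun setT V -> measurable [set x | V x <= v].
Proof.
move=> mV; have := mV measurableT _ (measurable_itv `]-oo, v]).
by rewrite setTI; congr measurable; apply/seteqP; split => x /=; rewrite in_itv.
Qed.

Lemma measurable_lt (V : X -> R) v : measurable_fun setT V -> measurable [set x | V x < v].
Proof.
move=> mV; have := mV measurableT _ (measurable_itv `]-oo, v[).
by rewrite setTI; congr measurable; apply/seteqP; split => x /=; rewrite in_itv.
Qed.

End measure_helpers.

Section atomless_coordinate.
Context {R : realType} {d : measure_display} {X : measurableType d}.
Variable mu : probability X R.
Variable V : X -> R.
Hypotheses (mV : measurable_fun setT V) (V01 : forall x, 0 <= V x <= 1).
Hypothesis V_atomless : forall v, mu [set x | V x = v] = 0%E.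

Let mVle v : measurable [set x | V x <= v]. Proof. exact: measurable_le. Qed.
Let mVeq v : measurable [set x | V x = v].
Proof. by have := mV measurableT (measurable_set1 v); rewrite setTI. Qed.

Variable A : set X.
Hypothesis mA : measurable A.

Let F v := fine (mu (A `&` [set x | V x <= v])).

Let FE v : mu (A `&` [set x | V x <= v]) = (F v)%:E.
Proof. by rewrite /F fineK// fin_num_measure//; exact: measurableI. Qed.

Let F_nd : {homo F : u v / u <= v}.
Proof.
move=> u v uv; rewrite -lee_fin -!FE; apply: le_measure.
- by rewrite inE; exact: measurableI.
- by rewrite inE; exact: measurableI.
- by move=> x [Ax /= h]; split => //=; exact: le_trans uv.
Qed.

Let F_left v t : (forall n : nat, F (v - n.+1%:R^-1) <= t) -> F v <= t.
Proof.
move=> h; rewrite -lee_fin -FE.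
pose D (n : nat) := A `&` [set x | V x <= v - n.+1%:R^-1].
have mD n : measurable (D n) by exact: measurableI.
apply: (@le_trans _ _ (mu (\bigcup_n D n))).
  apply: (@mu_le_null _ _ _ mu _ _ [set x | V x = v]) => //.
  - exact: measurableI.
  - by apply: bigcup_measurable => k _; exact: mD.
  move=> x [Ax /=]; rewrite le_eqVlt => /predU1P[->|xv]; [by right|left].
  have [n hn] : exists n : nat, n.+1%:R^-1 < v - V x by apply: invn_lt; lra.
  by exists n => //; split => //=; rewrite lerBrDl -lerBrDr ltW.
apply: mu_bigcup_le => //; last by move=> n; rewrite /D FE lee_fin.
move=> n x [Ax /= h']; split => //=; apply: le_trans h' _.
by rewrite lerB// lef_pV2 ?posrE// ler_nat.
Qed.

Let F_right v t : (forall n : nat, t <= F (v + n.+1%:R^-1)) -> t <= F v.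
Proof.
move=> h; rewrite -lee_fin -FE.
pose D (n : nat) := A `&` [set x | V x <= v + n.+1%:R^-1].
have mD n : measurable (D n) by exact: measurableI.
have -> : A `&` [set x | V x <= v] = \bigcap_n D n.
  apply/seteqP; split => x.
    move=> [Ax /= xv] n _; split => //=; apply: le_trans xv _.
    by rewrite lerDl invr_ge0.
  move=> DX; split; first by have [] := DX 0%N I.
  rewrite /= leNgt; apply/negP => vx.
  have [n hn] : exists n : nat, n.+1%:R^-1 < V x - v by apply: invn_lt; lra.
  rewrite ltrBrDl in hn; have [_ /= h'] := DX n I.
  by have := le_lt_trans h' hn; rewrite ltxx.
apply: mu_bigcap_ge => //; last by move=> n; rewrite /D FE lee_fin.
move=> n x [Ax /= h']; split => //=; apply: le_trans h' _.
by rewrite lerD// lef_pV2 ?posrE// ler_nat.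
Qed.

Let a := fine (mu A).
Let aE : mu A = a%:E. Proof. by rewrite /a fineK// fin_num_measure. Qed.

Let F1 : F 1 = a.
Proof.
rewrite /F /a; congr (fine (mu _)); apply/seteqP; split => x; first by case.
by move=> Ax; split => //=; have /andP[] := V01 x.
Qed.

Let FN1 : F (-1) = 0.
Proof.
rewrite /F (_ : _ `&` _ = set0) ?measure0//; rewrite -subset0 => x [_ /= ?].
have /andP[? ?] := V01 x; lra.
Qed.

Let mF : measurable_fun setT (fun x => F (V x)).
Proof. exact: (measurableT_comp (nondecreasing_measurable measurableT F_nd)). Qed.

Let F_law t : 0 <= t -> t < a -> mu (A `&` [set x | F (V x) <= t]) = t%:E.
Proof.
move=> t0 ta; pose L := [set v | F v <= t].
have LN1 : L (-1) by rewrite /L/= FN1.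
have Lub v : L v -> v <= 1.
  rewrite /L/= => h; rewrite leNgt; apply/negP => /ltW/F_nd; rewrite F1; lra.
have hL : has_sup L by split; [exists (-1)|exists 1].
pose s := sup L.
have Lt v : v < s -> F v <= t.
  move=> vs; have [z Lz /ltW vz] := sup_gt (ex_intro _ (-1) LN1) vs.
  exact: le_trans (F_nd vz) Lz.
have gt v : s < v -> t < F v.
  move=> sv; rewrite ltNge; apply/negP => h.
  have : v <= s by apply: ub_le_sup => //; case: hL.
  lra.
have Fs : F s = t.
  apply/eqP; rewrite eq_le; apply/andP; split.
  - by apply: F_left => n; apply: Lt; rewrite ltrBlDr ltrDl invr_gt0.
  - by apply: F_right => n; apply/ltW/gt; rewrite ltrDl invr_gt0.
rewrite -Fs -FE Fs; congr (mu (A `&` _)); apply/seteqP; split => x /=.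
  by move=> h; rewrite leNgt; apply/negP => /gt; lra.
by move=> /F_nd; rewrite Fs.
Qed.

(** The rank of [V] inside [A]; the null set where it vanishes is moved to 1. *)
Definition rank_in x := if 0 < F (V x) / a then F (V x) / a else 1.

(** The distribution function of [V] on [A] is continuous, so that its value at
    [V] is uniformly distributed. *)
Lemma rank_inP : [/\ measurable_fun setT rank_in, forall x, 0 < rank_in x <= 1 &
  forall t, 0 <= t <= 1 -> mu (A `&` [set x | rank_in x <= t]) = (t%:E * mu A)%E].
Proof.
have a0 : 0 <= a by rewrite /a fine_ge0.
have Fa x : F (V x) <= a.
  by rewrite -F1; apply: F_nd; have /andP[] := V01 x.
have F0 v : 0 <= F v by rewrite /F fine_ge0.
have mr : measurable_fun setT rank_in.
  apply: measurable_fun_ifT.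
  - apply: measurable_fun_ltr => //; exact: measurable_funM.
  - exact: measurable_funM.
  - by [].
have r01 x : 0 < rank_in x <= 1.
  rewrite /rank_in; case: ifPn => [h|_]; last by rewrite ltr01 lexx.
  rewrite h/=; have [->|an0] := eqVneq a 0; first by rewrite invr0 mulr0.
  by rewrite ler_pdivrMr ?mul1r// lt_def an0.
split => // t /andP[t0 t1].
have mrt : measurable (A `&` [set x | rank_in x <= t]).
  by apply: measurableI => //; exact: measurable_le.
have [az|an0] := eqVneq a 0.
  rewrite aE az mule0; apply: (mu_sub_null mrt mA); first by rewrite aE az.
  by move=> x [].
have {}a0 : 0 < a by rewrite lt_def an0.
move: t1; rewrite le_eqVlt => /predU1P[->|t1].
  rewrite mul1e; congr (mu _); apply/seteqP; split => x; first by case.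
  by move=> Ax; split => //=; have /andP[] := r01 x.
rewrite aE -EFinM -(@F_law (t * a)); first last.
- by rewrite gtr_pMl.
- by rewrite mulr_ge0// ltW.
apply: (@mu_eq_null _ _ _ mu _ _ (A `&` [set x | F (V x) <= 0])) => //.
- by apply: measurableI => //; exact: measurable_le.
- by apply: measurableI => //; exact: measurable_le.
- by rewrite F_law.
- move=> x [Ax /=]; rewrite /rank_in; case: ifPn => [h|_ h]; last by lra.
  by rewrite ler_pdivrMr// => h'; left.
- move=> x [Ax /= h]; rewrite /rank_in/=.
  have [h'|h'] := ltP 0 (F (V x) / a); last first.
    by right; split => //=; move: h'; rewrite ler_pdivrMr// mul0r.
  by left; split => //=; rewrite ler_pdivrMr.
Qed.

End atomless_coordinate.

(** * Trees have no atoms *)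

Section countable_families.
Context {R : realType} {d : measure_display} {X : measurableType d}.

Lemma countable_enum (A : set (set X)) : countable A ->
  exists e : nat -> set X, [/\ forall n, A (e n) \/ e n = set0,
    forall I, A I -> exists n, e n = I &
    forall i j, i <> j -> e i = e j -> e i = set0].
Proof.
move=> /countable_injP[f finj].
exists (fun n => xget set0 [set I | A I /\ f I = n]); split.
- by move=> n; case: xgetP => [I _ [AI _]|_]; [left|right].
- move=> I AI; exists (f I); case: xgetP => [J _ [AJ fJ]|h].
    by apply: finj; rewrite ?inE.
  by have := h I; case.
- move=> i j ij; case: xgetP => // I _ [AI fI]; case: xgetP => // J _ [AJ fJ] IJ.
  by case: ij; rewrite -fI -fJ IJ.
Qed.

(** The ternary expansion of [V] has the digit 2 or 0 at place [n] according to
    whether [e n] contains the point; with these digits it is unique. *)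
Lemma separating_coordinate (e : nat -> set X) : (forall n, measurable (e n)) ->
  exists V : X -> R, [/\ measurable_fun setT V, forall x, 0 <= V x <= 1 &
    forall x y, V x = V y -> forall n, e n x -> e n y].
Proof.
move=> me.
pose c (n : nat) : R := 3 ^- n.
have c0 n : 0 < c n by rewrite /c invr_gt0 exprn_gt0.
have cS n : c n = 3 * c n.+1 by rewrite /c exprS invfM mulrA mulfV ?mul1r// gt_eqF.
pose W (n : nat) (x : X) : R := \sum_(k < n) (2 * c k.+1) * \1_(e k) x.
have WS n x : W n.+1 x = W n x + 2 * c n.+1 * \1_(e n) x by rewrite /W big_ord_recr.
have i01 n x : 0 <= (\1_(e n) x : R) <= 1 by rewrite indicE; case: (_ \in _); rewrite ?lexx ?ler01.
have W_tail n m x : (n <= m)%N -> W n x <= W m x <= W n x + c n - c m.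
  elim: m => [|m ih]; first by rewrite leqn0 => /eqP ->; rewrite addrK !lexx.
  rewrite leq_eqVlt => /predU1P[->|nm]; first by rewrite addrK !lexx.
  have /andP[h1 h2] := ih nm; have /andP[h3 h4] := i01 m x.
  rewrite WS; have := c0 m.+1; have := cS m => h5 h6.
  have h7 : 2 * c m.+1 * \1_(e m) x <= 2 * c m.+1 by rewrite ler_piMr; lra.
  have h8 : 0 <= 2 * c m.+1 * \1_(e m) x by rewrite !mulr_ge0//; lra.
  by apply/andP; split; lra.
have W_nd x : nondecreasing_seq (W ^~ x).
  by move=> n m nm; have /andP[] := W_tail _ _ x nm.
have W_ub n x m : W m x <= W n x + c n.
  have [nm|/ltnW mn] := leqP n m.
    by have /andP[_ h] := W_tail _ _ x nm; have := c0 m; lra.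
  by have /andP[h _] := W_tail _ _ x mn; have := c0 n; lra.
have hs x : has_sup (range (W ^~ x)).
  split; first by exists (W 0%N x); exists 0%N.
  by exists (W 0%N x + c 0%N) => _ [m _ <-].
pose V x := sup (range (W ^~ x)).
have V_lb n x : W n x <= V x.
  by apply: ub_le_sup; [case: (hs x)|exists n].
have V_ub n x : V x <= W n x + c n.
  by apply: ge_sup; [case: (hs x)|move=> _ [m _ <-]].
exists V; split.
- apply: (@measurable_fun_cvg _ _ _ setT W).
    move=> m; rewrite /W; apply: measurable_sum => k.
    by apply: measurable_funM => //; exact: measurable_indic.
  move=> x _; apply: nondecreasing_cvgn; first exact: W_nd.
  by case: (hs x).
- move=> x; have := V_lb 0%N x; have := V_ub 0%N x.
  by rewrite /W big_ord0 add0r /c expr0 invr1 => -> ->.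
- move=> x y Vxy n; suff h m : W m x = W m y.
    have := h n.+1; rewrite !WS h => /addrI/(mulfI (lt0r_neq0 _)).
    rewrite mulr_gt0// => /(_ isT); rewrite !indicE => + en.
    rewrite mem_set//; case: (boolP (y \in e n)) => [|_]; first by rewrite inE.
    by move/eqP; rewrite oner_eq0.
  elim: m => [|m ih]; first by rewrite /W !big_ord0.
  have lbx := V_lb m.+1 x; have ubx := V_ub m.+1 x.
  have lby := V_lb m.+1 y; have uby := V_ub m.+1 y.
  have := c0 m.+1.
  move: lbx ubx lby uby; rewrite !WS ih Vxy !indicE.
  case: (x \in e m); case: (y \in e m); rewrite ?mulr1 ?mulr0 //; lra.
Qed.

End countable_families.

Section trees.
Context {R : realType} {d : measure_display} {X : measurableType d}.
Variable mu : probability X R.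
Variables (T : set (set X)) (C : set X -> set (set X)).
Hypothesis hT : tree_with mu T C.
Local Notation lvl := (tree_level C).

Lemma tree_levelT m I : lvl m I -> T I.
Proof. by move=> h; rewrite (tree_levels hT); exists m. Qed.

Lemma tree_level_cover m x : exists2 I, lvl m I & I x.
Proof.
elim: m => [|m [I mI Ix]]; first by exists setT.
move: Ix; rewrite (tree_cover hT (tree_levelT mI)) => -[J CJ Jx].
by exists J => //; exists I.
Qed.

Lemma countable_tree_level m : countable (lvl m).
Proof.
elim: m => [|m ih]; first exact: countable1.
by apply: bigcup_countable => // I /tree_levelT /(tree_child_countable hT).
Qed.

Lemma countable_tree : countable T.
Proof.
rewrite (tree_levels hT); apply: bigcup_countable => // m _.
exact: countable_tree_level.
Qed.

(** Siblings have a null intersection, and elements with different parents inherit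
    this from the parents. *)
Lemma tree_level_null m I J : lvl m I -> lvl m J -> I <> J -> mu (I `&` J) = 0%E.
Proof.
elim: m I J => [|m ih] I J; first by move=> -> ->.
move=> [I' mI' CI] [J' mJ' CJ] IJ.
have [TI' TJ'] := (tree_levelT mI', tree_levelT mJ').
have [e|/eqP e] := eqVneq I' J'.
  by apply: (tree_child_null hT TI') => //; rewrite e.
have mm K : T K -> measurable K by exact: (tree_measurable hT).
have [TI TJ] := (tree_childS hT TI' CI, tree_childS hT TJ' CJ).
apply: (mu_sub_null _ _ (ih _ _ mI' mJ' e)); try by apply: measurableI; exact: mm.
exact: setISS (tree_child_sub hT TI' CI) (tree_child_sub hT TJ' CJ).
Qed.

Lemma tree_mesh_lt (eps : R) : 0 < eps ->
  exists m, forall I, lvl m I -> (mu I < eps%:E)%E.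
Proof.
move=> e0; have := tree_mesh hT => /fine_cvgP[fn].
move=> /cvgrPdist_lt /(_ _ e0) h.
have [m _ /(_ m (leqnn m))] := filterI fn h.
move=> [fm]; rewrite /= sub0r normrN => hm.
exists m => I mI.
apply: (@le_lt_trans _ _ (ereal_sup [set mu I | I in lvl m])).
  by apply: ereal_sup_ubound; exists I.
by rewrite -(fineK fm) lte_fin; exact: le_lt_trans (ler_norm _) hm.
Qed.

(** A fibre of the coordinate that separates the tree is contained in one element
    of each level, and the mesh of the levels tends to 0. *)
Lemma tree_coordinate : exists V : X -> R, [/\ measurable_fun setT V,
  forall x, 0 <= V x <= 1 & forall v, mu [set x | V x = v] = 0%E].
Proof.
have [e [eT Te _]] := countable_enum countable_tree.
have me n : measurable (e n).
  by case: (eT n) => [/(tree_measurable hT)//|->].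
have [V [mV V01 Vsep]] := @separating_coordinate R _ _ e me.
exists V; split => // v.
have mv : measurable [set x | V x = v].
  by have := mV measurableT _ (measurable_set1 v); rewrite setTI.
apply/eqP; rewrite eq_le measure_ge0 andbT.
have [->|/set0P[x /= xv]] := eqVneq [set x | V x = v] set0; first by rewrite measure0.
apply/lee_addgt0Pr => eps e0; rewrite add0e.
have [m hm] := tree_mesh_lt e0; have [I mI Ix] := tree_level_cover m x.
apply: le_trans (ltW (hm _ mI)); apply: le_measure; rewrite ?inE//.
  exact: (tree_measurable hT (tree_levelT mI)).
move=> y /= yv; have [n nI] := Te _ (tree_levelT mI).
by rewrite -nI; apply: (Vsep x); [rewrite xv yv|rewrite nI].
Qed.

End trees.

(** * Uniform variables adapted to a partition *)

Section tailored_uniform.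
Context {R : realType} {d : measure_display} {X : measurableType d}.
Variable mu : probability X R.
Variable V : X -> R.
Hypotheses (mV : measurable_fun setT V) (V01 : forall x, 0 <= V x <= 1).
Hypothesis V_atomless : forall v, mu [set x | V x = v] = 0%E.

Definition uniform_on (A : set X) (U : X -> R) := forall t, 0 <= t <= 1 ->
  mu (A `&` [set x | U x <= t]) = (t%:E * mu A)%E.

Lemma measurable_mem (A : set X) : measurable A -> measurable_fun setT (fun x => x \in A).
Proof.
move=> mA; apply: (@measurable_fun_bool _ _ _ _ true); rewrite setTI.
have -> : (fun x => x \in A) @^-1` [set true] = A; last by [].
by apply/seteqP; split => x /=; [exact: set_mem|exact: mem_set].
Qed.

Lemma mu_bigsetU_null (F : nat -> set X) n : (forall j, measurable (F j)) ->
  (forall j, (j < n)%N -> mu (F j) = 0%E) -> mu (\big[setU/set0]_(j < n) F j) = 0%E.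
Proof.
move=> mF; elim: n => [|n ih] h; first by rewrite big_ord0 measure0.
rewrite big_ord_recr/=; apply/eqP; rewrite eq_le measure_ge0 andbT.
apply: le_trans (measureU2 _ _ _) _ => //; first exact: bigsetU_measurable.
apply: (@le_trans _ _ (0 + 0)%E); last by rewrite adde0.
have h0 : mu (\big[setU/set0]_(j < n) F j) = 0%E.
  by apply: ih => j jn; rewrite h// ltnS ltnW.
have h1 : mu (F n) = 0%E by exact: h.
by apply: leeD; [exact: (eq_ind_r (fun z => (z <= 0)%E) (lexx 0%E) h0)|
  exact: (eq_ind_r (fun z => (z <= 0)%E) (lexx 0%E) h1)].
Qed.

(** Almost disjoint pieces are made disjoint one after the other, and the rank
    inside each piece is used there. *)
Lemma uniform_pieces (I : nat -> set X) n : (forall j, measurable (I j)) ->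
  (forall i j, i <> j -> mu (I i `&` I j) = 0%E) ->
  exists U : X -> R, [/\ measurable_fun setT U, forall x, 0 < U x <= 1,
    uniform_on (\big[setU/set0]_(j < n) I j) U &
    forall j, (j < n)%N -> uniform_on (I j) U].
Proof.
move=> mI nI; elim: n => [|n [U [mU U01 Un Uj]]].
  exists (fun=> 1); split => //; first by move=> x; rewrite ltr01 lexx.
  by move=> t _; rewrite big_ord0 set0I measure0 mule0.
set En := \big[setU/set0]_(j < n) I j in Un.
have mEn : measurable En by exact: bigsetU_measurable.
pose B := I n `\` En; have mB : measurable B by exact: measurableD.
have [mr r01 rB] := rank_inP mV V01 V_atomless mB.
set r := rank_in mu V B in mr r01 rB.
pose U' x := if x \in B then r x else U x.
have mU' : measurable_fun setT U' by apply: measurable_fun_ifT => //; exact: measurable_mem.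
have U'B t : B `&` [set x | U' x <= t] = B `&` [set x | r x <= t].
  by apply/seteqP; split => x [Bx /=]; rewrite /U' mem_set.
have U'E Z t : Z `<=` En -> Z `&` [set x | U' x <= t] = Z `&` [set x | U x <= t].
  by move=> ZE; apply/seteqP; split => x [Zx /=]; rewrite /U' memNset// => -[_];
    apply; exact: ZE.
have In0 : mu (I n `&` En) = 0%E.
  rewrite /En -bigcup_mkord setI_bigcupr bigcup_mkord.
  apply: (@mu_bigsetU_null (fun j => I n `&` I j)).
    by move=> j; exact: measurableI.
  by move=> j jn; apply: nI => nj; rewrite nj ltnn in jn.
have muIn : mu (I n) = mu B.
  apply: (@mu_eq_null _ _ _ mu _ _ (I n `&` En)) => //; first exact: measurableI.
    by move=> x Ix; have [Ex|Ex] := pselect (En x); [right|left].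
  by move=> x [Ix _]; left.
have mle t (W : X -> R) Z : measurable Z -> measurable_fun setT W ->
    measurable (Z `&` [set x | W x <= t]).
  by move=> mZ mW; apply: measurableI => //; exact: measurable_le.
exists U'; split => //.
- by move=> x; rewrite /U'; case: ifP.
- move=> t t01; rewrite big_ord_recr/= -/En.
  have -> : En `|` I n = En `|` B.
    apply/seteqP; split => x [Ex|Ix]; [by left| |by left|by right; case: Ix].
    by have [Ex|Ex] := pselect (En x); [left|right].
  have EB0 : En `&` B = set0 by rewrite -subset0 => x [Ex []].
  rewrite setIUl mu_U; [|exact: mle..|]; last first.
    by rewrite -subset0 => x [[Ex _] [[_ ?] _]].
  rewrite U'E// U'B Un// rB// -ge0_muleDr//.
  by rewrite mu_U.
- move=> j; rewrite ltnS leq_eqVlt => /predU1P[->|jn] t t01; last first.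
    rewrite U'E ?Uj// /En; move=> x Ix.
    by rewrite -bigcup_mkord; exists j.
  rewrite muIn -rB// -U'B.
  apply: (@mu_eq_null _ _ _ mu _ _ (I n `&` En)); [exact: mle|exact: mle|exact: measurableI|by []|..].
    by move=> x [Ix Ux]; have [Ex|Ex] := pselect (En x); [right|left].
  by move=> x [[Ix _] Ux]; left.
Qed.

(** [S] is the rank inside the pieces, scaled to [(0, dl]], on [A], and the rank
    inside the complement of [A], moved above [dl], elsewhere. *)
Lemma tailored_uniform (I : nat -> set X) n dl : (forall j, measurable (I j)) ->
  (forall i j, i <> j -> mu (I i `&` I j) = 0%E) ->
  let A := \big[setU/set0]_(j < n) I j in mu A = dl%:E -> 0 < dl < 1 ->
  exists S : X -> R, [/\ uniform01 mu S, forall x, (S x <= dl) = (x \in A) &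
    forall j, (j < n)%N -> forall t, 0 <= t <= dl ->
      (dl%:E * mu (I j `&` [set x | (S x <= t)%R]) = mu (I j) * t%:E)%E].
Proof.
move=> mI nI A muA /andP[dl0 dl1].
have mA : measurable A by exact: bigsetU_measurable.
have [U [mU U01 UA Uj]] := uniform_pieces n mI nI.
have mAC : measurable (~` A) by exact: measurableC.
have [mr r01 rC] := rank_inP mV V01 V_atomless mAC.
set r := rank_in mu V (~` A) in mr r01 rC.
pose S x := if x \in A then dl * U x else dl + (1 - dl) * r x.
have muAC : mu (~` A) = (1 - dl)%:E by rewrite probability_setC// muA.
have SA t (Z : set X) : 0 <= t <= dl -> Z `<=` A ->
    Z `&` [set x | S x <= t] = Z `&` [set x | U x <= t / dl].
  move=> t01 ZA; apply/seteqP; split => x [Zx] /=; rewrite /S mem_set; try exact: ZA.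
    by move=> h; split => //; rewrite ler_pdivlMr// mulrC.
  by move=> h; split => //; move: h; rewrite ler_pdivlMr// mulrC.
have tdl t : 0 <= t <= dl -> 0 <= t / dl <= 1.
  move=> /andP[t0 t1]; apply/andP; split; first by apply: divr_ge0 => //; exact: ltW.
  by rewrite ler_pdivrMr ?mul1r.
have Sdl x : (S x <= dl) = (x \in A).
  rewrite /S; case: ifPn => _; have := U01 x; have := r01 x => /andP[r0 r1] /andP[u0 u1].
    by rewrite ler_piMr// ltW.
  apply/negbTE; rewrite -ltNge ltrDl mulr_gt0//; lra.
have mS : measurable_fun setT S.
  apply: measurable_fun_ifT; first exact: measurable_mem.
    exact: measurable_funM.
  by apply: measurable_funD => //; exact: measurable_funM.
exists S; split => //; last first.
  move=> j jn t t01; rewrite SA//; last first.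
    by rewrite /A => x Ix; rewrite -bigcup_mkord; exists j.
  rewrite Uj//; last exact: tdl.
  rewrite muleA -EFinM muleC; congr (_ * _%:E)%E; rewrite mulrC divfK//.
  by rewrite gt_eqF.
split => //.
  move=> x; rewrite /S; case: ifPn => _; have := U01 x; have := r01 x => /andP[r0 r1] /andP[u0 u1].
    have h : dl * U x <= dl by rewrite ler_piMr// ltW.
    have h' : 0 < dl * U x by rewrite mulr_gt0.
    lra.
  have h : (1 - dl) * r x <= 1 - dl by rewrite ler_piMr//; lra.
  have h' : 0 < (1 - dl) * r x by rewrite mulr_gt0//; lra.
  lra.
move=> t /andP[t0 t1].
have [tdl'|dlt] := leP t dl.
  have -> : [set x | S x <= t] = A `&` [set x | S x <= t].
    apply/seteqP; split => x /=; last by case.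
    by move=> h; split => //; apply: set_mem; rewrite -Sdl (le_trans h).
  rewrite SA ?t0// UA; last by apply: tdl; rewrite t0.
  by rewrite muA -EFinM divfK// gt_eqF.
have tC : 0 <= (t - dl) / (1 - dl) <= 1.
  apply/andP; split; first by apply: divr_ge0; lra.
  by rewrite ler_pdivrMr ?mul1r; lra.
have -> : [set x | S x <= t] = A `|` (~` A `&` [set x | r x <= (t - dl) / (1 - dl)]).
  apply/seteqP; split => x /=.
    have [Ax|Ax] := pselect (A x); first by left.
    rewrite /S memNset// => h; right; split => //.
    by rewrite ler_pdivlMr; lra.
  move=> [Ax|[Ax h]].
    by have := mem_set Ax; rewrite -Sdl => /le_trans; apply; exact: ltW.
  by move: h; rewrite /S memNset// ler_pdivlMr; lra.
rewrite mu_U//; last 2 first.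
- by apply: measurableI => //; exact: measurable_le.
- by rewrite -subset0 => x [Ax []].
rewrite rC// muA muAC -EFinM -EFinD divfK ?gt_eqF//; last by lra.
by congr EFin; ring.
Qed.

Lemma uniform_exists : exists S : X -> R, uniform01 mu S.
Proof.
have [mr r01 rT] := rank_inP mV V01 V_atomless measurableT.
exists (rank_in mu V setT); split => // t t01.
by have := rT t t01; rewrite setTI probability_setT mule1.
Qed.

End tailored_uniform.

(** * The weak-type inequality on a tree *)

Section set_integral.
Context {R : realType} {d : measure_display} {X : measurableType d}.
Variable mu : probability X R.
Variable phi : X -> R.
Hypotheses (phi0 : forall x, 0 <= phi x) (iphi : mu.-integrable setT (EFin \o phi)).
Implicit Types A B N : set X.

Definition mass A : R := fine (mu A).
Definition load A : R := \int[mu]_(x in A) phi x.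

Lemma massE A : measurable A -> mu A = (mass A)%:E.
Proof. by move=> mA; rewrite /mass fineK// fin_num_measure. Qed.

Let iA A : measurable A -> mu.-integrable A (EFin \o phi).
Proof. by move=> mA; exact: integrableS iphi. Qed.

Lemma loadE A : measurable A -> (\int[mu]_(x in A) (phi x)%:E)%E = (load A)%:E.
Proof.
by move=> mA; rewrite /load/Rintegral fineK//; apply: integrable_fin_num => //; exact: iA.
Qed.

Lemma load_U A B : measurable A -> measurable B -> A `&` B = set0 ->
  load (A `|` B) = load A + load B.
Proof.
move=> mA mB AB; rewrite /load Rintegral_setU//; first exact: iA (measurableU _ _ mA mB).
exact/disj_set2P.
Qed.

Lemma load_ge0 A : 0 <= load A.
Proof. by apply: Rintegral_ge0 => x _. Qed.

Lemma load_D A B : measurable A -> measurable B -> B `<=` A ->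
  load A = load B + load (A `\` B).
Proof.
move=> mA mB BA; rewrite -load_U//; first by rewrite setDUK.
  exact: measurableD.
by rewrite setDIK.
Qed.

Lemma load_le A B : measurable A -> measurable B -> A `<=` B -> load A <= load B.
Proof. by move=> mA mB AB; rewrite (load_D mB mA AB) lerDl load_ge0. Qed.

Lemma load_null N : measurable N -> mu N = 0%E -> load N = 0.
Proof.
move=> mN N0; rewrite /load /Rintegral null_set_integral//.
by have /integrableP[] := iA mN.
Qed.

Lemma load_bigcup_le (F : nat -> set X) a : (forall n, measurable (F n)) ->
  (forall n, F n `<=` F n.+1) -> (forall n, load (F n) <= a) ->
  load (\bigcup_n F n) <= a.
Proof.
move=> mF ndF h; have mU : measurable (\bigcup_n F n) by exact: bigcup_measurable.
rewrite -lee_fin -loadE//.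
have nd : nondecreasing_seq F by apply/nondecreasing_seqP => n; apply/subsetPset.
have := @ge0_nondecreasing_set_cvg_integral _ _ _ F (EFin \o phi) mu nd mF.
move=> /(_ _ _)/(cvge_le _); apply.
- by apply: nearW => n; rewrite loadE// lee_fin.
- by move=> i; have /integrableP[] := iA (mF i).
- by move=> i x _; rewrite lee_fin.
Qed.

Lemma load_bigcap_ge (F : nat -> set X) a : (forall n, measurable (F n)) ->
  (forall n, F n.+1 `<=` F n) -> (forall n, a <= load (F n)) ->
  a <= load (\bigcap_n F n).
Proof.
move=> mF niF h; have mI : measurable (\bigcap_n F n) by exact: bigcap_measurable.
have F0n n : F n `<=` F 0%N.
  by elim: n => // n ih; exact: subset_trans (niF n) ih.
have h1 : load (\bigcup_n (F 0%N `\` F n)) <= load (F 0%N) - a.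
  apply: load_bigcup_le.
  - by move=> n; exact: measurableD.
  - by move=> n; apply: setDS; exact: niF.
  - by move=> n; have := h n; have := load_D (mF 0%N) (mF n) (F0n n); lra.
have e : \bigcup_n (F 0%N `\` F n) = F 0%N `\` \bigcap_n F n.
  by rewrite setDE setC_bigcap setI_bigcupr.
have := load_D (mF 0%N) mI (fun x h => h 0%N I).
by rewrite -e; lra.
Qed.

Lemma mass_U A B : measurable A -> measurable B -> A `&` B = set0 ->
  mass (A `|` B) = mass A + mass B.
Proof.
move=> mA mB AB; apply: EFin_inj; rewrite EFinD -!massE//; last exact: measurableU.
exact: mu_U.
Qed.

Lemma mass_ge0 A : 0 <= mass A. Proof. by rewrite /mass fine_ge0. Qed.

Lemma mass_le A B : measurable A -> measurable B -> A `<=` B -> mass A <= mass B.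
Proof. by move=> mA mB AB; rewrite -lee_fin -!massE//; apply: le_measure; rewrite ?inE. Qed.

(** The density condition adds up along disjoint unions and passes to increasing
    limits; overlaps of measure zero do not count. *)
Lemma load_bigcup_density (F : nat -> set X) l : 0 < l -> (forall n, measurable (F n)) ->
  (forall i j, i <> j -> mu (F i `&` F j) = 0%E) ->
  (forall n, l * mass (F n) <= load (F n)) ->
  l * mass (\bigcup_n F n) <= load (\bigcup_n F n).
Proof.
move=> l0 mF nF h; have mU : measurable (\bigcup_n F n) by exact: bigcup_measurable.
pose G n := \big[setU/set0]_(j < n) F j.
have mG n : measurable (G n) by exact: bigsetU_measurable.
have hG n : l * mass (G n) <= load (G n).
  elim: n => [|n ih].
    by rewrite /G big_ord0 /mass /load measure0 Rintegral_set0 mulr0.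
  have GnF : mu (F n `&` G n) = 0%E.
    rewrite /G -bigcup_mkord setI_bigcupr bigcup_mkord.
    apply: (@mu_bigsetU_null _ _ _ _ (fun j => F n `&` F j)).
      by move=> j; exact: measurableI.
    by move=> j jn; apply: nF => nj; rewrite nj ltnn in jn.
  have mD : measurable (F n `\` G n) by exact: measurableD.
  have mI : measurable (F n `&` G n) by exact: measurableI.
  have eF : F n = (F n `\` G n) `|` (F n `&` G n) by rewrite setUC setUIDK.
  have dF : (F n `\` G n) `&` (F n `&` G n) = set0 by rewrite -subset0 => x [[_ h1] [_ h2]].
  have -> : G n.+1 = G n `|` (F n `\` G n).
    rewrite {1}/G big_ord_recr/= -/(G n); apply/seteqP; split => x.
      by move=> [Gx|Fx]; [left|have [Gx|Gx] := pselect (G n x); [left|right]].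
    by move=> [Gx|[Fx _]]; [left|right].
  have dG : G n `&` (F n `\` G n) = set0 by rewrite -subset0 => x [h1 [_ h2]].
  rewrite mass_U// load_U// mulrDr lerD//.
  have := h n; rewrite {1 2}eF mass_U// load_U// (load_null mI GnF).
  by rewrite {2}/mass GnF/= !addr0.
rewrite mulrC -ler_pdivlMr// -lee_fin -massE//.
have -> : \bigcup_n F n = \bigcup_n G n.
  apply/seteqP; split => x [n _ Fx].
    by exists n.+1 => //; rewrite /G big_ord_recr/=; right.
  by move: Fx; rewrite /G -bigcup_mkord => -[j _ Fjx]; exists j.
apply: mu_bigcup_le => //.
  by move=> n x; rewrite /G big_ord_recr/=; left.
move=> n; rewrite massE// lee_fin ler_pdivlMr// mulrC.
apply: le_trans (hG n) _; apply: load_le => //; first exact: bigcup_measurable.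
by move=> x Gx; exists n.
Qed.

End set_integral.

Section weak_type.
Context {R : realType} {d : measure_display} {X : measurableType d}.
Variable mu : probability X R.
Variables (T : set (set X)) (C : set X -> set (set X)).
Hypothesis hT : tree_with mu T C.
Local Notation lvl := (tree_level C).
Variable phi : X -> R.
Hypotheses (phi0 : forall x, 0 <= phi x) (iphi : mu.-integrable setT (EFin \o phi)).
Local Notation mass := (mass mu).
Local Notation load := (load mu phi).

Let mT I : T I -> measurable I. Proof. exact: (tree_measurable hT). Qed.

Lemma tree_mass_gt0 I : T I -> 0 < mass I.
Proof. by move=> TI; rewrite -lte_fin -massE; [exact: (tree_gt0 hT TI)|exact: mT]. Qed.

Lemma averageE I : T I -> ((mu I)^-1 * \int[mu]_(y in I) `|(phi y)%:E|)%E =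
  (load I / mass I)%:E.
Proof.
move=> TI; have mI := mT TI; have m0 := tree_mass_gt0 TI.
rewrite massE// inver gt_eqF// mulrC EFinM; congr (_ * _)%E.
by rewrite -loadE//; apply: eq_integral => x _; rewrite gee0_abs// lee_fin.
Qed.

Lemma maximal_gt l x : (l%:E < tree_maximal mu T phi x)%E <->
  exists2 I, T I & I x /\ l * mass I < load I.
Proof.
split.
- move=> /ereal_sup_gt[_ [I [TI Ix] <-]]; rewrite averageE// lte_fin.
  by rewrite ltr_pdivlMr ?tree_mass_gt0// => h; exists I.
- move=> [I TI [Ix h]]; apply: (@lt_le_trans _ _ (load I / mass I)%:E).
    by rewrite lte_fin ltr_pdivlMr ?tree_mass_gt0.
  by apply: ereal_sup_ubound; exists I => //; exact: averageE.
Qed.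

Lemma maximal_ge l I x : T I -> I x -> l * mass I <= load I ->
  (l%:E <= tree_maximal mu T phi x)%E.
Proof.
move=> TI Ix h; apply: (@le_trans _ _ (load I / mass I)%:E).
  by rewrite lee_fin ler_pdivlMr ?tree_mass_gt0.
by apply: ereal_sup_ubound; exists I => //; exact: averageE.
Qed.

Lemma measurable_countable_bigcup (A : set (set X)) (F : set X -> set X) :
  countable A -> (forall I, A I -> measurable (F I)) -> measurable (\bigcup_(I in A) F I).
Proof.
move=> /countable_enum[e [eA Ae _]] mF.
have -> : \bigcup_(I in A) F I = \bigcup_n (if `[< A (e n) >] then F (e n) else set0).
  apply/seteqP; split => x.
    move=> [I AI FIx]; have [n nI] := Ae _ AI; exists n => //.
    by rewrite nI; case: asboolP.
  by move=> [n _]; case: asboolP => // An Fx; exists (e n).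
by apply: bigcup_measurable => n _; case: asboolP => // An; exact: mF.
Qed.

Variable l : R.
Hypothesis l0 : 0 < l.

Let sel I := `[< l * mass I < load I >].

(** The part of [I] covered by the maximal dense descendants of [I] that are at
    most [n] generations below it. *)
Fixpoint stopped (n : nat) (I : set X) : set X :=
  if sel I then I else
  if n is n'.+1 then \bigcup_(J in C I) stopped n' J else set0.

Lemma stopped_spec n I : T I -> [/\ measurable (stopped n I), stopped n I `<=` I,
  stopped n I `<=` stopped n.+1 I & l * mass (stopped n I) <= load (stopped n I)].
Proof.
elim: n I => [|n ih] I TI /=; case: ifPn => [/asboolP h|_].
- by split => //; [exact: mT|exact: ltW].
- by split => //; rewrite /mass /load measure0 Rintegral_set0 mulr0.
- by split => //; [exact: mT|exact: ltW].
have TC J : C I J -> T J by exact: (tree_childS hT TI).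
have mS : measurable (\bigcup_(J in C I) stopped n J).
  apply: measurable_countable_bigcup; first exact: (tree_child_countable hT).
  by move=> J /TC /ih[].
split => //.
- move=> x [J CJ Sx]; apply: (tree_child_sub hT TI CJ).
  by have [_ + _ _] := ih _ (TC _ CJ); apply.
- move=> x [J CJ Sx]; exists J => //.
  by have [_ _ + _] := ih _ (TC _ CJ); apply.
have /countable_enum[e [eA Ae einj]] := tree_child_countable hT TI.
pose F k := if `[< C I (e k) >] then stopped n (e k) else set0.
have -> : \bigcup_(J in C I) stopped n J = \bigcup_k F k.
  apply/seteqP; split => x.
    move=> [J CJ Sx]; have [k kJ] := Ae _ CJ; exists k => //.
    by rewrite /F kJ; case: asboolP.
  by move=> [k _]; rewrite /F; case: asboolP => // Ck Sx; exists (e k).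
have mF k : measurable (F k) by rewrite /F; case: asboolP => // /TC /ih[].
apply: load_bigcup_density => //.
- move=> i j ij; rewrite /F; case: asboolP => [Ci|_]; last by rewrite set0I measure0.
  case: asboolP => [Cj|_]; last by rewrite setI0 measure0.
  have [Ti Tj] := (TC _ Ci, TC _ Cj).
  have eij : e i <> e j.
    move=> /(einj _ _ ij) e0; have := tree_gt0 hT Ti.
    by rewrite e0 measure0 ltxx.
  apply: (mu_sub_null _ _ (tree_child_null hT TI Ci Cj eij)).
  + by apply: measurableI; [case: (ih _ Ti)|case: (ih _ Tj)].
  + by apply: measurableI; exact: mT.
  + by apply: setISS; [case: (ih _ Ti)|case: (ih _ Tj)].
- move=> k; rewrite /F; case: asboolP => [/TC /ih[]//|_].
  by rewrite /mass /load measure0 Rintegral_set0 mulr0.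
Qed.

Lemma stopped_level m n I : lvl m I -> stopped n I `<=` stopped (m + n) setT.
Proof.
elim: m n I => [|m ih] n I; first by move=> ->; rewrite add0n.
move=> [J mJ CI]; rewrite addSnnS; apply: subset_trans (ih n.+1 _ mJ).
have TJ := tree_levelT hT mJ; have TI := tree_childS hT TJ CI.
rewrite [X in _ `<=` X]/=; case: ifPn => _.
  have [_ h _ _] := stopped_spec n TI.
  exact: subset_trans h (tree_child_sub hT TJ CI).
by move=> x Sx; exists I.
Qed.

Lemma maximal_gt_stopped :
  [set x | (l%:E < tree_maximal mu T phi x)%E] = \bigcup_n stopped n setT.
Proof.
apply/seteqP; split => x /=.
- move=> /maximal_gt[I TI [Ix h]].
  have [m _ mI] : (\bigcup_m lvl m) I by rewrite -(tree_levels hT).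
  exists (m + 0)%N => //; apply: (@stopped_level m 0%N I mI x).
  by rewrite /= ifT//; apply/asboolP.
- move=> [n _]; suff h I : T I -> stopped n I x -> exists2 J, T J & J x /\ l * mass J < load J.
    by move=> /h -/(_ (tree_setT hT)) /maximal_gt.
  elim: n I => [|n ih] I TI /=; case: ifPn => [/asboolP h Ix|_]//; try by exists I.
  by move=> [J /(tree_childS hT TI) TJ /(ih _ TJ)].
Qed.

(** The set is the union of the maximal dense elements, which are almost
    disjoint.  Cutting the tree at depth [n] replaces the selection of maximal
    elements by a recursion. *)
Lemma weak_type_gt : measurable [set x | (l%:E < tree_maximal mu T phi x)%E] /\
  l * mass [set x | (l%:E < tree_maximal mu T phi x)%E] <=
  load [set x | (l%:E < tree_maximal mu T phi x)%E].
Proof.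
rewrite maximal_gt_stopped; have TT := tree_setT hT.
have mU : measurable (\bigcup_n stopped n setT).
  by apply: bigcup_measurable => n _; case: (stopped_spec n TT).
split => //; rewrite mulrC -ler_pdivlMr// -lee_fin -massE//.
apply: mu_bigcup_le => //.
- by move=> n; case: (stopped_spec n TT).
- by move=> n; case: (stopped_spec n TT).
move=> n; have [mS _ _ h] := stopped_spec n TT.
rewrite massE// lee_fin ler_pdivlMr// mulrC; apply: (le_trans h).
by apply: load_le => // x Sx; exists n.
Qed.

End weak_type.

Section weak_type_ge.
Context {R : realType} {d : measure_display} {X : measurableType d}.
Variable mu : probability X R.
Variables (T : set (set X)) (C : set X -> set (set X)).
Hypothesis hT : tree_with mu T C.
Variable phi : X -> R.
Hypotheses (phi0 : forall x, 0 <= phi x) (iphi : mu.-integrable setT (EFin \o phi)).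

(** The set is the decreasing intersection of the sets for the strict inequality
    and smaller levels. *)
Lemma weak_type l : 0 < l ->
  measurable [set x | (l%:E <= tree_maximal mu T phi x)%E] /\
  l * mass mu [set x | (l%:E <= tree_maximal mu T phi x)%E] <=
  load mu phi [set x | (l%:E <= tree_maximal mu T phi x)%E].
Proof.
move=> l0; pose c (n : nat) : R := l - l / n.+2%:R.
pose F n := [set x | ((c n)%:E < tree_maximal mu T phi x)%E].
have cl n : c n < l by rewrite /c ltrBlDr ltrDl divr_gt0.
have c0 n : 0 < c n.
  by rewrite /c subr_gt0 ltr_pdivrMr// ltr_pMr// ltr1n.
have cnd n m : (n <= m)%N -> c n <= c m.
  by move=> nm; rewrite /c lerB// ler_pM2l// lef_pV2 ?posrE// ler_nat.
have hF n := weak_type_gt hT phi0 iphi (c0 n).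
have mF n : measurable (F n) by case: (hF n).
have e : [set x | (l%:E <= tree_maximal mu T phi x)%E] = \bigcap_n F n.
  apply/seteqP; split => x /=.
    by move=> h n _; apply: lt_le_trans h; rewrite lte_fin.
  move=> h; apply/lee_subgt0Pr => eps e0.
  have [n hn] := invn_lt (divr_gt0 e0 l0).
  apply: ltW; apply: le_lt_trans (h n I); rewrite -EFinD lee_fin /c lerB//.
  rewrite mulrC -ler_pdivlMr//; apply: le_trans (ltW hn).
  by rewrite lef_pV2 ?posrE// ler_nat.
have mE : measurable (\bigcap_n F n) by exact: bigcap_measurable.
have niF n m : (n <= m)%N -> F m `<=` F n.
  by move=> nm x /=; apply: le_lt_trans; rewrite lee_fin cnd.
rewrite e; split => //.
have low k : c k * mass mu (\bigcap_n F n) <= load mu phi (\bigcap_n F n).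
  apply: load_bigcap_ge => //; first by move=> n; exact: niF.
  move=> n; have [_ h] := hF (maxn n k).
  apply: (@le_trans _ _ (load mu phi (F (maxn n k)))); last first.
    by apply: (load_le phi0 iphi (mF (maxn n k)) (mF n)); apply: niF; exact: leq_maxl.
  apply: le_trans h; apply: ler_pM => //.
  - exact: ltW.
  - exact: mass_ge0.
  - by apply: cnd; exact: leq_maxr.
  - by apply: (mass_le mu mE (mF (maxn n k))) => x; apply.
set a := mass mu _ in low *; set b := load mu phi _ in low *.
rewrite leNgt; apply/negP => h.
have la0 : 0 < l * a by have := load_ge0 mu phi0 (\bigcap_n F n); rewrite -/b; lra.
have ab0 : 0 < l * a - b by rewrite subr_gt0.
have [n hn] := invn_lt (divr_gt0 ab0 la0).
have := low n; rewrite /c leNgt => /negP; apply.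
have h1 : n.+2%:R^-1 < (l * a - b) / (l * a).
  by apply: le_lt_trans hn; rewrite lef_pV2 ?posrE// ler_nat.
rewrite ltr_pdivlMr// in h1.
have -> : (l - l / n.+2%:R) * a = l * a - n.+2%:R^-1 * (l * a) by ring.
by move: h1; set i := n.+2%:R^-1 * (l * a); lra.
Qed.

End weak_type_ge.

(** * Realization of monotone functions on a tree *)

Section realization.
Context {R : realType} {d : measure_display} {X : measurableType d}.
Variable mu : probability X R.
Local Notation mass := (mass mu).
Local Notation load := (load mu).

Lemma ge0_integral_mrestr (A : set X) (mA : measurable A) (f : X -> \bar R) :
  measurable_fun setT f -> (forall x, 0 <= f x)%E ->
  (\int[mrestr mu mA]_x f x = \int[mu]_(x in A) f x)%E.
Proof.
move=> mf f0; have mAC : measurable (~` A) by exact: measurableC.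
transitivity (\int[mrestr mu mA]_(x in A) f x)%E.
  rewrite -(setvU A) ge0_integral_setU//.
  - rewrite [X in (X + _)%E]null_set_integral ?add0e//; first exact: measurable_funTS.
    exact: (eq_ind_r (fun Z => mu Z = 0%E) (measure0 mu) (setICl A)).
  - by rewrite setvU.
  - exact/disj_set2P/setICl.
apply: eq_measure_integral => B mB BA.
exact: (congr1 mu (setIidl BA)).
Qed.

Definition law_of (S : X -> R) (mS : measurable_fun setT (S : X -> measurableTypeR R))
  (A : set X) (mA : measurable A) : {measure set (measurableTypeR R) -> \bar R}.
Proof. by refine (pushforward (mrestr mu mA) (S : X -> measurableTypeR R)). Defined.

(** The restrictions of the law of [S] to the two pieces are proportional. *)
Lemma proportional_load (S : X -> R) (h : R -> R) (I A : set X) dl :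
  measurable_fun setT S -> (forall x, 0 < S x) -> measurable I -> measurable A ->
  (forall x, I x -> S x <= dl) -> (forall x, A x -> S x <= dl) ->
  (forall t, 0 <= t <= dl -> (mass A * mass (I `&` [set x | S x <= t]) =
     mass I * mass (A `&` [set x | S x <= t]))) ->
  measurable_fun setT h -> (forall s, 0 <= h s) ->
  mu.-integrable setT (EFin \o (h \o S)) ->
  mass A * load (h \o S) I = mass I * load (h \o S) A.
Proof.
move=> mS S0 mI mA Idl Adl law mh h0 iS.
have mS' : measurable_fun setT (S : X -> measurableTypeR R) := mS.
have a0 := mass_ge0 mu A; have i0 := mass_ge0 mu I.
have muI (B : set X) (D : set R) : measurable B -> measurable D ->
    mu (S @^-1` D `&` B) = (mass (B `&` (S @^-1` D)))%:E.
  move=> mB mD; rewrite setIC massE//; apply: measurableI => //.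
  by have := mS measurableT _ mD; rewrite setTI.
pose m1 : {measure set (measurableTypeR R) -> \bar R} := mscale (NngNum a0) (law_of mS' mI).
pose m2 : {measure set (measurableTypeR R) -> \bar R} := mscale (NngNum i0) (law_of mS' mA).
have m1E (D : set R) : measurable D -> m1 D = (mass A * mass (I `&` (S @^-1` D)))%:E.
  by move=> mD; rewrite EFinM -muI.
have m2E (D : set R) : measurable D -> m2 D = (mass I * mass (A `&` (S @^-1` D)))%:E.
  by move=> mD; rewrite EFinM -muI.
have ray t (Z : set X) : Z `&` (S @^-1` `]-oo, t]) = Z `&` [set x | S x <= t].
  by apply/seteqP; split => x []; rewrite /= in_itv.
have key (D : set (measurableTypeR R)) : measurable D -> m1 D = m2 D.
  apply: rays_determine.
  - exact: (eq_ind_r (fun z => (z < +oo)%E) (ltry _) (m1E setT measurableT)).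
  - exact: (eq_ind_r (fun z => (z < +oo)%E) (ltry _) (m2E setT measurableT)).
  move=> t; transitivity (mass A * mass (I `&` [set x | S x <= t]))%:E.
    by rewrite -ray; apply: m1E; exact: measurable_itv.
  transitivity (mass I * mass (A `&` [set x | S x <= t]))%:E; last first.
    by rewrite -ray; apply/esym/m2E; exact: measurable_itv.
  congr EFin; have [t0|t0] := ltP t 0.
    have e : [set x | S x <= t] = set0.
      by rewrite -subset0 => x /= h'; have := S0 x; lra.
    by rewrite e !setI0 /mass measure0 !mulr0.
  have [tdl|dlt] := leP t dl; first by apply: law; rewrite t0.
  have full (Z : set X) : (forall x, Z x -> S x <= dl) -> Z `&` [set x | S x <= t] = Z.
    move=> Zdl; apply/seteqP; split => [x []//|x Zx]; split => //=.
    exact: le_trans (Zdl _ Zx) (ltW dlt).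
  by rewrite (full I)// (full A)// mulrC.
have mhE : measurable_fun setT (EFin \o h : measurableTypeR R -> \bar R) by exact/measurable_EFinP.
have mhS : measurable_fun setT (EFin \o (h \o S)) by have /integrableP[] := iS.
have intE (B : set X) (mB : measurable B) (c : {nonneg R}) :
    (\int[mscale c (law_of mS' mB)]_y (h y)%:E =
     (c%:num * load (h \o S) B)%:E)%E.
  rewrite ge0_integral_mscale//; last by move=> x _; rewrite lee_fin.
  rewrite (ge0_integral_pushforward mS')//; last by move=> x _; rewrite lee_fin.
  rewrite preimage_setT ge0_integral_mrestr//; last by move=> x; rewrite lee_fin.
  by rewrite EFinM; congr (_ * _)%E; rewrite -loadE.
apply: EFin_inj; rewrite -[mass A]/((NngNum a0)%:num) -[mass I]/((NngNum i0)%:num).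
rewrite -(intE I mI (NngNum a0)) -(intE A mA (NngNum i0)).
by apply: eq_measure_integral => D mD _; exact: key.
Qed.

End realization.

Section realization_on_tree.
Context {R : realType} {d : measure_display} {X : measurableType d}.
Variable mu : probability X R.
Variables (T : set (set X)) (C : set X -> set (set X)).
Hypothesis hT : tree_with mu T C.
Local Notation E := (Rintegral mu setT).
Local Notation int f := (mu.-integrable setT (EFin \o f)).

(** The masses of the elements of a fine level are smaller than [eps], and those
    of all elements of the level sum up to 1: add them until [dl] is passed. *)
Lemma tree_union_approx (dl eps : R) : 0 < dl < 1 -> 0 < eps ->
  exists (I : nat -> set X) (n : nat) (dl' : R), [/\ forall j, T (I j) \/ I j = set0,
    forall i j, i <> j -> mu (I i `&` I j) = 0%E,
    mu (\big[setU/set0]_(j < n) I j) = dl'%:E & dl - eps < dl' <= dl].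
Proof.
move=> /andP[dl0 dl1] eps0.
have [m hm] := tree_mesh_lt hT eps0.
have [e [eA Ae einj]] := countable_enum (countable_tree_level hT m).
have mI n : measurable (e n).
  by case: (eA n) => [/(tree_levelT hT)/(tree_measurable hT)|->].
have e0 i j : i <> j -> mu (e i `&` e j) = 0%E.
  move=> ij; have [h|/eqP h] := eqVneq (e i) (e j).
    by rewrite (einj _ _ ij h) set0I measure0.
  case: (eA i) => [Ai|->]; last by rewrite set0I measure0.
  case: (eA j) => [Aj|->]; last by rewrite setI0 measure0.
  exact: (tree_level_null hT Ai Aj).
pose G n := \big[setU/set0]_(j < n) e j.
have mG n : measurable (G n) by exact: bigsetU_measurable.
have [N hN] : exists N, dl < mass mu (G N).
  apply: contrapT => /forallNP h.
  have : (mu (\bigcup_n G n) <= dl%:E)%E.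
    apply: mu_bigcup_le => //; first by move=> n x; rewrite /G big_ord_recr/=; left.
    by move=> n; rewrite massE// lee_fin leNgt; apply/negP; exact: h.
  have -> : \bigcup_n G n = setT.
    apply/seteqP; split => // x _; have [I mI' Ix] := tree_level_cover hT m x.
    have [n nI] := Ae _ mI'; exists n.+1 => //.
    by rewrite /G big_ord_recr/=; right; rewrite nI.
  by rewrite probability_setT lee_fin; lra.
have [[|n] hn nmin] := ex_minnP (ex_intro (fun n => dl < mass mu (G n)) N hN).
  by move: hn; rewrite /G big_ord0 /mass measure0 /=; lra.
exists e, n, (mass mu (G n)); split => //.
- by move=> j; case: (eA j) => [/(tree_levelT hT)|]; [left|right].
- by rewrite massE; [|exact: mG].
have h1 : mass mu (G n) <= dl.
  by rewrite leNgt; apply/negP => /nmin; rewrite ltnn.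
rewrite h1 andbT.
have h2 : mass mu (G n.+1) <= mass mu (G n) + mass mu (e n).
  rewrite -lee_fin EFinD -!massE// /G big_ord_recr/=.
  by apply: measureU2 => //; exact: mG.
have h3 : mass mu (e n) < eps.
  case: (eA n) => [/hm|->]; first by rewrite massE// lte_fin.
  by rewrite /mass measure0.
lra.
Qed.

(** On a union [A] of almost disjoint tree elements, of measure slightly less than
    [dl], choose [S] so that [A] is the set where it is smallest and each element
    sees the same distribution of [S] as [A] does.  The average of [g \o S] over
    each element is then its average over [A], which is at least [lam]. *)
Lemma realize (g : R -> R) (lam dl eps : R) :
  measurable_fun setT g -> (forall s, 0 <= g s) ->
  (forall s t, 0 < s -> s <= t -> t <= 1 -> g t <= g s) ->
  0 < lam -> 0 < dl < 1 -> 0 < eps ->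
  (forall S, uniform01 mu S -> int (g \o S)) ->
  (forall S, uniform01 mu S -> lam * dl <= E (fun x => g (S x) * (S x <= dl)%R%:R)) ->
  exists2 S, uniform01 mu S &
    ((dl - eps)%:E <= mu [set x | (lam%:E <= tree_maximal mu T (g \o S) x)%E])%E.
Proof.
move=> mg g0 gni lam0 /andP[dl0 dl1] eps0 ig hg.
have [V [mV V01 Vat]] := tree_coordinate hT.
have eps1 : 0 < Num.min eps (dl / 2) by rewrite lt_min eps0 divr_gt0.
have dl01 : 0 < dl < 1 by rewrite dl0.
have [I [n [dl' [TI nI muI /andP[dl'1 dl'2]]]]] := tree_union_approx dl01 eps1.
have mine : Num.min eps (dl / 2) <= eps by rewrite ge_min lexx.
have mind : Num.min eps (dl / 2) <= dl / 2 by rewrite ge_min lexx orbT.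
have dl'0 : 0 < dl' by lra.
have mI j : measurable (I j) by case: (TI j) => [/(tree_measurable hT)|->].
have [] := @tailored_uniform _ _ _ mu V mV V01 Vat I n dl' mI nI muI.
  by apply/andP; split; lra.
set A := \big[setU/set0]_(j < n) I j in muI *.
have mA : measurable A by exact: bigsetU_measurable.
move=> S [uS SA Sj].
have [mS S01 St] := uS.
have S0 x : 0 < S x by have /andP[] := S01 x.
have S1 x : S x <= 1 by have /andP[] := S01 x.
exists S => //.
have igS := ig _ uS.
have gS0 x : 0 <= (g \o S) x by exact: g0.
have [mE _] := weak_type hT gS0 igS lam0.
apply: (@le_trans _ _ (mu A)); first by rewrite muI lee_fin; lra.
apply: le_measure; rewrite ?inE//.
have ile t : int (fun x => (S x <= t)%R%:R) by apply: int_ind; exact: measurable_uniform_le uS _.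
have igle t : int (fun x => g (S x) * (S x <= t)%R%:R).
  by apply: int_Mind => //; exact: measurable_uniform_le uS _.
(* averages of a nonincreasing function over [(0, t]] decrease with [t] *)
have sub : lam * dl' <= E (fun x => g (S x) * (S x <= dl')%R%:R).
  have h := hg _ uS.
  have e1 : E (fun x => (S x <= dl)%R%:R) = dl by apply: (E_uniform_le uS); lra.
  have e2 : E (fun x => (S x <= dl')%R%:R) = dl' by apply: (E_uniform_le uS); lra.
  have h1 : E (fun x => g dl' * (S x <= dl')%R%:R) <= E (fun x => g (S x) * (S x <= dl')%R%:R).
    apply: E_le => //; first exact: int_Z.
    move=> x; case: (leP (S x) dl') => [h'|_]; last by rewrite !mulr0.
    by rewrite !mulr1 gni//; lra.
  have h2 : E (fun x => g (S x) * (S x <= dl)%R%:R) <=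
      E (fun x => g (S x) * (S x <= dl')%R%:R + g dl' * ((S x <= dl)%R%:R - (S x <= dl')%R%:R)).
    apply: E_le => //; first by apply: int_D => //; apply: int_Z; apply: int_B.
    move=> x; case: (leP (S x) dl') => [h'|h'].
      by rewrite (le_trans h' dl'2) subrr mulr0 addr0.
    rewrite mulr0 add0r subr0; case: (S x <= dl); rewrite ?mulr0// !mulr1.
    by apply: gni => //; exact: ltW.
  rewrite E_D// in h2; last by apply: int_Z; apply: int_B.
  rewrite E_Z ?E_B// in h2; last by apply: int_B.
  rewrite E_Z// e2 in h1; rewrite e1 e2 in h2.
  have [glam|glam] := leP (g dl') lam.
    have : g dl' * (dl - dl') <= lam * (dl - dl') by rewrite ler_wpM2r//; lra.
    lra.
  apply: le_trans h1; rewrite ler_wpM2r//; exact: ltW.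
have loadA : load mu (g \o S) A = E (fun x => g (S x) * (S x <= dl')%R%:R).
  rewrite /load Rintegral_mkcond; apply: eq_E => x; rewrite patchE SA.
  by case: ifP; rewrite ?mulr1 ?mulr0.
move=> x; rewrite /A -bigcup_mkord => -[j /= jn Ijx].
have TIj : T (I j) by case: (TI j) => // e; rewrite e in Ijx.
have massA : mass mu A = dl' by rewrite /mass muI.
have IA : I j `<=` A by move=> y Iy; rewrite /A -bigcup_mkord; exists j.
have AS y : A y -> S y <= dl' by move=> Ay; rewrite SA mem_set.
apply: (maximal_ge hT gS0 igS TIj Ijx).
have prop : dl' * load mu (g \o S) (I j) = mass mu (I j) * load mu (g \o S) A.
  rewrite -{1}massA; apply: (@proportional_load _ _ _ mu S g (I j) A dl') => //.
    by move=> y /IA /AS.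
  move=> t t01; rewrite massA.
  have -> : A `&` [set x | S x <= t] = [set x | S x <= t].
    apply/seteqP; split => [y []//|y /= h]; split => //; apply: set_mem; rewrite -SA.
    by case/andP: t01 => _; exact: le_trans.
  have mt : measurable [set x | S x <= t] by exact: measurable_le.
  apply: EFin_inj; rewrite !EFinM -!massE//; last by apply: measurableI.
  by rewrite Sj// St//; lra.
rewrite -(ler_pM2l dl'0) prop loadA.
have -> : dl' * (lam * mass mu (I j)) = mass mu (I j) * (lam * dl') by ring.
by apply: ler_wpM2l => //; exact: mass_ge0.
Qed.

End realization_on_tree.

(** * Powers of numbers in the unit interval *)

Section unit_powers.
Context {R : realType}.

Lemma powR_lt1 r (x : R) : 0 < r -> 0 <= x -> x < 1 -> x `^ r < 1.
Proof. by move=> r0 x0 x1; have := powR_lt r0 x0 x1; rewrite powR1. Qed.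

Lemma powR_le1 r (x : R) : 0 <= r -> 0 <= x -> x <= 1 -> x `^ r <= 1.
Proof. by move=> r0 x0 x1; have := powR_le r0 x0 x1; rewrite powR1. Qed.

Lemma powR_ge1 r (x : R) : 0 <= r -> 1 <= x -> 1 <= x `^ r.
Proof. by move=> r0 x1; have := powR_le r0 ler01 x1; rewrite powR1. Qed.

End unit_powers.

(** * Intermediate values *)

Section intermediate_values.
Context {R : realType}.
Implicit Types (h : R -> R) (a b A : R).

Lemma sup_level h a b A : a <= b -> h a <= A ->
  exists c, [/\ a <= c <= b, forall x, a <= x <= b -> h x <= A -> x <= c &
    forall eps, 0 < eps -> exists x, [/\ a <= x <= b, h x <= A, c - eps < x & x <= c]].
Proof.
move=> ab hA; pose S := [set x | a <= x <= b /\ h x <= A]; pose c := sup S.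
have Sa : S a by split => //; rewrite lexx ab.
have Sb : ubound S b by move=> x [/andP[]].
have hs : has_sup S by split; [exists a|exists b].
have Sc : ubound S c by exact: sup_upper_bound.
exists c; split.
- by rewrite (Sc _ Sa)/= ge_sup//; exists a.
- by move=> x xab hx; exact: Sc.
- move=> eps eps0; have [x Sx cx] := sup_adherent eps0 hs.
  by exists x; case: (Sx) => ? ?; split => //; exact: Sc.
Qed.

(** A function bounded below, up to any error, by an affine minorant at each
    point is convex and lower semicontinuous, hence takes intermediate values. *)
Lemma convex_IVT h a b A : a <= b ->
  (forall x eps, a <= x <= b -> 0 < eps ->
    exists s, forall y, a <= y <= b -> h x - eps + s * (y - x) <= h y) ->
  h a <= A <= h b -> exists2 x, a <= x <= b & h x = A.
Proof.
move=> ab tangent /andP[hA Ah]; have [c [/andP[ac cb] cub cadh]] := sup_level ab hA; exists c; first by rewrite ac.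
have hcA : h c <= A.
  rewrite leNgt; apply/negP => hc; pose e := (h c - A) / 2.
  have e0 : 0 < e by rewrite divr_gt0// subr_gt0.
  have [|s hs] := tangent c e _ e0; first by rewrite ac.
  have s0 : 0 < `|s| + 1 by rewrite ltr_wpDl.
  have [x [xab hx cx xc]] := cadh (e / (`|s| + 1)) (divr_gt0 e0 s0).
  have := hs x xab; have : `|s * (x - c)| < e.
    rewrite normrM; have : `|x - c| < e / (`|s| + 1) by rewrite distrC ger0_norm; lra.
    rewrite ltr_pdivlMr// mulrC => h1.
    by apply: le_lt_trans h1; rewrite mulrDl lerDl mul1r.
  by rewrite ltr_norml => /andP[h1 h2]; rewrite /e in h1 h2 *; lra.
apply/eqP; rewrite eq_le hcA /= leNgt; apply/negP => hc.
have hcb : 0 < h b - h c by lra.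
have cb' : c < b.
  by rewrite lt_neqAle cb andbT; apply/negP => /eqP cbE; move: hcb; rewrite cbE subrr ltxx.
pose t := (A - h c) / (h b - h c); pose x := c + t * (b - c).
have t0 : 0 < t by rewrite divr_gt0// subr_gt0.
have t1 : t <= 1 by rewrite ler_pdivrMr// mul1r; lra.
have xc : 0 < t * (b - c) by rewrite mulr_gt0// subr_gt0.
have xb : t * (b - c) <= b - c by rewrite ler_piMl// subr_ge0.
have xab : a <= x <= b by rewrite /x; apply/andP; split; lra.
have [hx|hx] := leP (h x) A; first by have := cub x xab hx; rewrite /x; lra.
have e0 : 0 < (h x - A) / 2 by rewrite divr_gt0// subr_gt0.
have [s hs] := tangent x _ xab e0.
have h1 := hs c ltac:(by rewrite ac cb); have h2 := hs b ltac:(by rewrite ab lexx).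
have tA : t * (h b - h c) = A - h c by rewrite /t divfK// gt_eqF.
have h3 : (1 - t) * (h x - (h x - A) / 2 + s * (c - x)) <= (1 - t) * h c.
  by rewrite ler_wpM2l// subr_ge0.
have h4 : t * (h x - (h x - A) / 2 + s * (b - x)) <= t * h b by rewrite ler_wpM2l// ltW.
have : (1 - t) * (h x - (h x - A) / 2 + s * (c - x)) +
    t * (h x - (h x - A) / 2 + s * (b - x)) = h x - (h x - A) / 2 by rewrite /x; field.
lra.
Qed.

Lemma convex_IVT_decr h a b A : a <= b ->
  (forall x eps, a <= x <= b -> 0 < eps ->
    exists s, forall y, a <= y <= b -> h x - eps + s * (y - x) <= h y) ->
  h b <= A <= h a -> exists2 x, a <= x <= b & h x = A.
Proof.
move=> ab tangent hA.
have [||x xab hx] := @convex_IVT (fun x => h (a + b - x)) a b A ab.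
- move=> x eps xab eps0; have [|s hs] := tangent (a + b - x) eps _ eps0; first by lra.
  exists (- s) => y yab; have := hs (a + b - y) ltac:(lra).
  by have -> : s * (a + b - y - (a + b - x)) = - s * (y - x) by ring.
- have -> : a + b - a = b by ring.
  by have -> : a + b - b = a by ring.
by exists (a + b - x) => //; lra.
Qed.

(** Only an upward jump could skip a level on the way up, and the continuity of
    [rho] excludes it. *)
Lemma dominated_IVT h rho a b A : a <= b ->
  (forall x, a <= x <= b -> {for x, continuous rho}) ->
  (forall x y, a <= x -> x < y -> y <= b -> h y - h x <= rho y - rho x) ->
  h a <= A <= h b -> exists2 x, a <= x <= b & h x = A.
Proof.
move=> ab crho hrho /andP[hA Ah]; have [c [/andP[ac cb] cub cadh]] := sup_level ab hA; exists c; first by rewrite ac.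
have near_c e : 0 < e -> exists2 eta, 0 < eta & forall x, `|x - c| < eta -> `|rho x - rho c| < e.
  move=> e0; have := crho c; rewrite ac cb => /(_ isT) /cvgrPdist_lt /(_ e e0).
  move=> /nbhs_ballP[eta /= eta0 he]; exists eta => // x xc.
  by rewrite distrC; apply: he; rewrite /ball /= distrC.
apply/eqP; rewrite eq_le; apply/andP; split; rewrite leNgt; apply/negP => hc.
  have [|eta eta0 he] := near_c (h c - A); first by rewrite subr_gt0.
  have [x [/andP[ax xb] hx cx xc]] := cadh eta eta0.
  have {}xc : x < c.
    by rewrite lt_neqAle xc andbT; apply/negP => /eqP xE; move: hx; rewrite xE; lra.
  have := hrho x c ax xc cb; have := he x ltac:(by rewrite distrC ger0_norm; lra).
  by rewrite ltr_norml => /andP[]; lra.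
have [|eta eta0 he] := near_c (A - h c); first by rewrite subr_gt0.
have cb' : c < b.
  by rewrite lt_neqAle cb andbT; apply/negP => /eqP cbE; move: hc; rewrite cbE; lra.
pose d := Num.min (eta / 2) (b - c).
have d0 : 0 < d by rewrite lt_min subr_gt0 cb' divr_gt0.
have d1 : d <= b - c by rewrite ge_min lexx orbT.
have d2 : d <= eta / 2 by rewrite ge_min lexx.
have := hrho c (c + d) ac ltac:(lra) ltac:(lra).
have := he (c + d) ltac:(by rewrite addrAC subrr add0r ger0_norm; lra).
rewrite ltr_norml => /andP[_ h1] h2.
have := cub (c + d) ltac:(lra) ltac:(lra); lra.
Qed.

End intermediate_values.

(** * Minimizers at a given level *)

Section optimal_profiles.
Context {R : realType}.
Variables p q : R.
Hypotheses (q1 : 1 < q) (qp : q < p).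
Local Notation k := ((p - 1) / p).
Local Notation kk := (1 - p^-1).
Local Notation kq := (1 - q / p).
Local Notation G := (Gam p q).
Local Notation w := (wtail p).
Local Notation Tf := (Tfun p q).
Local Notation Ff := (Ffun p q).
Local Notation K := (Kfun p).
Local Notation be0 := (beta0 p).

Let p0 : 0 < p. Proof. have ? := q1; have ? := qp; lra. Qed.
Let k0 : 0 < k. Proof. apply: divr_gt0 => //; have ? := q1; have ? := qp; lra. Qed.
Let kE : k = kk. Proof. by field; rewrite gt_eqF. Qed.
Let ip01 : 0 < p^-1 < 1.
Proof. by rewrite invr_gt0 p0 invf_lt1//; have ? := q1; have ? := qp; lra. Qed.
Let qp01 : 0 < q / p < 1.
Proof. by rewrite divr_gt0 ?ltr_pdivrMr ?mul1r//; have ? := q1; have ? := qp; lra. Qed.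

Ltac plra := have ? := q1; have ? := qp; have ? := ip01; have ? := qp01; lra.

Let kk0 : 0 < kk. Proof. plra. Qed.
Let kq0 : 0 < kq. Proof. plra. Qed.
Let pq0 : 0 < p - q. Proof. plra. Qed.
Let k1 : k < 1. Proof. rewrite kE; plra. Qed.
Let kkE : kq / kk = (p - q) / (p - 1).
Proof.
by field; rewrite !gt_eqF//; plra.
Qed.
Let q0 : 0 < q. Proof. plra. Qed.
Local Notation lp l := ((l `^ p)^-1).

Lemma Gam_gt0 : 0 < G.
Proof. by rewrite /Gam mulr_gt0 ?powR_gt0// divr_gt0. Qed.

Lemma GamE : G - k `^ q = k `^ q * (q / (p - q)).
Proof. by rewrite /Gam; field; rewrite gt_eqF. Qed.

Lemma wtail_mul s : 0 < s -> w s * s = k * s `^ kk.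
Proof.
move=> s0; rewrite /wtail -mulrA; congr (_ * _).
by rewrite powRDx// powRr1 ?(ltW s0)// mulrC.
Qed.

Lemma wtail_powq_mul s : 0 < s -> w s `^ q * s = k `^ q * s `^ kq.
Proof.
move=> s0; rewrite (wtail_powRq q1 qp)// -mulrA; congr (_ * _).
by rewrite powRDx// powRr1 ?(ltW s0)// mulrC.
Qed.

Lemma beta0_gt0 l : 0 < l -> 0 < be0 l.
Proof. by move=> l0; rewrite /beta0 powR_gt0// divr_gt0. Qed.

Lemma wtail_beta0 l : 0 < l -> w (be0 l) = l.
Proof. by move=> l0; exact: (wtailK q1 qp). Qed.

(** [wtail p y] is the derivative of [y^(1 - 1/p)], a concave power. *)
Lemma wtail_concave x y : 0 <= x -> 0 < y -> x `^ kk <= y `^ kk + w y * (x - y).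
Proof.
move=> x0 y0; have kk01 : 0 < kk < 1 by plra.
have := powR_concave kk01 x0 y0.
have -> : kk - 1 = - p^-1 by ring.
by rewrite /wtail kE.
Qed.

Lemma wtail_concave_lt x y : 0 <= x -> 0 < y -> x != y ->
  x `^ kk < y `^ kk + w y * (x - y).
Proof.
move=> x0 y0 xy; have kk01 : 0 < kk < 1 by plra.
have := powR_concave_lt kk01 x0 y0 xy.
have -> : kk - 1 = - p^-1 by ring.
by rewrite /wtail kE.
Qed.

(** The minimizer on the part carrying the average [l]: when the constant [l]
    exceeds the bound [w al], a plateau [(0, b]] must be lifted above it. *)
Lemma T_profile l al : 0 < l -> 0 < al -> l * al <= al `^ kk -> exists b v,
  [/\ [/\ 0 <= b, b <= al, 0 <= v, 0 < b -> v <= w b & 0 < b -> b < al -> w b <= v],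
      v * b + al `^ kk - b `^ kk = l * al,
      v `^ q * b + G * (al `^ kq - b `^ kq) = Tf l al,
      [/\ 0 < b -> l <= v, (v = l /\ l <= w al) \/ w al <= l & l * al < al `^ kk -> 0 < b] &
      be0 l <= al -> b `^ kk = p * (al `^ kk - l * al) /\
        Tf l al = G * al `^ kq - (G - k `^ q) * b `^ kq].
Proof.
move=> l0 al0 hl; rewrite /Tfun.
have b00 := beta0_gt0 l0; have wb0 := wtail_beta0 l0.
case: ifPn => [alb|]; last rewrite -ltNge => bal.
  exists al, l; have wal : l <= w al by rewrite -{1}wb0 (wtail_le q1 qp).
  split => //.
  - by split => //; [exact: ltW|exact: ltW|rewrite ltxx].
  - by ring.
  - by rewrite subrr mulr0 addr0.
  - by split => //; left.
  - move=> b0al; have {}alb : al = be0 l by apply/eqP; rewrite eq_le alb.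
    have e : l * al = k * al `^ kk by rewrite -wtail_mul// alb wb0.
    split; first by rewrite e kE; field; rewrite gt_eqF.
    by rewrite -{1}wb0 -alb wtail_powq_mul//; ring.
pose U := p * (al `^ kk - l * al); have U0 : 0 <= U by rewrite mulr_ge0 ?subr_ge0// ltW.
pose b := U `^ kk^-1.
have bk : b `^ kk = U by rewrite /b powRVK// gt_eqF.
have b0 : 0 <= b by exact: powR_ge0.
have wall : w al < l by rewrite -{1}wb0 (wtail_lt q1 qp).
have bal' : b < al.
  rewrite ltNge; apply/negP => /(powR_le (ltW kk0) (ltW al0)); rewrite bk.
  have := wtail_mul al0; have : w al * al < l * al by rewrite ltr_pM2r.
  rewrite /U kE => h1 h2.
  have : p * (1 - kk) = 1 by field; rewrite gt_eqF.
  have : p * (kk * al `^ kk) < p * (l * al) by rewrite ltr_pM2l// -h2.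
  move=> h3 h4 h5; have : p * (1 - kk) * al `^ kk = al `^ kk by rewrite h4 mul1r.
  lra.
have bb0 : b <= be0 l.
  rewrite leNgt; apply/negP => /(powR_lt kk0 (ltW b00)); rewrite bk /U.
  have := wtail_concave (ltW al0) b00; rewrite wb0 => h1.
  have e : l * be0 l = k * be0 l `^ kk by rewrite -wtail_mul// wb0.
  have : p * (al `^ kk - l * al) <= p * (be0 l `^ kk - l * be0 l).
    rewrite ler_pM2l// lerBlDr; apply: le_trans h1 _.
    by rewrite le_eqVlt; apply/orP; left; apply/eqP; ring.
  rewrite e kE; have -> : p * (be0 l `^ kk - kk * be0 l `^ kk) = be0 l `^ kk.
    by field; rewrite gt_eqF.
  by move=> h2 h3; have := le_lt_trans h2 h3; rewrite ltxx.
have TE : k `^ q / (p - q) * (p * al `^ kq - q * U `^ ((p - q) / (p - 1))) =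
    G * al `^ kq - (G - k `^ q) * b `^ kq.
  by rewrite GamE /b -powRrM [kk^-1 * kq]mulrC kkE /Gam; field; rewrite gt_eqF.
exists b, (if 0 < b then w b else l); case: ifPn => [b1|].
  split => //.
  - by split => //; [exact: ltW|exact: wtail_ge0 q1 qp _].
  - by rewrite wtail_mul// bk /U kE; field; rewrite gt_eqF.
  - by rewrite wtail_powq_mul// TE; ring.
  - by split => //; [rewrite -{1}wb0 (wtail_le q1 qp)|right; exact: ltW].
rewrite -leNgt => b1; have bz : b = 0 by apply/eqP; rewrite eq_le b1.
have Uz : U = 0 by rewrite -bk bz powR0// gt_eqF.
have alz : al `^ kk - l * al = 0.
  by apply/eqP; have /eqP := Uz; rewrite mulf_eq0 (gt_eqF p0).
have [kkn kqn] : kk != 0 /\ kq != 0 by rewrite !gt_eqF.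
split => //.
- by split => //; exact: ltW.
- by rewrite bz powR0//; lra.
- by rewrite TE bz !powR0//; ring.
- by split => //; [right; exact: ltW|rewrite -subr_gt0 alz ltxx].
Qed.

Lemma level_gt0 l : 0 < l -> 0 < lp l.
Proof. by move=> l0; rewrite invr_gt0 powR_gt0. Qed.

Lemma levelE l : 0 < l -> l * lp l = lp l `^ kk.
Proof.
move=> l0; rewrite -powRN -powRrM -{1}(powRr1 (ltW l0)) -powRDx//.
by congr (_ `^ _); field; rewrite gt_eqF.
Qed.

Lemma wtail_level l : 0 < l -> w (lp l) = k * l.
Proof.
move=> l0; have kl0 := mulr_gt0 k0 l0.
rewrite -[RHS](wtailK q1 qp kl0); congr (wtail _ _).
by rewrite invfM mulrA mulfV ?gt_eqF// mul1r -powRN -powR_inv1 ?(ltW l0)// -powRrM mulN1r.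
Qed.

Lemma lt_level l al : 0 < l -> 0 < al -> (l * al < al `^ kk) = (al < lp l).
Proof.
move=> l0 al0; have kl0 := mulr_gt0 k0 l0.
rewrite -(ltr_pM2l k0) -wtail_mul// mulrA ltr_pM2r// (lt_wtail q1 qp)//; congr (_ < _).
by rewrite invfM mulrA mulfV ?gt_eqF// mul1r -powRN -powR_inv1 ?(ltW l0)// -powRrM mulN1r.
Qed.

(** [l^(-p)] is where the integral [al^(1 - 1/p)] of [w] over [(0, al]] no longer
    provides the average [l]. *)
Lemma le_level l al : 0 < l -> 0 < al -> (l * al <= al `^ kk) = (al <= lp l).
Proof.
move=> l0 al0; apply/idP/idP; last first.
  rewrite le_eqVlt => /predU1P[->|]; first by rewrite levelE.
  by rewrite -lt_level// => /ltW.
apply: contraTT; rewrite -!ltNge => h.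
rewrite -(ltr_pM2l k0) -wtail_mul// mulrA ltr_pM2r// -wtail_level//.
by apply: (wtail_lt q1 qp) => //; exact: level_gt0.
Qed.

Lemma beta0_lt_level l : 0 < l -> be0 l < lp l.
Proof.
move=> l0; have b0 := beta0_gt0 l0.
rewrite -lt_level// -(ltr_pM2l k0) -wtail_mul// (wtail_beta0)// mulrA ltr_pM2r//.
by rewrite gtr_pMl.
Qed.

Lemma T_saturated l al : 0 < l -> 0 < al -> l * al = al `^ kk -> Tf l al = G * al `^ kq.
Proof.
move=> l0 al0 e; have [|b [v [_ _ _ _ h]]] := T_profile l0 al0; first by rewrite e.
have [] := h; last first.
  rewrite e subrr mulr0 => b0 ->.
  have -> : b = 0 by apply/eqP; move/eqP: b0; rewrite powR_eq0 => /andP[].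
  by rewrite powR0 ?gt_eqF// mulr0 subr0.
apply/ltW/(lt_le_trans (beta0_lt_level l0)).
by rewrite leNgt -lt_level// e ltxx.
Qed.

(** [K f1 l x <= 0] says that what remains of the mean when [E] carries [l x] does
    not exceed [1 - x^(1 - 1/p)], the most that the complement of [E] can carry. *)
Lemma K_le_beta0 f1 l x : 0 < l -> 0 <= x -> K f1 l x <= K f1 l (be0 l).
Proof.
move=> l0 x0; have := wtail_concave x0 (beta0_gt0 l0).
rewrite (wtail_beta0)// /Kfun; lra.
Qed.

Lemma K_decreasing f1 l x y : 0 < l -> be0 l <= x -> x < y -> K f1 l y < K f1 l x.
Proof.
move=> l0 bx xy; have b0 := beta0_gt0 l0.
have x0 : 0 < x by exact: lt_le_trans bx.
have wl : w x <= l by rewrite -(wtail_beta0 l0) (wtail_le q1 qp).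
have := @wtail_concave_lt y x ltac:(lra) x0; rewrite gt_eqF// => /(_ isT).
have : w x * (y - x) <= l * (y - x) by rewrite ler_pM2r// subr_gt0.
rewrite /Kfun; lra.
Qed.

Lemma K_level f1 l : 0 < l -> K f1 l (lp l) = f1 - 1.
Proof. by move=> l0; rewrite /Kfun levelE//; ring. Qed.

Lemma continuous_within_powR r a b : 0 < a ->
  {within `[a, b], continuous (fun x : R => x `^ r)}.
Proof.
move=> a0; apply: continuous_in_subspaceT => x; rewrite inE/= in_itv/= => /andP[ax _].
by apply: continuous_powR; exact: lt_le_trans ax.
Qed.

(** The equation for [c] says that the constant [w c] on [(al, c]], followed by [w],
    has the prescribed integral. *)
Lemma croot_equation f1 l al c : 0 < c ->
  (p^-1 * c `^ kk + kk * al * c `^ (- p^-1) = 1 - (f1 - l * al)) <->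
  rest p al (w c) c = f1 - l * al.
Proof.
move=> c0; have e : p^-1 * c `^ kk + kk * al * c `^ (- p^-1) = 1 - rest p al (w c) c.
  by rewrite /rest mulrBr wtail_mul// /wtail kE; ring.
by rewrite e; split => h; lra.
Qed.

(** For [al > 0] the left-hand side of the equation moves from [al^(1 - 1/p)] at
    [c = al] to its value at [c = 1], and the two hypotheses on [al] say that
    these values enclose the right-hand side. *)
Lemma croot_exists f1 l al : k < f1 < 1 -> f1 < l -> 0 <= al ->
  al < (f1 - k) / (l - k) -> K f1 l al <= 0 ->
  let c := croot p f1 l al in
  [/\ al <= c <= 1, 0 < c & rest p al (w c) c = f1 - l * al].
Proof.
move=> /andP[kf f11] fl al0 alb Kal c.
suff : exists c, [/\ al <= c <= 1, 0 < c &
    p^-1 * c `^ kk + kk * al * c `^ (- p^-1) = 1 - (f1 - l * al)].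
  by move=> /(xgetPex 0); rewrite -/(croot p f1 l al) -/c => -[? c0 /croot_equation-/(_ c0)].
have [{alb Kal}->|aln] := eqVneq al 0.
  exists ((p * (1 - f1)) `^ kk^-1).
  have h : 0 < p * (1 - f1) by rewrite mulr_gt0// subr_gt0.
  split; last first.
  - rewrite powRVK ?gt_eqF ?(ltW h)// !mulr0 mul0r; field; rewrite gt_eqF//.
  - by rewrite powR_gt0.
  have e1 : (1 : R) `^ kk^-1 = 1 by rewrite powR1.
  rewrite powR_ge0/= -[X in _ <= X]e1.
  apply: powR_le; [by rewrite invr_ge0 ltW|exact: ltW|].
  have : p * (1 - f1) <= p * (1 - k) by rewrite ler_pM2l//; lra.
  have -> : p * (1 - k) = 1 by field; rewrite gt_eqF.
  by [].
have {aln al0} al0 : 0 < al by rewrite lt_neqAle eq_sym aln.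
have lk : 0 < l - k by lra.
have al1 : al < 1.
  by apply: (lt_trans alb); rewrite ltr_pdivrMr// mul1r; lra.
have h1 : al * (l - k) < f1 - k by rewrite -ltr_pdivlMr.
pose psi c := p^-1 * c `^ kk + kk * al * c `^ (- p^-1).
have psial : psi al = al `^ kk.
  rewrite /psi.
  have : w al * al = k * al `^ kk := wtail_mul al0.
  rewrite /wtail -kE => h; rewrite -mulrA [al * _]mulrC mulrA h kE; ring.
have psi1 : psi 1 = p^-1 + kk * al by rewrite /psi !powR1 /=; ring.
have cpsi : {within `[al, 1], continuous psi}.
  have cp r : {within `[al, 1], continuous (fun x : R => x `^ r)} by exact: continuous_within_powR.
  by move=> x; apply: cvgD; apply: cvgM; [exact: cvg_cst|exact: cp|exact: cvg_cst|exact: cp].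
have := IVT (ltW al1) cpsi; move=> /(_ (1 - (f1 - l * al))).
case.
  rewrite psial psi1 ge_min le_max; apply/andP; split.
    by apply/orP; left; move: Kal; rewrite /Kfun; lra.
  apply/orP; right; move: h1; rewrite kE.
  lra.
move=> c'; rewrite in_itv/= => /andP[c1 c2] e; exists c'; split => //.
  by rewrite c1 c2.
exact: lt_le_trans c1.
Qed.

Lemma powR_average N D : 0 <= N -> 0 < D -> (N / D) `^ q * D = N `^ q / D `^ (q - 1).
Proof.
move=> N0 D0; have Dq : 0 < D `^ (q - 1) by exact: powR_gt0.
have e : N `^ q = (N / D) `^ q * D `^ q.
  by rewrite -powRM ?divfK ?gt_eqF// ?divr_ge0// ltW.
have e2 : D `^ q = D * D `^ (q - 1) by rewrite mulr_powRB1// ltW.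
by rewrite e e2 mulrA mulfK// gt_eqF.
Qed.

(** The minimizer on the part carrying the average at most [l]: a constant if
    it stays below the bound [w 1 = k], otherwise a constant that meets [w] at
    [c] and is followed by [w]. *)
Lemma F_profile f1 l al : 0 < f1 < 1 -> f1 < l -> 0 < al < 1 -> l * al <= f1 ->
  f1 <= k \/ [/\ k < f1, K f1 l al < 0 & K f1 l (be0 l) < 0 \/ be0 l < al] ->
  exists v' c, [/\ [/\ al < c, c <= 1, 0 <= v' & v' <= w c], c < 1 -> w c <= v',
    rest p al v' c = f1 - l * al,
    v' `^ q * (c - al) + G * (1 - c `^ kq) = Ff f1 l al & v' < l].
Proof.
move=> /andP[f0 f1lt] fl /andP[al0 al1] lal hK.
have l0 : 0 < l := lt_trans f0 fl.
have D0 : 0 < 1 - al by lra.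
have w1 : w 1 = k by rewrite /wtail powR1 mulr1.
rewrite /Ffun; case: ifPn => [br|].
  exists ((f1 - l * al) / (1 - al)), 1.
  have N0 : 0 <= f1 - l * al by lra.
  have Nlt : f1 - l * al < l * (1 - al) by lra.
  split.
  - split => //; first by rewrite divr_ge0// ltW.
    rewrite w1 ler_pdivrMr//; case/orP: br => [fk|].
      have : f1 * al <= l * al by rewrite ler_pM2r// ltW.
      have : f1 * (1 - al) <= k * (1 - al) by rewrite ler_pM2r.
      lra.
    have [fk|kf] := leP f1 k; last first.
      have lk : 0 < l - k by lra.
      rewrite ler_pdivrMr//; lra.
    have : f1 * al <= l * al by rewrite ler_pM2r// ltW.
    have : f1 * (1 - al) <= k * (1 - al) by rewrite ler_pM2r.
    lra.
  - by rewrite ltxx.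
  - by rewrite /rest divfK ?gt_eqF// powR1 /=; lra.
  - by rewrite powR_average// powR1 /= subrr mulr0 addr0.
  - by rewrite ltr_pdivrMr.
rewrite negb_or -!ltNge => /andP[kf br].
have [|[_ Kal hb]] := hK; first by rewrite leNgt kf.
have kf1 : k < f1 < 1 by rewrite kf.
have := @croot_exists f1 l al kf1 fl (ltW al0) br (ltW Kal).
set c := croot p f1 l al => -[/andP[alc c1] c0 e].
have lt_alc : al < c.
  rewrite lt_neqAle alc andbT; apply/negP => /eqP alcE.
  by move: e Kal; rewrite /rest -alcE /Kfun; lra.
exists (w c), c; split => //.
- by split => //; exact: wtail_ge0 q1 qp _.
- by rewrite (wtail_powRq q1 qp)// mulNr.
have Kc : K f1 l c = (w c - l) * (c - al) by move: e; rewrite /rest /Kfun; lra.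
have [cb|bc] := leP c (be0 l); last first.
  by rewrite -[X in _ < X](wtail_beta0 l0) (wtail_lt q1 qp)// (beta0_gt0).
case: hb => [Kb|]; last by lra.
have := @K_le_beta0 f1 l c l0 (ltW c0).
rewrite Kc => h; rewrite -subr_lt0; have {h} := le_lt_trans h Kb.
by rewrite pmulr_llt0 // subr_gt0.
Qed.

Lemma rest_wtail_lt z c : 0 <= z -> z < c -> rest p z (w c) c < 1 - z `^ kk.
Proof.
move=> z0 zc; have c0 : 0 < c := le_lt_trans z0 zc.
have := @wtail_concave_lt z c z0 c0.
rewrite lt_eqF// => /(_ isT); rewrite /rest; lra.
Qed.

Lemma F_zero f1 l : 0 < f1 -> f1 < l -> Ff f1 l (f1 / l) = 0.
Proof.
move=> f0 fl; have l0 : 0 < l := lt_trans f0 fl.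
rewrite /Ffun ifT; first by rewrite [l * _]mulrC divfK ?gt_eqF// subrr powR0 ?gt_eqF// mul0r.
have [//|kf] := leP f1 k; have lk : 0 < l - k by lra.
rewrite ler_pdivrMr// mulrAC ler_pdivlMr//.
have : k * f1 <= k * l by rewrite ler_pM2l// ltW.
lra.
Qed.

(** [A2] is the minimal energy without exceptional set, that is, with the
    exceptional set equal to the whole space. *)
Lemma A2E f1 : 0 < f1 -> A2 p q f1 k = Tf f1 1.
Proof.
move=> f0; rewrite /A2 /Tfun.
have e : (1 <= be0 f1) = (f1 <= k).
  rewrite /beta0; apply/idP/idP.
    apply: contraTT; rewrite -!ltNge => h.
    by apply: powR_lt1 => //; [rewrite divr_ge0 ?(ltW k0) ?(ltW f0)|rewrite ltr_pdivrMr// mul1r].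
  move=> h; apply: powR_ge1; first exact: ltW.
  by rewrite ler_pdivlMr// mul1r.
rewrite e; case: ifP => _; first by rewrite mulr1.
rewrite !powR1 /= !mulr1.
by have -> : k * (f1 / k) = f1 by field; rewrite !gt_eqF//; plra.
Qed.

(** The lower end of the admissible levels, where the constraint on the part
    [E] is not binding: there the minimal energy is the unconstrained one. *)
Lemma Delta_min_spec f1 l : 0 < f1 < 1 -> f1 < l ->
  let z := Delta_min p f1 l in
  [/\ 0 <= z, z < Num.min (f1 / l) (lp l), Tf l z + Ff f1 l z = Tf f1 1,
    forall al, z < al ->
      f1 <= k \/ [/\ k < f1, K f1 l al < 0 & K f1 l (be0 l) < 0 \/ be0 l < al] &
    exists v b v' c, [/\ is_profile p v b z v' c, head p v b z = l * z,
      rest p z v' c = f1 - l * z & energy p q v b z v' c = Tf f1 1]].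
Proof.
move=> /andP[f0 f1lt] fl; have l0 : 0 < l := lt_trans f0 fl.
have lp0 := level_gt0 l0.
have m0 : 0 < Num.min (f1 / l) (lp l) by rewrite lt_min lp0 divr_gt0.
have b0 := beta0_gt0 l0.
have T0 : Tf l 0 = 0 by rewrite /Tfun ltW// mulr0.
have [|b [v [[b0' b1 v0 vb bv] fE TE [_ _ bpos] h1]]] := @T_profile f1 1 f0 ltr01.
  by rewrite powR1 mulr1 ltW.
have bgt0 : 0 < b by apply: bpos; rewrite powR1 /= mulr1.
have zero_profile : exists v b v' c, [/\ is_profile p v b 0 v' c,
    head p v b 0 = l * 0, rest p 0 v' c = f1 - l * 0 &
    energy p q v b 0 v' c = Tf f1 1].
  exists 0, 0, v, b; split.
  - by split=> //; rewrite ?ltxx// => ?; exact: bv.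
  - by rewrite /head powR0 ?gt_eqF//; ring.
  - by move: fE; rewrite /rest powR1 /=; lra.
  - by move: TE; rewrite /energy !powR0 ?gt_eqF// powR1 /= => <-; ring.
rewrite /Delta_min /=; case: ifPn => [fk|]; last rewrite -ltNge => kf.
  split => //; last by left.
  rewrite T0 /Ffun fk /= mulr0 !subr0 powR1 /= divr1 add0r -A2E// /A2 fk//.
have kf1 : k < f1 < 1 by rewrite kf.
have lk : 0 < l - k by rewrite subr_gt0 (lt_trans kf).
have fk0 : 0 < f1 - k by rewrite subr_gt0.
have fp0 : 0 < p * (1 - f1) by rewrite mulr_gt0// subr_gt0.
have inj x y : 0 <= x -> 0 <= y -> x `^ kk = y `^ kk -> x = y.
  by move=> x0 y0 e; rewrite -(powRK x0 (lt0r_neq0 kk0)) e powRK// gt_eqF.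
have be1 : be0 f1 <= 1.
  apply: powR_le1; [exact: ltW|by rewrite divr_ge0 ?(ltW k0) ?(ltW f0)|].
  by rewrite ler_pdivrMr// mul1r ltW.
have [] := h1 be1; rewrite !powR1 /= !mulr1 => bk Tf1.
case: ifPn => [Kb|]; last rewrite -leNgt => Kb.
  split => //; last first.
    move=> al al0; right; split=> //; last by left.
    exact: le_lt_trans (@K_le_beta0 f1 l al l0 (ltW al0)) Kb.
  rewrite T0 add0r /Ffun leNgt kf /= ifN; last first.
    by rewrite -ltNge divr_gt0.
  have := @croot_exists f1 l 0 kf1 fl (lexx 0).
  case.
  - by rewrite divr_gt0.
  - by rewrite /Kfun powR0 ?gt_eqF// mulr0 subr0 addr0 subr_le0 ltW.
  set c := croot p f1 l 0 => _ c0 /(croot_equation f1 l 0 c0).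
  rewrite !mulr0 mul0r subr0 addr0 => e.
  have cb : c = b.
    by apply: inj; [exact: ltW|exact: b0'|rewrite bk -e mulrA mulfV ?gt_eqF// mul1r].
  rewrite Tf1 -cb subr0 -mulrA -[X in _ * (_ * X)](powRr1 (ltW c0)) -powRDx//.
  by rewrite [- _ + 1]addrC; ring.
have bl := beta0_lt_level l0.
have meet z : be0 l <= z -> z < lp l -> K f1 l z = 0 ->
    [/\ 0 <= z, z < Num.min (f1 / l) (lp l), Tf l z + Ff f1 l z = Tf f1 1,
    forall al, z < al -> K f1 l al < 0 /\ be0 l < al &
    exists v b v' c, [/\ is_profile p v b z v' c, head p v b z = l * z,
      rest p z v' c = f1 - l * z & energy p q v b z v' c = Tf f1 1]].
  move=> bz zl Kz; have z0 : 0 < z := lt_le_trans b0 bz.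
  have bel1 : be0 l < 1.
    apply: powR_lt1 => //; first by rewrite divr_ge0 ?(ltW k0) ?(ltW l0).
    by rewrite ltr_pdivrMr// mul1r (lt_trans kf).
  have z1 : z < 1.
    rewrite ltNge; apply/negP; rewrite le_eqVlt => /predU1P[z1|z1].
      by move: Kz; rewrite /Kfun -z1 powR1 /= mulr1 subrK => /eqP; rewrite subr_eq0 lt_eqF.
    have := @K_decreasing f1 l 1 z l0 (ltW bel1) z1.
    by rewrite Kz /Kfun powR1 /= mulr1 subrK subr_gt0 ltNge (ltW fl).
  have zk1 : z `^ kk < 1.
    by apply: powR_lt1 => //; exact: ltW.
  have lz : l * z = f1 - 1 + z `^ kk by apply/esym/subr0_eq; exact: Kz.
  have lzk : l * z <= z `^ kk by rewrite lz gerDr subr_le0 ltW.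
  have [b' [v' [[b'0 b'z v'0 vb' bv'] hE TlE [lv _ _] h]]] := @T_profile l z l0 z0 lzk.
  have TzE : Tf l z + G * (1 - z `^ kq) = Tf f1 1.
    have [b'k ->] := h bz; have -> : b' = b by apply: inj => //; rewrite bk b'k lz; ring.
    by rewrite Tf1; ring.
  have wzl : w z <= l by rewrite -(wtail_beta0 l0) (wtail_le q1 qp).
  split => //; [exact: ltW| | | |].
  - by rewrite lt_min zl andbT ltr_pdivlMr// mulrC lz -addrA gtrDl addrC subr_lt0.
  - have br : z < (f1 - k) / (l - k).
      rewrite ltr_pdivlMr//.
      have := @wtail_concave_lt z 1 (ltW z0) ltr01.
      rewrite lt_eqF// => /(_ isT); rewrite /wtail !powR1 /= mulr1 => zk.
      have -> : z * (l - k) = f1 - k - (1 + k * (z - 1) - z `^ kk).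
        by rewrite mulrBr [z * l]mulrC lz; ring.
      by rewrite gtrBl subr_gt0.
    rewrite /Ffun leNgt kf leNgt br /=.
    have := @croot_exists f1 l z kf1 fl (ltW z0) br.
    rewrite Kz => /(_ (lexx 0)); set c := croot p f1 l z => -[/andP[zc _] c0 e].
    have <- : z = c.
      apply/eqP; rewrite eq_le zc /= leNgt; apply/negP => zc'.
      have := rest_wtail_lt (ltW z0) zc'; rewrite e lz.
      have -> : f1 - (f1 - 1 + z `^ kk) = 1 - z `^ kk by ring.
      by rewrite ltxx.
    by rewrite subrr mulr0 add0r.
  - move=> al zal; split; last exact: le_lt_trans zal.
    by rewrite -Kz; exact: (K_decreasing).
  - exists v', b', (w z), z; split => //.
    + split => //; [exact: ltW|exact: wtail_ge0 q1 qp _|].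
      by move=> /lv; exact: le_trans.
    + by rewrite /rest subrr mulr0 lz; ring.
    + by rewrite -TzE -TlE /energy subrr mulr0 addr0.
case: ifPn => [/eqP K0|Kn0].
  have [z0 zm TF above prof] := meet _ (lexx _) bl K0.
  by split=> // al /above[? ?]; right; split => //; right.

have [z [bz zl Kz]] : exists z, [/\ be0 l <= z, z < lp l & K f1 l z = 0].
  have cK : {within `[be0 l, lp l], continuous (K f1 l)}.
    have cp : {within `[be0 l, lp l], continuous (fun x : R => x `^ kk)}.
      exact: continuous_within_powR.
    have ci : {within `[be0 l, lp l], continuous (@idfun R)}.
      by apply: continuous_subspaceT => x; exact: cvg_id.
    move=> x; apply: cvgB; first by apply: cvgD; [exact: cvg_cst|exact: cp].
    by apply: cvgM; [exact: cvg_cst|exact: ci].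
  have [|z] := @IVT _ _ _ _ 0 (ltW bl) cK.
    by rewrite (K_level)// ge_min le_max Kb orTb/= andbT; apply/orP; right; lra.
  rewrite in_itv/= => /andP[bz zl] Kz; exists z; split => //.
  rewrite lt_neqAle zl andbT; apply/negP => /eqP zE; move: Kz; rewrite zE (K_level)//.
  by lra.
have maxz : Kzeros p f1 l z /\ forall b', Kzeros p f1 l b' -> b' <= z.
  split; first by split => //; rewrite (ltW zl) andbT; lra.
  move=> b' [/andP[_ b'l] Kb']; rewrite leNgt; apply/negP => zb'.
  have := @K_decreasing f1 l z b' l0 bz zb'.
  by rewrite Kz Kb' ltxx.
have -> : beta2 p f1 l = z.
  have [m1 m2] := @xgetPex _ 0 [set b | Kzeros p f1 l b /\
    forall b', Kzeros p f1 l b' -> b' <= b] (ex_intro _ z maxz).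
  apply/eqP; rewrite eq_le; apply/andP; split; first exact: maxz.2.
  exact: (m2 _ maxz.1).
have [z0 zm TF above prof] := meet _ bz zl Kz.
by split=> // al /above[? ?]; right; split => //; right.
Qed.

Lemma optimal_profile f1 l al : 0 < f1 < 1 -> f1 < l -> Delta_min p f1 l < al ->
  al <= Num.min (f1 / l) (lp l) -> exists v b v' c,
  [/\ is_profile p v b al v' c, head p v b al = l * al, rest p al v' c = f1 - l * al,
    energy p q v b al v' c = Tf l al + Ff f1 l al &
    [/\ v' < l, v' <= w al, 0 < b -> l <= v, (v = l /\ l <= w al) \/ w al <= l &
       al < lp l -> 0 < b]].
Proof.
move=> f01 fl zal; rewrite le_min => /andP[alf all].
have /andP[f0 f1lt] := f01; have l0 : 0 < l := lt_trans f0 fl.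
have [z0 _ _ above _] := Delta_min_spec f01 fl.
have al0 : 0 < al := le_lt_trans z0 zal.
have lal : l * al <= f1 by rewrite mulrC -ler_pdivlMr.
have al1 : al < 1 by apply: (le_lt_trans alf); rewrite ltr_pdivrMr// mul1r.
have lalk : l * al <= al `^ kk by rewrite (le_level).
have [b [v [[b0 bal v0 vb bv] hE TE [lv dich bpos] _]]] := T_profile l0 al0 lalk.
have [|v' [c [[alc c1 v'0 v'c] cv' rE FE v'l]]] := F_profile f01 fl _ lal (above _ zal).
  by rewrite al0.
have v'al : v' <= w al by apply: le_trans v'c _; apply: (wtail_le q1 qp) => //; exact: ltW.
exists v, b, v', c; split => //.
- split => //; [exact: ltW|exact: lt_trans alc|].
  by move=> /lv; apply: le_trans; exact: ltW.
- by rewrite -TE -FE /energy; ring.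
- by split => //; rewrite -(lt_level).
Qed.

(** The price of enlarging the exceptional set is positive. *)
Lemma slope_gt0 l v v' om : 0 <= v' -> v' < l -> v' <= om -> l <= v ->
  (v = l /\ l <= om) \/ om <= l ->
  0 < q * (v `^ (q - 1) - v' `^ (q - 1)) * l - (rtan q v om - rtan q v' om).
Proof.
move=> v'0 v'l v'om lv dich; have l0 : 0 < l := le_lt_trans v'0 v'l.
have v0 : 0 <= v by lra.
have lq : l * l `^ (q - 1) = l `^ q by rewrite mulr_powRB1// ltW.
have v'q : v' * v' `^ (q - 1) = v' `^ q by rewrite mulr_powRB1.
have h1 := powR_tangent_lt q1 (ltW l0) v'0 ltac:(by rewrite gt_eqF).
have {}h1 : 0 < l `^ q - q * v' `^ (q - 1) * l + (q - 1) * v' `^ q.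
  have : q * v' `^ (q - 1) * (l - v') = q * v' `^ (q - 1) * l - q * v' `^ q by rewrite -v'q; ring.
  lra.
rewrite (rtan_ge q1 v'0 v'om); case: dich => [[-> lom]|oml].
  rewrite rtan_ge// ?ltW//.
  have : q * (l `^ (q - 1) - v' `^ (q - 1)) * l = q * l `^ q - q * v' `^ (q - 1) * l.
    by rewrite -lq; ring.
  lra.
have om0 : 0 <= om := le_trans v'0 v'om.
rewrite rtanE; last exact: le_trans lv.
have h2 := powR_tangent q1 om0 (ltW l0).
have h3 : l `^ (q - 1) * (l - om) <= v `^ (q - 1) * (l - om).
  rewrite ler_wpM2r ?subr_ge0//; apply: powR_le => //; [plra|exact: ltW].
have {}h3 : q * (l `^ (q - 1) * (l - om)) <= q * (v `^ (q - 1) * (l - om)) by rewrite ler_pM2l.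
have : q * (v `^ (q - 1) - v' `^ (q - 1)) * l - (q * v `^ (q - 1) * om - om `^ q
   - (q - 1) * v' `^ q) = q * (v `^ (q - 1) * (l - om)) + om `^ q
   - q * v' `^ (q - 1) * l + (q - 1) * v' `^ q by ring.
have : q * (l `^ (q - 1) * (l - om)) = - (q * l `^ (q - 1) * (om - l)) by ring.
lra.
Qed.

(** A profile equal to [w] near 0 is not constrained there: it is approached
    by profiles with a small plateau [(0, b]]. *)
Lemma small_plateau v0 al v' c eps : is_profile p v0 0 al v' c -> 0 < al -> 0 < eps ->
  exists v b, [/\ is_profile p v b al v' c, 0 < b, head p v b al <= al `^ kk &
    energy p q v0 0 al v' c - eps <= energy p q v b al v' c].
Proof.
move=> hP al0 eps0; have G0 := Gam_gt0.
(* the energy of [w] on [(0, b]] is [G b^kq] *)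
pose b := Num.min al ((eps / G) `^ kq^-1).
have b0 : 0 < b by rewrite lt_min al0 powR_gt0// divr_gt0.
have bal : b <= al by rewrite ge_min lexx.
exists (w b), b; split => //.
- have [] := hP => *; split => //; [exact: ltW|exact: wtail_ge0 q1 qp _| |].
    by move=> _; apply: (@le_trans _ _ (w al)); [auto|exact: (wtail_le q1 qp)].
  by move=> ?; auto.
- rewrite /head (wtail_mul b0).
  have : k * b `^ kk <= b `^ kk.
    by rewrite ler_piMl ?powR_ge0// ler_pdivrMr// mul1r; plra.
  lra.
have h1 : G * b `^ kq <= eps.
  have : b `^ kq <= eps / G.
    have h := powR_le (ltW kq0) (ltW b0) (_ : b <= (eps / G) `^ kq^-1).
    rewrite -[X in _ <= X](powRVK (ltW (divr_gt0 eps0 G0)) (lt0r_neq0 kq0)).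
    by apply: h; rewrite ge_min lexx orbT.
  by rewrite ler_pdivlMr// mulrC.
have h2 : 0 <= w b `^ q * b by rewrite mulr_ge0 ?powR_ge0 ?(ltW b0).
rewrite /energy powR0 ?(gt_eqF kq0)// mulr0 subr0; lra.
Qed.

End optimal_profiles.

(** * Monotonicity of the value functions *)

Section value_functions_compare.
Context {R : realType} {d : measure_display} {X : measurableType d}.
Variable mu : probability X R.
Variables p q : R.
Hypotheses (q1 : 1 < q) (qp : q < p).
Local Notation E := (Rintegral mu setT).
Local Notation int f := (mu.-integrable setT (EFin \o f)).
Local Notation k := ((p - 1) / p).
Local Notation kk := (1 - p^-1).
Local Notation kq := (1 - q / p).
Local Notation G := (Gam p q).
Local Notation w := (wtail p).
Local Notation Tf := (Tfun p q).
Local Notation Ff := (Ffun p q).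
Local Notation lp l := ((l `^ p)^-1).
Local Notation dom := (dominated mu p).
Local Notation prof := (is_profile p).
Local Notation en := (energy p q).
Local Notation hd := (head p).
Local Notation rs := (rest p).

Let p0 : 0 < p. Proof. have ? := q1; have ? := qp; lra. Qed.
Let ip01 : 0 < p^-1 < 1.
Proof. by rewrite invr_gt0 p0 invf_lt1//; have ? := q1; have ? := qp; lra. Qed.
Let qp01 : 0 < q / p < 1.
Proof. by rewrite divr_gt0 ?ltr_pdivrMr ?mul1r//; have ? := q1; have ? := qp; lra. Qed.

Ltac plra := have ? := q1; have ? := qp; have ? := ip01; have ? := qp01; lra.

Let kk0 : 0 < kk. Proof. plra. Qed.
Let kq0 : 0 < kq. Proof. plra. Qed.
Let k0 : 0 < k. Proof. apply: divr_gt0 => //; have ? := q1; have ? := qp; lra. Qed.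
Let q0 : 0 < q. Proof. plra. Qed.
Let qm0 : 0 < q - 1. Proof. plra. Qed.
Let G0 : 0 < G. Proof. exact: (Gam_gt0 q1 qp). Qed.

Variable S : X -> R.
Hypothesis uS : uniform01 mu S.

Lemma rtan0 y : 0 <= y -> rtan q 0 y = 0.
Proof. by move=> y0; rewrite (rtan_ge q1 (lexx 0) y0) powR0 ?mulr0// gt_eqF. Qed.

Lemma full_rest al : rs al 0 1 = 0.
Proof. by rewrite /rest powR1 /=; ring. Qed.

Lemma full_energy v b al : en v b al 0 1 = v `^ q * b + G * (al `^ kq - b `^ kq).
Proof. by rewrite /energy powR0 ?gt_eqF// powR1 /=; ring. Qed.

(** Profiles vanishing off [(0, al]]. *)
Lemma full_profile l al : 0 < l -> 0 < al <= 1 -> l * al <= al `^ kk ->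
  exists v b, [/\ prof v b al 0 1, hd v b al = l * al, en v b al 0 1 = Tf l al,
    0 < b -> l <= v & l * al < al `^ kk -> 0 < b].
Proof.
move=> l0 /andP[al0 al1] lal.
have [b [v [[b0 bal v0 vb bv] hE TE [lv _ bpos] _]]] := T_profile q1 qp l0 al0 lal.
exists v, b; split => //; last by rewrite full_energy.
by split => //; rewrite ?ltxx// => *; exact: wtail_ge0 q1 qp _.
Qed.

Lemma full_profile_plateau l al eps : 0 < l -> 0 < al <= 1 -> l * al <= al `^ kk ->
  0 < eps -> exists v b, [/\ prof v b al 0 1, 0 < b, hd v b al <= l * al &
    Tf l al - eps <= en v b al 0 1].
Proof.
move=> l0 al01 lal eps0; have [v [b [hP hE TE _ bpos]]] := full_profile l0 al01 lal.
have [bgt0|] := boolP (0 < b); first by exists v, b; split => //; rewrite ?hE ?TE//; lra.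
rewrite -leNgt => b0; have {}b0 : b = 0 by apply/eqP; rewrite eq_le b0 (profile_b0 hP).
subst b; have [v2 [b2 [hP2 b20 hd2 en2]]] := small_plateau q1 qp hP (andP al01).1 eps0.
exists v2, b2; split => //; last by rewrite -TE.
apply: le_trans hd2 _; rewrite leNgt; apply/negP => /bpos; by rewrite ltxx.
Qed.

(** The exceptional set is the whole space here, and the multiplier of its
    complement is 0. *)
Lemma energy_ge_base f1 phi : dom phi -> int (fun x => phi x `^ q) -> 0 < f1 ->
  E phi = f1 -> Tf f1 1 <= E (fun x => phi x `^ q).
Proof.
move=> dphi iphiq f10 fE; have [iphi f1le] := dominated_int q1 qp uS dphi.
apply/ler_addgt0Pr => eps eps0.
have [||v [b [hP b0 hE TE]]] := @full_profile_plateau f1 1 eps f10 _ _ eps0.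
- by rewrite ltr01 lexx.
- by rewrite powR1 mulr1 -fE.
have mT : measurable [set x : X | true] by rewrite (_ : mkset _ = setT)//; apply/seteqP.
have := @energy_lower_bound _ _ _ mu p q q1 qp S uS phi (fun=> true) v 0 b 1 1
  dphi iphiq mT b0 (profile_b_al hP) (profile_al_c hP) (profile_c1 hP) (profile_v'0 hP)
  (profile_v0 hP) (profile_vb hP b0) (profile_bv hP b0) (profile_v'c hP) (profile_cv' hP).
rewrite (_ : mkset _ = setT); last by apply/seteqP.
rewrite probability_setT /= [0 `^ (q - 1)]powR0 ?gt_eqF//.
have -> : E (fun x => phi x * 1) = f1 by rewrite -fE; apply: eq_E => x; rewrite mulr1.
move=> h; have h2 : 0 <= q * v `^ (q - 1) * (f1 - hd v b 1).
  by rewrite mulr_ge0 ?subr_ge0//; [rewrite mulr_ge0 ?powR_ge0// ltW|rewrite -[X in _ <= X]mulr1].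
by move: h TE h2; rewrite /energy /head; lra.
Qed.

Section fixed_mean.
Variable f1 : R.
Hypothesis f10 : 0 < f1.
Local Notation d0 := (f1 `^ kk^-1).

(** The minimal energy of functions of mean [f1] vanishing outside a set of
    measure [de]. *)
Definition Tfull de := Tf (f1 / de) de.
(** The minimal energy of functions of mean [f1] equal to [w] on [(0, de]]. *)
Definition Hsat de := Ff f1 (de `^ (- p^-1)) de + G * de `^ kq.

(** [d0] is the measure of the smallest set that can carry the mean [f1].  There the
    minimizers of both kinds are [w] followed by 0. *)
Lemma d0_gt0 : 0 < d0. Proof. exact: powR_gt0. Qed.

Lemma d0_powkk : d0 `^ kk = f1.
Proof. by rewrite powRVK ?gt_eqF// ltW. Qed.

Lemma le_d0 x : 0 <= x -> (d0 <= x) = (f1 <= x `^ kk).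
Proof.
move=> x0; apply/idP/idP => [h|].
  by rewrite -d0_powkk; apply: powR_le => //; [exact: ltW|exact: powR_ge0].
by apply: contraTT; rewrite -!ltNge => h; rewrite -d0_powkk; exact: powR_lt.
Qed.

Lemma lt_d0 x : 0 <= x -> (d0 < x) = (f1 < x `^ kk).
Proof.
move=> x0; apply/idP/idP => [h|].
  by rewrite -[X in X < _]d0_powkk; apply: powR_lt => //; exact: powR_ge0.
by apply: contraTT; rewrite -!leNgt => h; rewrite -d0_powkk; apply: powR_le => //; exact: ltW.
Qed.

Lemma Tfull_profile x : d0 <= x <= 1 -> exists v b, [/\ prof v b x 0 1, hd v b x = f1,
  en v b x 0 1 = Tfull x, 0 < b -> 0 < v & d0 < x -> 0 < b].
Proof.
move=> /andP[dx x1]; have x0 := lt_le_trans d0_gt0 dx.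
have e : f1 / x * x = f1 by rewrite divfK// gt_eqF.
have l0 := divr_gt0 f10 x0.
have [||v [b [hP hE TE lv bpos]]] := @full_profile (f1 / x) x l0.
- by rewrite x0.
- by rewrite e -le_d0// ltW.
exists v, b; split => //; first by rewrite hE.
- by move=> /lv; exact: lt_le_trans.
- by move=> dx'; apply: bpos; rewrite e -lt_d0// ltW.
Qed.

Lemma Tfull_tangent x eps : d0 <= x <= 1 -> 0 < eps ->
  exists s, forall y, d0 <= y <= 1 -> Tfull x - eps + s * (y - x) <= Tfull y.
Proof.
move=> /andP[dx x1] eps0; have x0 := lt_le_trans d0_gt0 dx.
have e : f1 / x * x = f1 by rewrite divfK// gt_eqF.
have [||v [b [hP b0 hE TE]]] := @full_profile_plateau (f1 / x) x eps (divr_gt0 f10 x0) _ _ eps0.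
- by rewrite x0.
- by rewrite e -le_d0// ltW.
exists (- (rtan q v (w x) - rtan q 0 (w x))) => y dy1.
have [v2 [b2 [hP2 hE2 TE2 _ _]]] := Tfull_profile dy1.
have := energy_compare q1 qp uS hP b0 hP2.
rewrite !full_rest subrr mulr0 addr0 TE2 hE2 => h; rewrite e in hE.
have h2 : 0 <= q * v `^ (q - 1) * (f1 - hd v b x).
  by rewrite mulr_ge0 ?subr_ge0// mulr_ge0 ?powR_ge0// ltW.
rewrite /Tfull in h TE *; lra.
Qed.

(** The multiplier of the complement is 0, and enlarging the support has a
    positive price. *)
Lemma Tfull_decreasing x y : d0 <= y -> y < x -> x <= 1 -> Tfull x < Tfull y.
Proof.
move=> dy yx x1; have dx : d0 < x := le_lt_trans dy yx.
have [|v [b [hP hE TE vpos bpos]]] := @Tfull_profile x; first by rewrite ltW.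
have [|v2 [b2 [hP2 hE2 TE2 _ _]]] := @Tfull_profile y; first by rewrite dy; lra.
have b0 := bpos dx; have wx : 0 < w x by apply: (wtail_gt0 q1 qp); exact: lt_trans d0_gt0 dx.
have := energy_compare q1 qp uS hP b0 hP2.
rewrite !full_rest subrr mulr0 addr0 TE TE2 hE hE2 subrr mulr0 addr0.
rewrite rtan0 ?(ltW wx)// subr0 => h.
have : 0 < (x - y) * rtan q v (w x).
  apply: mulr_gt0; first by rewrite subr_gt0.
  by apply: rtan_gt0 => //; exact: vpos.
lra.
Qed.

Lemma Tfull_d0 : Tfull d0 = G * d0 `^ kq.
Proof.
rewrite /Tfull; have d00 := d0_gt0.
have e : f1 / d0 * d0 = d0 `^ kk by rewrite divfK ?gt_eqF// d0_powkk.
by rewrite (T_saturated q1 qp)// divr_gt0.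
Qed.

Lemma Tfull_1 : Tfull 1 = Tf f1 1.
Proof. by rewrite /Tfull divr1. Qed.

Lemma Tfull_root A : f1 <= 1 -> Tf f1 1 <= A <= G * d0 `^ kq ->
  exists2 x, d0 <= x <= 1 & Tfull x = A.
Proof.
move=> f11 hA; apply: convex_IVT_decr; last by rewrite Tfull_1 Tfull_d0.
  by apply: powR_le1 => //; [rewrite invr_ge0 ltW|exact: ltW].
by move=> x eps; exact: Tfull_tangent.
Qed.

Section mean_lt1.
Hypothesis f11 : f1 < 1.
Let f01 : 0 < f1 < 1. Proof. by rewrite f10. Qed.

Section fixed_level.
Variable l : R.
Hypothesis fl : f1 < l.
Let l0 : 0 < l. Proof. exact: lt_trans fl. Qed.
Local Notation z := (Delta_min p f1 l).
Local Notation m := (Num.min (f1 / l) (lp l)).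

(** The minimal energy of functions of mean [f1] that have average at least [l] on
    a set of measure [al], for [al] in [Delta]. *)
Definition Ev al := Tf l al + Ff f1 l al.

Lemma Ev_min : Ev z = Tf f1 1.
Proof. by have [] := Delta_min_spec q1 qp f01 fl. Qed.

Lemma Ev_profile y : z <= y <= m -> exists v b v' c, [/\ prof v b y v' c,
  hd v b y = l * y, rs y v' c = f1 - l * y & en v b y v' c = Ev y].
Proof.
move=> /andP[]; rewrite le_eqVlt => /predU1P[<- _|zy ym].
  rewrite Ev_min.
  by have [_ _ _ _ h] := Delta_min_spec q1 qp f01 fl.
have [v [b [v' [c [hP h1 h2 h3 _]]]]] := optimal_profile q1 qp f01 fl zy ym.
by exists v, b, v', c.
Qed.

Lemma Ev_ge_min y : z <= y <= m -> Tf f1 1 <= Ev y.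
Proof.
move=> /Ev_profile[v [b [v' [c [hP hE rE eE]]]]].
have [i e] := E_profile q1 qp uS hP; have [iq eq] := E_profile_q q1 qp uS hP.
rewrite -eE -eq; apply: energy_ge_base => //; first exact: (dominated_profile q1 qp uS hP).
by rewrite e hE rE; ring.
Qed.

Lemma Ev_tangent_pos x : z < x -> x <= m -> x < lp l ->
  exists2 s, 0 < s & forall y, z <= y <= m -> Ev x + s * (y - x) <= Ev y.
Proof.
move=> zx xm xl.
have [v [b [v' [c [hP hE rE eE [v'l v'w lv dich bpos]]]]]] := optimal_profile q1 qp f01 fl zx xm.
have b0 := bpos xl.
have s0 := slope_gt0 q1 qp (profile_v'0 hP) v'l v'w (lv b0) dich.
exists (q * (v `^ (q - 1) - v' `^ (q - 1)) * l - (rtan q v (w x) - rtan q v' (w x))) => //.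
move=> y /Ev_profile[v2 [b2 [v2' [c2 [hP2 hE2 rE2 eE2]]]]].
have := energy_compare q1 qp uS hP b0 hP2.
by rewrite hE hE2 rE rE2 eE eE2 /Ev; lra.
Qed.

(** At the lower end the constant [Ev_min] is a minorant.  At [al = l^(-p)] the
    profile equals [w] near 0 and there is no multiplier; small plateaus give
    approximate ones. *)
Lemma Ev_tangent x eps : z <= x <= m -> 0 < eps ->
  exists s, forall y, z <= y <= m -> Ev x - eps + s * (y - x) <= Ev y.
Proof.
move=> /andP[]; rewrite le_eqVlt => /predU1P[<- _ eps0|zx xm eps0].
  by exists 0 => y /Ev_ge_min; rewrite Ev_min; lra.
have xl : x <= lp l by move: xm; rewrite le_min => /andP[].
move: xl; rewrite le_eqVlt => /predU1P[xl|xl]; last first.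
  have [s _ hs] := Ev_tangent_pos zx xm xl.
  by exists s => y /hs; lra.
have [v [b [v' [c [hP hE rE eE _]]]]] := optimal_profile q1 qp f01 fl zx xm.
have x0 : 0 < x by rewrite xl level_gt0.
have lx : l * x = x `^ kk by rewrite xl (levelE q1 qp).
have [v3 [b3 [hP3 b30 hE3 eE3]]] : exists v3 b3, [/\ prof v3 b3 x v' c, 0 < b3,
    hd v3 b3 x <= x `^ kk & Ev x - eps <= en v3 b3 x v' c].
  have [bgt0|] := boolP (0 < b).
    by exists v, b; split => //; rewrite ?hE ?eE ?lx /Ev//; lra.
  rewrite -leNgt => b0; have {}b0 : b = 0 by apply/eqP; rewrite eq_le b0 (profile_b0 hP).
  by subst b; rewrite /Ev -eE; exact: small_plateau.
exists (q * v3 `^ (q - 1) * l - q * v' `^ (q - 1) * l - (rtan q v3 (w x) - rtan q v' (w x))).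
move=> y /Ev_profile[v2 [b2 [v2' [c2 [hP2 hE2 rE2 eE2]]]]].
have := energy_compare q1 qp uS hP3 b30 hP2.
rewrite hE2 rE rE2 eE2 => h.
have : q * v3 `^ (q - 1) * (l * y - l * x) <= q * v3 `^ (q - 1) * (l * y - hd v3 b3 x).
  by rewrite ler_wpM2l ?mulr_ge0 ?powR_ge0 ?(ltW q0)// lx; lra.
rewrite /Ev in eE3 h *; lra.
Qed.

Lemma Ev_increasing x y : z <= x -> x < y -> y <= m -> Ev x < Ev y.
Proof.
move=> zx xy ym; have yl : y <= lp l by move: ym; rewrite le_min => /andP[].
pose u := (x + y) / 2; have [xu uy] := midf_lt xy; rewrite -/u in xu uy.
have zu := le_lt_trans zx xu; have um := le_trans (ltW uy) ym.
have ul : u < lp l := lt_le_trans uy yl.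
have [s s0 hs] := Ev_tangent_pos zu um ul.
have Euy : Ev u < Ev y.
  apply: lt_le_trans (hs y _); first by rewrite ltrDl mulr_gt0// subr_gt0.
  by rewrite ym andbT ltW// (lt_trans zu).
apply: le_lt_trans Euy; move: zx; rewrite le_eqVlt => /predU1P[<-|zx].
  by rewrite Ev_min; apply: Ev_ge_min; rewrite um andbT ltW.
have [s2 s20 hs2] := Ev_tangent_pos zx (le_trans (ltW xu) um) (lt_trans xu ul).
apply: le_trans (hs2 u _); first by rewrite lerDl mulr_ge0 ?subr_ge0// ltW.
by rewrite um andbT ltW.
Qed.

Lemma Ev_root A : Tf f1 1 <= A <= Ev m -> exists2 x, z <= x <= m & Ev x = A.
Proof.
move=> hA; apply: convex_IVT; last by rewrite Ev_min.
  by have [_ h _ _ _] := Delta_min_spec q1 qp f01 fl; exact: ltW.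
by move=> x eps; exact: Ev_tangent.
Qed.

End fixed_level.

End mean_lt1.
End fixed_mean.

(** Integrate the tangent inequality of the power [q] at [om] along [w]. *)
Lemma slab_tangent x m om : 0 <= x -> x <= m -> m <= 1 -> 0 <= om ->
  om `^ q * (m - x) + q * om `^ (q - 1) * (m `^ kk - x `^ kk - om * (m - x)) <=
  G * (m `^ kq - x `^ kq).
Proof.
move=> x0 xm m1 om0; have x01 : 0 <= x <= 1 by lra.
have m01 : 0 <= m <= 1 by lra.
have [ix ex] := E_wS q1 qp uS x01; have [im em] := E_wS q1 qp uS m01.
have [iqx eqx] := E_wSq q1 qp uS x01; have [iqm eqm] := E_wSq q1 qp uS m01.
have jx := int_ind_le uS x; have jm := int_ind_le uS m.
have fx := E_uniform_le uS x01; have fm := E_uniform_le uS m01.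
pose c0 := om `^ q - q * om `^ (q - 1) * om; pose c1 := q * om `^ (q - 1).
have i1 := int_B im ix; have i2 := int_B jm jx; have i3 := int_B iqm iqx.
have := E_le (int_D (int_Z c1 i1) (int_Z c0 i2)) i3.
rewrite (E_D (int_Z c1 i1) (int_Z c0 i2)) (E_Z c1 i1) (E_Z c0 i2).
rewrite (E_B im ix) (E_B jm jx) (E_B iqm iqx) ex em eqx eqm fx fm => h.
have e : om `^ q * (m - x) + q * om `^ (q - 1) * (m `^ kk - x `^ kk - om * (m - x)) =
  c1 * (m `^ kk - x `^ kk) + c0 * (m - x) by rewrite /c0 /c1; ring.
rewrite e [G * _]mulrBr; apply: h => t.
have [tx|xt] := leP (S t) x; first by rewrite (le_trans tx xm) /= !mulr1 !subrr !mulr0 addr0.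
have [tm|mt] := leP (S t) m; last by rewrite /= !mulr0 !subrr !mulr0 addr0.
rewrite /= !mulr1 !mulr0 !subr0 mulr1.
have := powR_tangent q1 (wtail_ge0 q1 qp (S t)) om0; rewrite /c0 /c1; lra.
Qed.

(** Freezing the multiplier [r] while the region where the function equals [w]
    grows from [x] to [m] raises the Lagrangian by the integral of
    [w^q - r^q - q r^(q-1) (w - r)], positive by strict convexity. *)
Lemma slab_gt0 x m r : 0 < x -> x < m -> m <= 1 -> 0 <= r -> r <= w m ->
  0 < G * (m `^ kq - x `^ kq) - r `^ q * (m - x)
      - q * r `^ (q - 1) * (m `^ kk - x `^ kk - r * (m - x)).
Proof.
move=> x0 xm m1 r0 rm; pose u := (x + m) / 2.
have [xu um] : x < u /\ u < m by rewrite /u; split; lra.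
have u0 : 0 < u by lra.
have wmu : w m < w u by exact: (wtail_lt q1 qp).
have h1 := @slab_tangent u m r (ltW u0) (ltW um) m1 r0.
have h2 := @slab_tangent x u (w u) (ltW x0) (ltW xu) ltac:(lra) (wtail_ge0 q1 qp _).
have h3 := powR_tangent_lt q1 (wtail_ge0 q1 qp u) r0 ltac:(by rewrite gt_eqF//; lra).
have h4 : 0 <= u `^ kk - x `^ kk - w u * (u - x).
  have := wtail_concave q1 qp (ltW x0) u0; lra.
have h5 : q * r `^ (q - 1) <= q * w u `^ (q - 1).
  by rewrite ler_pM2l//; apply: powR_le => //; [exact: ltW|lra].
have h6 : 0 < (u - x) * (w u `^ q - r `^ q - q * r `^ (q - 1) * (w u - r)).
  by rewrite mulr_gt0// ?subr_gt0//; lra.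
have h7 : 0 <= (q * w u `^ (q - 1) - q * r `^ (q - 1)) * (u `^ kk - x `^ kk - w u * (u - x)).
  by rewrite mulr_ge0// subr_ge0.
set a := G * _ in h2; set a' := G * (m `^ kq - u `^ kq) in h1.
have -> : G * (m `^ kq - x `^ kq) = a + a' by rewrite /a /a'; ring.
have : (u - x) * (w u `^ q - r `^ q - q * r `^ (q - 1) * (w u - r)) +
  (q * w u `^ (q - 1) - q * r `^ (q - 1)) * (u `^ kk - x `^ kk - w u * (u - x)) =
  w u `^ q * (u - x) + q * w u `^ (q - 1) * (u `^ kk - x `^ kk - w u * (u - x))
  - r `^ q * (u - x) - q * r `^ (q - 1) * (u `^ kk - x `^ kk - r * (u - x)) by ring.
have : r `^ q * (m - u) + q * r `^ (q - 1) * (m `^ kk - u `^ kk - r * (m - u)) +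
  r `^ q * (u - x) + q * r `^ (q - 1) * (u `^ kk - x `^ kk - r * (u - x)) =
  r `^ q * (m - x) + q * r `^ (q - 1) * (m `^ kk - x `^ kk - r * (m - x)) by ring.
lra.
Qed.

Section saturated_values.
Variable f1 : R.
Hypotheses (f10 : 0 < f1) (f11 : f1 < 1).
Let f01 : 0 < f1 < 1. Proof. by rewrite f10. Qed.
Local Notation d0 := (f1 `^ kk^-1).
Local Notation H := (Hsat f1).

Lemma saturated_level y : 0 < y -> y <= d0 ->
  let l := y `^ (- p^-1) in [/\ 0 < l, lp l = y, l * y = y `^ kk & f1 < l].
Proof.
move=> y0 yd l; have l0 : 0 < l by exact: powR_gt0.
have e : lp l = y.
  by rewrite -powRN -powRrM mulrNN mulVf ?gt_eqF// powRr1// ltW.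
have ly : l * y = y `^ kk by rewrite -{1 2}e (levelE q1 qp).
split => //.
have d1 : d0 <= 1 by apply: powR_le1 => //; [rewrite invr_ge0 ltW|exact: ltW|exact: ltW].
have : 1 <= l.
  by rewrite /l powRN invf_ge1 ?powR_gt0//; apply: powR_le1; [plra|exact: ltW|exact: le_trans d1].
by apply: lt_le_trans.
Qed.

Lemma d0_lt1 : d0 < 1.
Proof. by apply: powR_lt1 => //; [rewrite invr_gt0|exact: ltW]. Qed.

Lemma powkk_le_f1 y : 0 <= y -> y <= d0 -> y `^ kk <= f1.
Proof.
move=> y0 yd; rewrite -[X in _ <= X](powRVK (ltW f10) (lt0r_neq0 kk0)).
by apply: powR_le => //; exact: ltW.
Qed.

Lemma H_profile y : 0 < y -> y <= d0 -> exists r c,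
  [/\ prof 0 0 y r c, y < c, rs y r c = f1 - y `^ kk & en 0 0 y r c = H y].
Proof.
move=> y0 yd; have [l0 lpE ly fl] := saturated_level y0 yd.
set l := y `^ _ in l0 lpE ly fl *.
have [_ zm _ above _] := Delta_min_spec q1 qp f01 fl.
have zy : Delta_min p f1 l < y by move: zm; rewrite lt_min lpE => /andP[].
have y1 : 0 < y < 1 by rewrite y0 (le_lt_trans yd d0_lt1).
have lyf : l * y <= f1 by rewrite ly powkk_le_f1// ltW.
have [r [c [[yc c1 r0 rc] cr rE FE _]]] := F_profile q1 qp f01 fl y1 lyf (above _ zy).
exists r, c; split => //.
- split => //; [exact: ltW|exact: ltW|exact: lt_trans yc|by rewrite ltxx|by rewrite ltxx|by rewrite ltxx|].
  by move=> _; apply: le_trans rc _; apply: (wtail_le q1 qp) => //; exact: ltW.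
- by rewrite rE ly.
- by rewrite /Hsat -/l -FE /energy powR0 ?gt_eqF// powR0 ?gt_eqF//; ring.
Qed.

(** Weak duality for the constraint that the function equals [w] on [(0, y]]. *)
Lemma H_dual y r c : 0 < y -> y <= d0 -> prof 0 0 y r c ->
  en 0 0 y r c + q * r `^ (q - 1) * (f1 - y `^ kk - rs y r c) <= H y.
Proof.
move=> y0 yd hP; apply/ler_addgt0Pr => eps eps0.
have [v [b [hP2 b0 hE eE]]] := small_plateau q1 qp hP y0 eps0.
have [r2 [c2 [hP3 _ rE3 eE3]]] := H_profile y0 yd.
have := energy_compare q1 qp uS hP2 b0 hP3.
rewrite subrr mul0r subr0 rE3 eE3 => h.
have hE3 : hd 0 0 y = y `^ kk by rewrite /head powR0 ?gt_eqF//; ring.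
have : 0 <= q * v `^ (q - 1) * (hd 0 0 y - hd v b y).
  by rewrite mulr_ge0 ?mulr_ge0 ?powR_ge0 ?(ltW q0)// hE3 subr_ge0.
lra.
Qed.

(** Keep the multiplier [r] of [x] while [y <= c].  Beyond [c], the multiplier
    [w y] is used instead and [slab_gt0] compares at [c]. *)
Lemma H_increasing x y : 0 < x -> x < y -> y <= d0 -> H x < H y.
Proof.
move=> x0 xy yd; have xd : x <= d0 by lra.
have [r [c [hP xc rE eE]]] := H_profile x0 xd.
have r0 := profile_v'0 hP; have c1 := profile_c1 hP; have rc := profile_v'c hP xc.
have y0 : 0 < y by lra.
have y1 : y <= 1 by have := d0_lt1; lra.
have zkq : 0 `^ kq = 0 :> R by rewrite powR0// gt_eqF.
have zq : 0 `^ q = 0 :> R by rewrite powR0// gt_eqF.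
have [yc|cy] := leP y c.
  have hP2 : prof 0 0 y r c.
    case: hP => *; split => //; [exact: ltW|by rewrite ltxx|].
    by move=> _; apply: le_trans rc _; exact: (wtail_le q1 qp).
  have := H_dual y0 yd hP2.
  have := slab_gt0 x0 xy y1 r0 (profile_v'al hP2 y0).
  rewrite -eE; move: rE; rewrite /energy /rest zkq zq => rE h1 h2.
  have e : f1 = x `^ kk + (r * (c - x) + 1 - c `^ kk) by lra.
  have : q * r `^ (q - 1) * (y `^ kk - x `^ kk - r * (y - x)) =
    - (q * r `^ (q - 1) * (f1 - y `^ kk - (r * (c - y) + 1 - c `^ kk))).
    by rewrite e; ring.
  lra.
have c0 := profile_c0 hP.
have wyr : w y <= r.
  apply: le_trans (profile_cv' hP _); last by lra.
  by apply: (wtail_le q1 qp) => //; exact: ltW.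
have hP2 : prof 0 0 y (w y) y.
  by split => //; rewrite ?ltxx//; [exact: ltW|exact: (wtail_ge0 q1 qp)].
have := H_dual y0 yd hP2; have := slab_gt0 x0 xc c1 r0 rc.
have h0 : w y `^ (q - 1) <= r `^ (q - 1).
  by apply: powR_le => //; [exact: ltW|exact: (wtail_ge0 q1 qp)].
have {}h0 : q * w y `^ (q - 1) * (1 - f1) <= q * r `^ (q - 1) * (1 - f1).
  by rewrite ler_wpM2r ?ler_pM2l// subr_ge0 ltW.
rewrite -eE; move: rE; rewrite /energy /rest zkq zq => rE h1 h2.
have e : 1 - f1 = c `^ kk - x `^ kk - r * (c - x) by lra.
have : q * w y `^ (q - 1) * (f1 - y `^ kk - (w y * (y - y) + 1 - y `^ kk)) =
  - (q * w y `^ (q - 1) * (1 - f1)) by ring.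
have : q * r `^ (q - 1) * (1 - f1) =
  q * r `^ (q - 1) * (c `^ kk - x `^ kk - r * (c - x)) by rewrite e.
lra.
Qed.

(** The multiplier of the larger point [y] is used at [x]. *)
Lemma H_lipschitz x y : 0 < x -> x < y -> y <= d0 -> H y - H x <= G * y `^ kq - G * x `^ kq.
Proof.
move=> x0 xy yd; have xd : x <= d0 by lra.
have y0 : 0 < y by lra.
have [r [c [hP yc rE eE]]] := H_profile y0 yd.
have r0 := profile_v'0 hP; have ry := profile_v'al hP y0.
have zkq : 0 `^ kq = 0 :> R by rewrite powR0// gt_eqF.
have zq : 0 `^ q = 0 :> R by rewrite powR0// gt_eqF.
have hP2 : prof 0 0 x r c.
  have rc := profile_v'c hP yc.
  case: hP => *; split => //; [exact: ltW|lra|by rewrite ltxx|].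
  by move=> _; apply: le_trans ry _; apply: (wtail_le q1 qp) => //; exact: ltW.
have := H_dual x0 xd hP2.
have h1 : 0 <= r `^ q * (y - x) by rewrite mulr_ge0 ?powR_ge0// subr_ge0 ltW.
have h2 : 0 <= q * r `^ (q - 1) * (y `^ kk - x `^ kk - r * (y - x)).
  rewrite mulr_ge0 ?mulr_ge0 ?powR_ge0 ?(ltW q0)//.
  have := wtail_concave q1 qp (ltW x0) y0.
  have : r * (y - x) <= w y * (y - x) by rewrite ler_wpM2r// subr_ge0 ltW.
  lra.
rewrite -eE; move: rE; rewrite /energy /rest zkq zq => rE h3.
have e : f1 = y `^ kk + (r * (c - y) + 1 - c `^ kk) by lra.
have : q * r `^ (q - 1) * (y `^ kk - x `^ kk - r * (y - x)) =
    q * r `^ (q - 1) * (f1 - x `^ kk - (r * (c - x) + 1 - c `^ kk)) by rewrite e; ring.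
lra.
Qed.

(** The multiplier of [y], with its plateau extended down to 0, is tested on the
    unconstrained minimizer. *)
Lemma H_near0 y : 0 < y -> y <= d0 -> H y <= Tf f1 1 + G * y `^ kq.
Proof.
move=> y0 yd; have [r [c [hP yc rE eE]]] := H_profile y0 yd.
have r0 := profile_v'0 hP; have ry := profile_v'al hP y0.
have rc := profile_v'c hP yc.
have zkq : 0 `^ kq = 0 :> R by rewrite powR0// gt_eqF.
have zq : 0 `^ q = 0 :> R by rewrite powR0// gt_eqF.
have hP1 : prof r y y r c by case: hP => *; split => //; rewrite ?ltxx//; exact: ltW.
have [||v2 [b2 [hP2 hE2 eE2 _ _]]] := @full_profile f1 1 f10.
- by rewrite ltr01 lexx.
- by rewrite powR1 mulr1 ltW.
have := energy_compare q1 qp uS hP1 y0 hP2.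
rewrite subrr mulr0 subr0 full_rest hE2 eE2 => h.
have h2 : 0 <= q * r `^ (q - 1) * (y `^ kk - r * y).
  rewrite mulr_ge0 ?mulr_ge0 ?powR_ge0 ?(ltW q0)// subr_ge0.
  have : r * y <= w y * y by rewrite ler_pM2r.
  rewrite (wtail_mul p y0) => h3; apply: le_trans h3 _.
  by rewrite ler_piMl ?powR_ge0// ler_pdivrMr// mul1r; plra.
rewrite -eE; move: rE h; rewrite /energy /head /rest zkq zq => rE h.
have e : f1 = y `^ kk + (r * (c - y) + 1 - c `^ kk) by lra.
rewrite mulr1 in h.
have : q * r `^ (q - 1) * (y `^ kk - r * y) =
  q * r `^ (q - 1) * (f1 - (r * y + y `^ kk - y `^ kk))
  + q * r `^ (q - 1) * (0 - (r * (c - y) + 1 - c `^ kk)) by rewrite e; ring.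
have : 0 <= r `^ q * y by rewrite mulr_ge0 ?powR_ge0// ltW.
lra.
Qed.

Lemma H_d0 : H d0 = G * d0 `^ kq.
Proof.
have d00 : 0 < d0 by exact: powR_gt0.
have [l0 _ ly fl] := saturated_level d00 (lexx _).
rewrite /Hsat; set l := d0 `^ (- p^-1) in l0 ly fl *.
have dE : d0 = f1 / l.
  by rewrite -[in RHS](powRVK (ltW f10) (lt0r_neq0 kk0)) -ly mulrC mulKf// gt_eqF.
by rewrite {1}dE (F_zero q1 qp)// add0r.
Qed.

Lemma H_root A : Tf f1 1 < A <= G * d0 `^ kq -> exists2 x, 0 < x <= d0 & H x = A.
Proof.
move=> /andP[TA AG]; have d00 : 0 < d0 by exact: powR_gt0.
have e0 : 0 < (A - Tf f1 1) / G by rewrite divr_gt0// subr_gt0.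
(* small enough for the bound of [H_near0] to be at most [A] *)
pose a := Num.min d0 (((A - Tf f1 1) / G) `^ kq^-1).
have a0 : 0 < a by rewrite lt_min d00 powR_gt0.
have ad : a <= d0 by rewrite ge_min lexx.
have Ha : H a <= A.
  have := H_near0 a0 ad; have : a `^ kq <= (A - Tf f1 1) / G.
    rewrite -[X in _ <= X](powRVK (ltW e0) (lt0r_neq0 kq0)).
    by apply: powR_le; [exact: ltW|exact: ltW|rewrite ge_min lexx orbT].
  by rewrite ler_pdivlMr// mulrC; lra.
have [| | |x /andP[ax xd] Hx] := @dominated_IVT _ H (fun y => G * y `^ kq) a d0 A ad.
- move=> x /andP[ax _]; apply: cvgM; first exact: cvg_cst.
  by apply: continuous_powR; exact: lt_le_trans ax.
- move=> x y ax xy yd; apply: H_lipschitz => //; exact: lt_le_trans ax.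
- by rewrite Ha H_d0.
by exists x => //; rewrite xd (lt_le_trans a0 ax).
Qed.

End saturated_values.

End value_functions_compare.

(** * Scaling *)

Section normalization.
Context {R : realType} {d : measure_display} {X : measurableType d}.
Variable mu : probability X R.
Variables p q : R.
Hypotheses (q1 : 1 < q) (qp : q < p).
Local Notation E := (Rintegral mu setT).
Local Notation int f := (mu.-integrable setT (EFin \o f)).
Local Notation k := ((p - 1) / p).
Local Notation dom := (dominated mu p).

Let p0 : 0 < p. Proof. have ? := q1; have ? := qp; lra. Qed.
Let k0 : 0 < k. Proof. apply: divr_gt0 => //; have ? := q1; have ? := qp; lra. Qed.
Let pm0 : 0 < p - 1. Proof. have ? := q1; have ? := qp; lra. Qed.

Lemma measurable_ge (phi : X -> R) t : measurable_fun setT phi ->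
  measurable [set x | t <= phi x].
Proof.
move=> mphi; have := mphi measurableT _ (measurable_itv `[t, +oo[).
by rewrite setTI; congr measurable; apply/seteqP; split => x /=; rewrite in_itv/= andbT.
Qed.

Lemma weak_norm_le (F : R) (phi : X -> R) : 0 <= F -> measurable_fun setT phi -> (forall x, 0 <= phi x) ->
  ((weak_norm mu p phi <= F%:E)%E <->
   forall t, 0 < t -> (mu [set x | (t <= phi x)%R] <= ((F / t) `^ p)%:E)%E).
Proof.
move=> F0 mphi phi0.
have ip0 : 0 <= p^-1 by rewrite invr_ge0 ltW.
have one t : 0 < t -> (t%:E * mu [set x | (t <= `|phi x|)%R] `^ (p^-1)%R <= F%:E)%E =
    (mu [set x | (t <= phi x)%R] <= ((F / t) `^ p)%:E)%E.
  move=> t0; have -> : [set x | (t <= `|phi x|)%R] = [set x | (t <= phi x)%R].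
    by apply/seteqP; split => x /=; rewrite ger0_norm.
  rewrite massE; last exact: measurable_ge.
  set m := mass mu _; have m0 : 0 <= m by exact: mass_ge0.
  have Ft0 : 0 <= F / t by rewrite divr_ge0// ltW.
  rewrite poweR_EFin -EFinM !lee_fin mulrC -ler_pdivlMr//; apply/idP/idP => h.
    by have := powR_le (ltW p0) (powR_ge0 _ _) h; rewrite powRVK// gt_eqF.
  by have := powR_le ip0 m0 h; rewrite powRK// gt_eqF.
split => [h t t0|h]; last by apply: ge_ereal_sup => _ [t t0 <-]; rewrite one//; exact: h.
by rewrite -one//; apply: le_trans h; apply: ereal_sup_ubound; exists t.
Qed.

Definition normalized (f A : R) (phi : X -> R) :=
  [/\ dom phi, int (fun x => phi x `^ q), E phi = f & E (fun x => phi x `^ q) = A].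

Variable F : R.
Hypothesis F0 : 0 < F.
Local Notation kap := ((p - 1) / (p * F)).

Lemma kap_gt0 : 0 < kap. Proof. by rewrite divr_gt0// mulr_gt0. Qed.

Lemma kapE : kap * F = k.
Proof. by field; rewrite !gt_eqF. Qed.

Lemma admissible_normalized f A phi : admissible mu p q f A F phi ->
  normalized (kap * f) (kap `^ q * A) (fun x => kap * phi x).
Proof.
move=> [mphi phi0 fE AE /(weak_norm_le (ltW F0) mphi phi0) tail].
have kap0 := kap_gt0.
have [iphi Ephi] := int_ge0 mphi phi0 fE.
have mq : measurable_fun setT (fun x => phi x `^ q).
  by apply: (measurableT_comp (measurable_powR q)).
have [iq Eq] := int_ge0 mq (fun x => powR_ge0 _ _) AE.
have e : (fun x => (kap * phi x) `^ q) = (fun x => kap `^ q * phi x `^ q).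
  by apply/funext => x; rewrite powRM// ltW.
split.
- split; first by apply: measurable_funM.
    by move=> x; rewrite mulr_ge0// ltW.
  move=> t t0; have := tail (t / kap) (divr_gt0 t0 kap0).
  have -> : F / (t / kap) = k / t by rewrite -kapE invf_div mulrA [F * _]mulrC.
  apply: le_trans; rewrite le_eqVlt; apply/orP; left; apply/eqP; congr (mu _).
  by apply/seteqP; split => x /=; rewrite ler_pdivrMr// mulrC.
- by rewrite e; exact: int_Z.
- by rewrite E_Z// Ephi.
- by rewrite e E_Z// Eq.
Qed.

Lemma normalized_admissible f A phi : normalized (kap * f) (kap `^ q * A) phi ->
  admissible mu p q f A F (fun x => kap^-1 * phi x).
Proof.
move=> [dphi iq fE AE]; have [mphi phi0 tail] := dphi; have kap0 := kap_gt0.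
have iphi : int phi.
  apply: int_le mphi (int_D (int_cst mu 1) iq) _ => x; rewrite phi0 /=.
  have [x1|/ltW x1] := leP (phi x) 1; first by have := powR_ge0 (phi x) q; lra.
  have := powR_le (ltW (lt_trans ltr01 q1)) ler01 x1.
  have : phi x `^ 1 <= phi x `^ q by rewrite ler_powR// ltW.
  by rewrite powRr1//; lra.
have m' : measurable_fun setT (fun x => kap^-1 * phi x) by apply: measurable_funM.
have p' x : 0 <= kap^-1 * phi x by rewrite mulr_ge0// invr_ge0 ltW.
have e x : (kap^-1 * phi x) `^ q = (kap `^ q)^-1 * phi x `^ q.
  have ikap0 : 0 <= kap^-1 by rewrite invr_ge0 ltW.
  rewrite (powRM q ikap0 (phi0 x)); congr (_ * _).
  by rewrite -powRN -(powR_inv1 (ltW kap0)) -powRrM mulN1r.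
split => //.
- by rewrite (E_EFin (int_Z kap^-1 iphi)) (E_Z kap^-1 iphi) fE mulKf// gt_eqF.
- rewrite (_ : (fun x => _) = (fun x => ((kap `^ q)^-1 * phi x `^ q)%:E)); last first.
    by apply/funext => x; rewrite e.
  rewrite (E_EFin (int_Z (kap `^ q)^-1 iq)) (E_Z (kap `^ q)^-1 iq) AE mulKf//.
  by rewrite gt_eqF// powR_gt0.
- apply/(weak_norm_le (ltW F0) m' p') => t t0; have := tail (kap * t) (mulr_gt0 kap0 t0).
  have -> : k / (kap * t) = F / t by rewrite -kapE; field; rewrite !gt_eqF.
  apply: le_trans; rewrite le_eqVlt; apply/orP; left; apply/eqP; congr (mu _).
  by apply/seteqP; split => x /=; rewrite ler_pdivlMl.
Qed.

End normalization.

Section maximal_scaling.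
Context {R : realType} {d : measure_display} {X : measurableType d}.
Variable mu : probability X R.
Variables (T : set (set X)) (C : set X -> set (set X)).
Hypothesis hT : tree_with mu T C.
Local Notation int f := (mu.-integrable setT (EFin \o f)).

Lemma maximal_scale kap lam (phi : X -> R) x : 0 < kap -> (forall x, 0 <= phi x) ->
  int phi -> (lam%:E <= tree_maximal mu T phi x)%E ->
  ((kap * lam)%:E <= tree_maximal mu T (fun x => (kap * phi x)%R) x)%E.
Proof.
move=> kap0 phi0 iphi h.
suff H : (tree_maximal mu T phi x <=
    kap^-1%:E * tree_maximal mu T (fun x => (kap * phi x)%R) x)%E.
  by rewrite EFinM -lee_pdivlMl//; exact: le_trans h H.
have kphi0 y : 0 <= kap * phi y by rewrite mulr_ge0// ltW.
have ikphi : int (fun y => kap * phi y) by exact: int_Z.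
apply: ge_ereal_sup => _ [I [TI Ix] <-].
rewrite (averageE hT phi0 iphi TI) lee_pdivlMl// -EFinM.
apply: ereal_sup_ubound; exists I => //; rewrite (averageE hT kphi0 ikphi TI).
rewrite /load RintegralZl ?mulrA//; first exact: (tree_measurable hT).
by apply: integrableS iphi => //; exact: (tree_measurable hT).
Qed.

Lemma maximal_scale_set kap lam (phi : X -> R) : 0 < kap -> (forall x, 0 <= phi x) ->
  int phi -> [set x | (lam%:E <= tree_maximal mu T phi x)%E] =
  [set x | ((kap * lam)%:E <= tree_maximal mu T (fun x => (kap * phi x)%R) x)%E].
Proof.
move=> kap0 phi0 iphi; apply/seteqP; split => x /=; first exact: maximal_scale.
have ikap0 : 0 < kap^-1 by rewrite invr_gt0.
have kphi0 y : 0 <= kap * phi y by rewrite mulr_ge0// ltW.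
move=> /(maximal_scale ikap0 kphi0 (int_Z kap iphi)); rewrite mulKf ?gt_eqF//.
by under [X in tree_maximal _ _ X]funext => y do rewrite mulKf ?gt_eqF//.
Qed.

End maximal_scaling.

Section bounds.
Context {R : realType} {d : measure_display} {X : measurableType d}.
Variable mu : probability X R.
Variables p q : R.
Hypotheses (q1 : 1 < q) (qp : q < p).
Variables (T : set (set X)) (C : set X -> set (set X)).
Hypothesis hT : tree_with mu T C.
Local Notation E := (Rintegral mu setT).
Local Notation int f := (mu.-integrable setT (EFin \o f)).
Local Notation k := ((p - 1) / p).

Variables f A F : R.
Hypotheses (f0 : 0 < f) (F0 : 0 < F).
Local Notation kap := ((p - 1) / (p * F)).
Local Notation normal := (normalized mu p q (kap * f) (kap `^ q * A)).

Let kap0 : 0 < kap. Proof. exact: (kap_gt0 q1 qp). Qed.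

Lemma tree_uniform_exists : exists S : X -> R, uniform01 mu S.
Proof.
have [V [mV V01 Vat]] := tree_coordinate hT.
exact: (uniform_exists mV V01 Vat).
Qed.

(** Upper bounds for [B1] only use the weak-type inequality. *)
Lemma B1_le lam D : 0 < lam ->
  (forall phi (P : X -> bool) dl, normal phi -> measurable [set x | P x] ->
    mu [set x | P x] = dl%:E -> 0 <= dl <= 1 ->
    kap * lam * dl <= E (fun x => phi x * (P x)%:R) -> dl <= D) ->
  (B1 mu T p q f A F lam <= D%:E)%E.
Proof.
move=> lam0 h; apply: ge_ereal_sup => _ [phi adm <-].
have hn := admissible_normalized q1 qp F0 adm.
have [mphi phi0 fE _ _] := adm; have [iphi _] := int_ge0 mphi phi0 fE.
rewrite (maximal_scale_set hT lam kap0 phi0 iphi).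
set psi := (fun x => kap * phi x) in hn *.
pose P x := ((kap * lam)%:E <= tree_maximal mu T psi x)%E.
have psi0 y : 0 <= psi y by rewrite mulr_ge0// ltW.
have ipsi : int psi by exact: int_Z.
have [mP hP] := weak_type hT psi0 ipsi (mulr_gt0 kap0 lam0).
have muP : mu [set x | P x] = (mass mu [set x | P x])%:E by exact: massE.
apply: (@le_trans _ _ (mass mu [set x | P x])%:E).
  by rewrite le_eqVlt; apply/orP; left; apply/eqP; exact: muP.
rewrite lee_fin; apply: (h psi P) => //.
- by rewrite mass_ge0 /= -lee_fin -muP; exact: probability_le1.
- apply: le_trans hP _; rewrite le_eqVlt; apply/orP; left; apply/eqP.
  rewrite /load Rintegral_mkcond; apply: eq_E => x; rewrite patchE.
  have [xP|xP] := boolP (P x).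
    by rewrite mem_set// mulr1.
  by rewrite memNset ?mulr0//; apply/negP.
Qed.

(** Lower bounds come from the realization of a profile. *)
Lemma B1_ge v b al v' c lam dl : is_profile p v b al v' c ->
  head p v b al + rest p al v' c = kap * f -> energy p q v b al v' c = kap `^ q * A ->
  0 < lam -> 0 < dl < 1 ->
  (forall S, uniform01 mu S -> kap * lam * dl <=
    E (fun x => profile p v b al v' c (S x) * (S x <= dl)%R%:R)) ->
  (dl%:E <= B1 mu T p q f A F lam)%E.
Proof.
move=> hP fE AE lam0 dl01 h; set g := profile p v b al v' c in h.
apply/lee_addgt0Pr => eps eps0.
have [|S uS hS] := realize hT (measurable_profile p v b al v' c)
  (profile_ge0 q1 qp hP) (fun s t => profile_nonincreasing q1 qp hP (s := s) (t := t))
  (mulr_gt0 kap0 lam0) dl01 eps0 _ h.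
  by move=> S uS; have [] := E_profile q1 qp uS hP.
have [ig Eg] := E_profile q1 qp uS hP; have [iq Eq] := E_profile_q q1 qp uS hP.
have hn : normal (g \o S).
  by split => //; [exact: (dominated_profile q1 qp uS hP)|rewrite Eg|rewrite Eq].
have adm := normalized_admissible q1 qp F0 hn.
rewrite -leeBlDr//; apply: le_trans (ereal_sup_ubound _); last by exists (fun x => kap^-1 * (g \o S) x).
have [m' p' _ _ _] := adm.
have i' : int (fun x => kap^-1 * (g \o S) x) by exact: int_Z.
rewrite (maximal_scale_set hT lam kap0 p' i').
under [X in tree_maximal _ _ X]funext => y do rewrite mulVKf ?gt_eqF//.
done.
Qed.

End bounds.

(** * The extremal problem *)

Section scaling_of_the_domain.
Context {R : realType}.
Variables p q : R.
Hypotheses (q1 : 1 < q) (qp : q < p).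
Local Notation k := ((p - 1) / p).
Local Notation kk := (1 - p^-1).
Local Notation kq := (1 - q / p).
Local Notation G := (Gam p q).
Local Notation Tf := (Tfun p q).
Local Notation lp l := ((l `^ p)^-1).

Let p0 : 0 < p. Proof. have ? := q1; have ? := qp; lra. Qed.
Let pm0 : 0 < p - 1. Proof. have ? := q1; have ? := qp; lra. Qed.
Let pq0 : 0 < p - q. Proof. have ? := q1; have ? := qp; lra. Qed.
Let k0 : 0 < k. Proof. exact: divr_gt0. Qed.

Lemma A2_scale f F : 0 < f -> 0 < F ->
  ((p - 1) / (p * F)) `^ q * A2 p q f F = Tf ((p - 1) / (p * F) * f) 1.
Proof.
move=> f0 F0; set kap := (p - 1) / (p * F).
have kap0 : 0 < kap by rewrite divr_gt0// mulr_gt0.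
have kF : k = kap * F by rewrite /kap; field; rewrite !gt_eqF.
rewrite -(A2E q1 qp (mulr_gt0 kap0 f0)) /A2.
have -> : (kap * f <= k) = (f <= F) by rewrite kF ler_pM2l.
case: ifP => _; first by rewrite (powRM q (ltW kap0) (ltW f0)).
have -> : k * (kap * f / k) = k * (f / F) by rewrite /kap; field; rewrite !gt_eqF.
have -> : k `^ q = kap `^ q * F `^ q by rewrite -(powRM q (ltW kap0) (ltW F0)) -kF.
by ring.
Qed.

Lemma A1_scale f F : 0 < f -> 0 < F ->
  ((p - 1) / (p * F)) `^ q * A1 p q f F =
  G * (((p - 1) / (p * F) * f) `^ kk^-1) `^ kq.
Proof.
move=> f0 F0; set kap := (p - 1) / (p * F).
have kap0 : 0 < kap by rewrite divr_gt0// mulr_gt0.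
have kF : k = kap * F by rewrite /kap; field; rewrite !gt_eqF.
rewrite -powRrM; have -> : kk^-1 * kq = (p - q) / (p - 1).
  by field; rewrite !gt_eqF.
rewrite /A1 /Gam; set e1 := (p - q) / (p - 1); set e2 := p * (q - 1) / (p - 1).
have qE : q = e1 + e2 by rewrite /e1 /e2; field; rewrite gt_eqF.
have -> : k `^ q = k `^ e1 * (kap `^ e2 * F `^ e2).
  by rewrite -(powRM e2 (ltW kap0) (ltW F0)) -kF {1}qE powRDx.
have -> : kap `^ q = kap `^ e1 * kap `^ e2 by rewrite {1}qE powRDx.
by rewrite (powRM e1 (ltW kap0) (ltW f0)); ring.
Qed.

Lemma d0_level f1 : 0 < f1 -> f1 `^ kk^-1 = lp ((f1^-1) `^ (p - 1)^-1).
Proof.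
move=> f10; rewrite -(powR_inv1 (ltW f10)) -!powRrM -powRN; congr (_ `^ _).
by field; rewrite !gt_eqF.
Qed.

Lemma level_le l l' : 0 < l -> 0 < l' -> (lp l' <= lp l) = (l <= l').
Proof.
move=> l0 l'0; rewrite lef_pV2 ?posrE ?powR_gt0//; apply/idP/idP => [|h].
  by apply: contraTT; rewrite -!ltNge; apply: powR_lt => //; exact: ltW.
by apply: powR_le => //; exact: ltW.
Qed.

Lemma levelK l : 0 < l -> (lp l) `^ (- p^-1) = l.
Proof.
by move=> l0; rewrite -powRN -powRrM mulrNN mulfV ?gt_eqF// powRr1// ltW.
Qed.

Lemma levelVK x : 0 < x -> lp (x `^ (- p^-1)) = x.
Proof.
by move=> x0; rewrite -powRN -powRrM mulrNN mulVf ?gt_eqF// powRr1// ltW.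
Qed.

Lemma level_powkq l : 0 < l -> lp l `^ kq = (l `^ (p - q))^-1.
Proof.
move=> l0; rewrite -!powRN -powRrM; congr (_ `^ _).
by field; rewrite gt_eqF.
Qed.

End scaling_of_the_domain.

Section extremal_problem.
Context {R : realType} {d : measure_display} {X : measurableType d}.
Variable mu : probability X R.
Variables p q : R.
Hypotheses (q1 : 1 < q) (qp : q < p).
Variables (T : set (set X)) (C : set X -> set (set X)).
Hypothesis hT : tree_with mu T C.
Local Notation E := (Rintegral mu setT).
Local Notation k := ((p - 1) / p).
Local Notation kk := (1 - p^-1).
Local Notation kq := (1 - q / p).
Local Notation G := (Gam p q).
Local Notation Tf := (Tfun p q).
Local Notation Ff := (Ffun p q).
Local Notation lp l := ((l `^ p)^-1).

Variables f A F : R.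
Hypotheses (f0 : 0 < f) (F0 : 0 < F).
Local Notation kap := ((p - 1) / (p * F)).
Local Notation f1 := (kap * f).
Local Notation A' := (kap `^ q * A).
Local Notation d0 := (f1 `^ kk^-1).

Let p0 : 0 < p. Proof. have ? := q1; have ? := qp; lra. Qed.
Let pm0 : 0 < p - 1. Proof. have ? := q1; have ? := qp; lra. Qed.
Let ip01 : 0 < p^-1 < 1.
Proof. by rewrite invr_gt0 p0 invf_lt1//; have ? := q1; have ? := qp; lra. Qed.
Let qp01 : 0 < q / p < 1.
Proof. by rewrite divr_gt0 ?ltr_pdivrMr ?mul1r//; have ? := q1; have ? := qp; lra. Qed.

Ltac plra := have ? := q1; have ? := qp; have ? := ip01; have ? := qp01; lra.

Let kk0 : 0 < kk. Proof. plra. Qed.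
Let kap0 : 0 < kap. Proof. exact: (kap_gt0 q1 qp). Qed.
Let f10 : 0 < f1. Proof. exact: mulr_gt0. Qed.
Let q0 : 0 < q. Proof. plra. Qed.
Let qm0 : 0 < q - 1. Proof. plra. Qed.

Lemma mean_le1 : (f1 <= 1) = (f <= p / (p - 1) * F).
Proof.
have -> : p / (p - 1) * F = kap^-1 by field; rewrite !gt_eqF.
by rewrite -[kap^-1]mulr1 ler_pdivlMl.
Qed.

Lemma domain_necessary phi : admissible mu p q f A F phi ->
  [/\ f1 <= 1, Tf f1 1 <= A' & A' <= G * d0 `^ kq].
Proof.
move=> /(admissible_normalized q1 qp F0) [dphi iq fE AE].
have [S uS] := tree_uniform_exists hT.
have [i f11] := dominated_int q1 qp uS dphi.
split; first by rewrite -fE.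
  by rewrite -AE; exact: (energy_ge_base q1 qp uS dphi iq f10 fE).
rewrite -AE; have := energy_upper_bound q1 qp uS dphi iq; rewrite fE => /(_ f10).
by rewrite -powRrM [kk^-1 * kq]mulrC.
Qed.

(** The minimizers supported on sets of measure [x] have energies that run through
    the whole interval as [x] varies. *)
Lemma domain_sufficient : f1 <= 1 -> Tf f1 1 <= A' <= G * d0 `^ kq ->
  exists phi, admissible mu p q f A F phi.
Proof.
move=> f11 hA; have [S uS] := tree_uniform_exists hT.
have [x xd hx] := Tfull_root q1 qp uS f10 f11 hA.
have [v [b [hP hE eE _ _]]] := Tfull_profile q1 qp f10 xd.
have [ig Eg] := E_profile q1 qp uS hP; have [iq Eq] := E_profile_q q1 qp uS hP.
exists (fun y => kap^-1 * (profile p v b x 0 1 \o S) y).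
apply: normalized_admissible => //; split => //.
- exact: (dominated_profile q1 qp uS hP).
- by rewrite Eg hE full_rest addr0.
- by rewrite Eq eE hx.
Qed.

Section values.
Hypothesis hA : Tf f1 1 < A' <= G * d0 `^ kq.
Hypothesis f11 : f1 < 1.
Let f01 : 0 < f1 < 1. Proof. by rewrite f10. Qed.
Variable lam : R.
Hypothesis lam0 : 0 < lam.
Local Notation l := (kap * lam).
Let l0 : 0 < l. Proof. exact: mulr_gt0. Qed.

Lemma B1_small : lam <= f -> B1 mu T p q f A F lam = 1%:E.
Proof.
move=> lf; have /andP[/ltW TA AG] := hA.
have [|phi adm] := domain_sufficient (ltW f11); first by rewrite TA.
apply/eqP; rewrite eq_le; apply/andP; split.
  by apply: (B1_le q1 qp hT F0 lam0) => psi P dl _ _ _ /andP[].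
have [mphi phi0 fE _ _] := adm; have [iphi Ef] := int_ge0 mphi phi0 fE.
apply: le_trans (ereal_sup_ubound _); last by exists phi.
have -> : [set x | (lam%:E <= tree_maximal mu T phi x)%E] = setT.
  apply/seteqP; split => // x _; apply: (maximal_ge hT phi0 iphi (tree_setT hT)) => //.
  by rewrite /load Ef /mass probability_setT /= mulr1.
exact: (eq_ind_r (fun z => (1%:E <= z)%E) (lexx _) (probability_setT mu)).
Qed.

(** The function of energy [A'] concentrated on a set of measure [x] has its whole
    mean on the set of measure [f1 / l]. *)
Lemma B1_linear x : f1 < l -> d0 <= x <= 1 -> Tfull p q f1 x = A' -> x <= f1 / l ->
  B1 mu T p q f A F lam = (f1 / l)%:E.
Proof.
move=> fl xd hx xl; apply/eqP; rewrite eq_le; apply/andP; split.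
  apply: (B1_le q1 qp hT F0 lam0) => psi P dl [dpsi iq fE AE] mP muP dl01 h.
  have [S uS] := tree_uniform_exists hT.
  have [ipsi _] := dominated_int q1 qp uS dpsi; have [_ psi0 _] := dpsi.
  rewrite ler_pdivlMr// mulrC; apply: le_trans h _; rewrite -fE.
  apply: E_le => //; first exact: int_Mind.
  by move=> y; rewrite ler_piMr// lern1 leq_b1.
have [v [b [hP hE eE _ _]]] := Tfull_profile q1 qp f10 xd.
apply: (B1_ge q1 qp hT F0 hP) => //.
- by rewrite hE full_rest addr0.
- by rewrite eE.
- by rewrite divr_gt0//= ltr_pdivrMr// mul1r.
move=> S uS; rewrite [l * _]mulrC divfK ?gt_eqF// -{1}hE -(E_profile_head q1 qp uS hP).
have [ig _] := E_profile q1 qp uS hP.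
have g0 y : 0 <= (profile p v b x 0 1 \o S) y by exact: (profile_ge0 q1 qp hP).
apply: E_le; [exact: int_Mind (measurable_uniform_le uS _) g0 ig..|].
move=> y /=; rewrite ler_wpM2l//; first exact: g0.
have [Sx|] := leP (S y) x; last by rewrite ler0n.
by rewrite (le_trans Sx xl).
Qed.

(** The bound that [dominated] alone imposes. *)
Lemma B1_level_le : (B1 mu T p q f A F lam <= (lp l)%:E)%E.
Proof.
have [S uS] := tree_uniform_exists hT.
apply: (B1_le q1 qp hT F0 lam0) => psi P dl [dpsi iq fE AE] mP muP /andP[dl0 dl1] h.
move: dl0; rewrite le_eqVlt => /predU1P[<-|dl0]; first by rewrite ltW// level_gt0.
rewrite -(le_level q1 qp l0 dl0); apply: le_trans h _.
by apply: (dominated_set q1 qp uS dpsi mP muP); rewrite dl0.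
Qed.

(** The minimizer that equals [w] on [(0, x]] has average at least [l] on
    [(0, l^(-p)]]. *)
Lemma B1_level x : 0 < x <= d0 -> Hsat p q f1 x = A' -> lp l <= x ->
  B1 mu T p q f A F lam = (lp l)%:E.
Proof.
move=> /andP[x0 xd] Hx lx; apply/eqP; rewrite eq_le B1_level_le /=.
have [r [c [hP xc rE eE]]] := H_profile q1 qp f10 f11 x0 xd.
have dl0 := level_gt0 p l0.
have dl1 : lp l < 1 by apply: le_lt_trans lx _; apply: le_lt_trans xd (d0_lt1 q1 qp f10 f11).
apply: (B1_ge q1 qp hT F0 hP) => //.
- by rewrite rE /head powR0 ?gt_eqF//; ring.
- by rewrite eE.
- by rewrite dl0.
move=> S uS; have [_ S01 _] := uS.
have dl01 : 0 <= lp l <= 1 by rewrite !ltW.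
have [_ e] := E_wS q1 qp uS dl01.
rewrite (levelE q1 qp l0) -e le_eqVlt; apply/orP; left; apply/eqP; apply: eq_E => y.
have [Sy|] := leP (S y) (lp l); last by rewrite !mulr0.
have /andP[Sy0 _] := S01 y.
by rewrite /profile leNgt Sy0 /= (le_trans Sy lx).
Qed.

(** Past its upper end the constraint fails for one of two reasons: the mean is
    exhausted, and the energy there is a value of [Tfull], or the bound [w] is
    reached, and it is a value of [Hsat]. *)
Lemma Ev_max x3 x1 : f1 < l -> d0 <= x3 <= 1 -> Tfull p q f1 x3 = A' -> f1 / l < x3 ->
  0 < x1 <= d0 -> Hsat p q f1 x1 = A' -> x1 <= lp l ->
  A' <= Ev p q f1 l (Num.min (f1 / l) (lp l)).
Proof.
move=> fl /andP[dx3 x31] h3 lx3 /andP[x10 x1d] h1 x1l.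
have [S uS] := tree_uniform_exists hT.
have dl0 := level_gt0 p l0.
have [h|h] := leP (lp l) d0.
  have -> : Num.min (f1 / l) (lp l) = lp l.
    apply/min_idPr; rewrite ler_pdivlMr// mulrC (levelE q1 qp l0).
    by apply: (powkk_le_f1 q1 qp f10) => //; exact: ltW.
  have -> : Ev p q f1 l (lp l) = Hsat p q f1 (lp l).
    by rewrite /Ev /Hsat (levelK q1 qp l0) (T_saturated q1 qp l0 dl0 (levelE q1 qp l0)) addrC.
  move: x1l; rewrite -h1 le_eqVlt => /predU1P[->//|x1l].
  exact/ltW/(H_increasing q1 qp uS f10 f11).
have -> : Num.min (f1 / l) (lp l) = f1 / l.
  apply/min_idPl; rewrite ler_pdivrMr// [lp l * _]mulrC (levelE q1 qp l0).
  by rewrite -(le_d0 q1 qp f10) ?ltW.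
rewrite /Ev (F_zero q1 qp)// addr0 -h3.
have -> : Tf l (f1 / l) = Tfull p q f1 (f1 / l).
  by rewrite /Tfull; congr Tfun; rewrite invf_div mulrCA divff ?mulr1 ?gt_eqF//.
apply/ltW/(Tfull_decreasing q1 qp uS f10) => //.
have d00 : 0 < d0 by exact: powR_gt0.
have := ltW h; rewrite -(le_level q1 qp l0 d00) powRVK ?gt_eqF ?(ltW f10)// => ld.
by rewrite ler_pdivlMr// mulrC.
Qed.

(** Optimality of [de] is seen from its own multipliers: a larger exceptional set
    would cost more than the energy [A']. *)
Lemma B1_middle (z := Delta_min p f1 l) (m := Num.min (f1 / l) (lp l)) : f1 < l ->
  A' <= Ev p q f1 l m -> exists de,
  unique (fun a => Delta p f1 l a /\ Tf l a + Ff f1 l a = A') de /\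
  B1 mu T p q f A F lam = de%:E.
Proof.
move=> fl Am; have [S uS] := tree_uniform_exists hT.
have /andP[TA _] := hA.
have [|de /andP[zd dm] hde] := @Ev_root _ _ _ mu p q q1 qp S uS f1 f10 f11 l fl A'.
  by rewrite (ltW TA).
have EvE := Ev_min q1 qp f10 f11 fl.
have {}zd : z < de.
  rewrite lt_neqAle zd andbT; apply/negP => /eqP zE.
  by move: TA; rewrite -hde -zE EvE ltxx.
have incr := Ev_increasing q1 qp uS f10 f11 fl.
exists de; split.
  split; first by split => //; rewrite /Delta /= (ltW zd).
  move=> a [/andP[za am] ha]; apply/eqP; rewrite eq_le; apply/andP; split;
    rewrite leNgt; apply/negP => h.
    by have := incr a de za h dm; rewrite hde -ha ltxx.
  by have := incr de a (ltW zd) h am; rewrite hde -ha ltxx.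
have [z0 _ _ _ _] := Delta_min_spec q1 qp f01 fl.
have de0 : 0 < de := le_lt_trans z0 zd.
have [del delp] : de <= f1 / l /\ de <= lp l by move: dm; rewrite le_min => /andP.
have de1 : de < 1 by apply: (le_lt_trans del); rewrite ltr_pdivrMr// mul1r.
have [v [b [v' [c [hP hE rE eE [v'l v'w lv dich bpos]]]]]] := optimal_profile q1 qp f01 fl zd dm.
apply/eqP; rewrite eq_le; apply/andP; split; last first.
  apply: (B1_ge q1 qp hT F0 hP) => //.
  - by rewrite hE rE; ring.
  - by rewrite eE.
  - by rewrite de0.
  by move=> S' uS'; rewrite -hE -(E_profile_head q1 qp uS' hP).
have [->|{}delp] : de = lp l \/ de < lp l by move: delp; rewrite le_eqVlt => /predU1P.
  exact: B1_level_le.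
have b0 := bpos delp.
have s0 := slope_gt0 q1 qp (profile_v'0 hP) v'l v'w (lv b0) dich.
apply: (B1_le q1 qp hT F0 lam0) => psi P dl [dpsi iq fE AE] mP muP /andP[dl0 dl1] h.
rewrite leNgt; apply/negP => dedl.
have := energy_lower_bound q1 qp uS dpsi iq mP b0 (profile_b_al hP) (profile_al_c hP)
  (profile_c1 hP) (profile_v'0 hP) (profile_v'v hP b0) (profile_vb hP b0)
  (profile_bv hP b0) (profile_v'c hP) (profile_cv' hP).
rewrite AE fE muP /= -/(energy p q v b de v' c) -/(head p v b de) -/(rest p de v' c) hE rE eE.
rewrite -/(Ev p q f1 l de) hde.
set x := E _ in h *; set om := rtan q v _ - _ in s0 *.
have v'v : v' `^ (q - 1) <= v `^ (q - 1).
  by apply: powR_le; [exact: ltW qm0|exact: profile_v'0 hP|exact: profile_v'v hP b0].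
have h1 : 0 <= q * (v `^ (q - 1) - v' `^ (q - 1)) * (x - l * dl).
  by rewrite mulr_ge0 ?subr_ge0// mulr_ge0 ?subr_ge0// ltW.
have h2 : 0 < (q * (v `^ (q - 1) - v' `^ (q - 1)) * l - om) * (dl - de).
  by rewrite mulr_gt0// subr_gt0.
rewrite leNgt; apply/negP; rewrite negbK -subr_gt0.
have -> : A' + q * v `^ (q - 1) * (x - l * de)
    + q * v' `^ (q - 1) * (f1 - x - (f1 - l * de)) - (dl - de) * om - A' =
    q * (v `^ (q - 1) - v' `^ (q - 1)) * (x - l * dl)
    + (q * (v `^ (q - 1) - v' `^ (q - 1)) * l - om) * (dl - de) by ring.
exact: ltr_wpDl.
Qed.

End values.
End extremal_problem.

(** * The theorem *)

Theorem theorem1p1 (R : realType) (d : measure_display) (X : measurableType d)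
    (mu : probability X R) (p q : R) (T : set (set X))
    (q_gt1 : 1 < q) (q_lt_p : q < p)
    (mu_nonatomic : nonatomic mu) (T_tree : is_tree mu T) :
  (forall f A F : R, 0 < f -> 0 < A -> 0 < F ->
     (exists phi : X -> R, admissible mu p q f A F phi) <-> D1 p q f A F)
  /\
  (forall f A F : R, D1 p q f A F -> A2 p q f F < A ->
     let f1 := (p - 1) / p * (f / F) in
     let A' := ((p - 1) / (p * F)) `^ q * A in
     exists l1 l3 : R,
       [/\ unique (fun l => (f1^-1) `^ (p - 1)^-1 <= l /\
                     Ffun p q f1 l (l `^ p)^-1 + Gam p q / l `^ (p - q) = A')
             l1,
           unique (fun l => f1 <= l <= (f1^-1) `^ (p - 1)^-1 /\
                     Tfun p q l (f1 / l) = A')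
             l3 &
           forall lambda : R, 0 < lambda ->
             let l := (p - 1) / p * (lambda / F) in
             [/\ lambda <= f ->
                   B1 mu T p q f A F lambda = 1%:E,
                 f < lambda <= p / (p - 1) * F * l3 ->
                   B1 mu T p q f A F lambda = (f / lambda)%:E,
                 p / (p - 1) * F * l3 < lambda <= p / (p - 1) * F * l1 ->
                   exists delta : R,
                     unique (fun a => Delta p f1 l a /\
                               Tfun p q l a + Ffun p q f1 l a = A')
                       delta /\
                     B1 mu T p q f A F lambda = delta%:E &
                 p / (p - 1) * F * l1 < lambda ->
                   B1 mu T p q f A F lambda =
                   ((p * F / (p - 1) / lambda) `^ p)%:E]]).
Proof.
have [C treeT] := T_tree.
have p0 : 0 < p by lra.
have pm0 : 0 < p - 1 by lra.
have kappaE x F : 0 < F -> (p - 1) / p * (x / F) = (p - 1) / (p * F) * x.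
  by move=> F0; field; rewrite !gt_eqF.
have lower f A F : 0 < f -> 0 < F -> let kap := (p - 1) / (p * F) in
    (A2 p q f F <= A) = (Tfun p q (kap * f) 1 <= kap `^ q * A).
  move=> f0 F0 kap; rewrite -(A2_scale q_gt1 q_lt_p)// ler_pM2l// powR_gt0//.
  exact: (kap_gt0 q_gt1 q_lt_p).
have upper f A F : 0 < f -> 0 < F -> let kap := (p - 1) / (p * F) in
    (A <= A1 p q f F) =
    (kap `^ q * A <= Gam p q * ((kap * f) `^ (1 - p^-1)^-1) `^ (1 - q / p)).
  move=> f0 F0 kap; rewrite -(A1_scale q_gt1 q_lt_p)// ler_pM2l// powR_gt0//.
  exact: (kap_gt0 q_gt1 q_lt_p).
split.
  move=> f A F f0 A0 F0; split.
    move=> [phi /(domain_necessary q_gt1 q_lt_p treeT f0 F0)[f11 TA AG]].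
    split => //; first by rewrite -(mean_le1 q_gt1 q_lt_p).
    by rewrite lower// upper// TA.
  move=> [_ _ _ fF]; rewrite lower// upper// => hA.
  apply: (domain_sufficient q_gt1 q_lt_p treeT f0 F0) => //.
  by rewrite (mean_le1 q_gt1 q_lt_p).
move=> f A F [f0 A0 F0 fF /andP[_ AA1]] A2A f1 A'.
have kap0 := kap_gt0 q_gt1 q_lt_p F0.
have f1E : f1 = (p - 1) / (p * F) * f by exact: kappaE.
have f1le : f1 <= 1 by rewrite f1E (mean_le1 q_gt1 q_lt_p).
have hA : Tfun p q f1 1 < A' <= Gam p q * (f1 `^ (1 - p^-1)^-1) `^ (1 - q / p).
  rewrite /A' f1E -upper// AA1 andbT -(A2_scale q_gt1 q_lt_p)// ltr_pM2l//.
  exact: powR_gt0.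
have f10 : 0 < f1 by rewrite f1E mulr_gt0.
have f11 : f1 < 1.
  rewrite lt_neqAle f1le andbT; apply/eqP => e; move: hA.
  rewrite e (T_saturated q_gt1 q_lt_p)//; last by rewrite mul1r powR1.
  by rewrite !powR1 /= => /andP[h1 h2]; have := lt_le_trans h1 h2; rewrite ltxx.
have [S uS] := tree_uniform_exists treeT.
set d0 := f1 `^ _ in hA.
have d00 : 0 < d0 by exact: powR_gt0.
(* [x3] and [x1] are the measures of the set at the thresholds [l3] and [l1] *)
have [|x3 x3d h3] := Tfull_root q_gt1 q_lt_p uS f10 f1le (A := A').
  by have /andP[/ltW-> ->] := hA.
have [x1 x1d h1] := H_root q_gt1 q_lt_p uS f10 f11 hA.
have [/andP[dx3 x31] /andP[x10 x1d0]] := (x3d, x1d).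
have x30 : 0 < x3 := lt_le_trans d00 dx3.
(* at the level [L], the mean and the bound [w] are exhausted together *)
pose L := (f1^-1) `^ (p - 1)^-1.
have L0 : 0 < L by rewrite powR_gt0// invr_gt0.
have d0L : d0 = (L `^ p)^-1 by exact: (d0_level q_gt1 q_lt_p).
have Ld0 : L * d0 = f1.
  by rewrite d0L (levelE q_gt1 q_lt_p)// -d0L (d0_powkk q_gt1 q_lt_p).
have levelP l : 0 < l -> L <= l -> 0 < (l `^ p)^-1 <= d0 /\
    Hsat p q f1 (l `^ p)^-1 = Ffun p q f1 l (l `^ p)^-1 + Gam p q / l `^ (p - q).
  move=> l0 Ll; split; first by rewrite level_gt0//= d0L (level_le q_gt1 q_lt_p).
  by rewrite /Hsat (levelK q_gt1 q_lt_p)// (level_powkq q_gt1 q_lt_p).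
have meanP l : f1 <= l -> l <= L -> d0 <= f1 / l <= 1 /\
    Tfull p q f1 (f1 / l) = Tfun p q l (f1 / l).
  move=> fl lL; have l0 : 0 < l := lt_le_trans f10 fl.
  rewrite ler_pdivlMr// ler_pdivrMr// mul1r fl andbT -[X in _ <= X]Ld0 mulrC.
  split; first by rewrite ler_pM2r.
  by rewrite /Tfull invf_div mulrCA divff ?mulr1// gt_eqF.
exists (x1 `^ (- p^-1)), (f1 / x3).
have l10 : 0 < x1 `^ (- p^-1) by exact: powR_gt0.
have l1x := levelVK q_gt1 q_lt_p x10.
have l30 : 0 < f1 / x3 by exact: divr_gt0.
have l3x : f1 / (f1 / x3) = x3 by rewrite invf_div mulrCA divff ?mulr1// gt_eqF.
have Ll1 : L <= x1 `^ (- p^-1).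
  have h : x1 <= (L `^ p)^-1 by rewrite -d0L.
  by move: h; rewrite -{1}l1x (level_le q_gt1 q_lt_p L0 l10).
have fl3 : f1 <= f1 / x3 by rewrite ler_pdivlMr// ler_piMr// ltW.
have l3L : f1 / x3 <= L by rewrite ler_pdivrMr// -{1}Ld0 ler_pM2l.
split.
- split.
    by have [_ e] := levelP _ l10 Ll1; rewrite -e l1x.
  move=> l [Ll hl]; have l0 : 0 < l := lt_le_trans L0 Ll.
  have [/andP[y0 yd] e] := levelP l l0 Ll; rewrite -e -h1 in hl.
  suff -> : x1 = (l `^ p)^-1 by exact: (levelK q_gt1 q_lt_p).
  have incr := H_increasing q_gt1 q_lt_p uS f10 f11.
  apply/eqP; rewrite eq_le; apply/andP; split; rewrite leNgt; apply/negP => h.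
    by have := incr _ _ y0 h x1d0; rewrite hl ltxx.
  by have := incr _ _ x10 h yd; rewrite hl ltxx.
- split.
    by rewrite fl3 l3L; have [_ <-] := meanP _ fl3 l3L; rewrite l3x.
  move=> l [/andP[fl lL] hl]; have l0 : 0 < l := lt_le_trans f10 fl.
  have [/andP[dy y1] e] := meanP l fl lL; rewrite -e -h3 in hl.
  suff -> : x3 = f1 / l by rewrite invf_div mulrCA divff ?mulr1// gt_eqF.
  have decr := Tfull_decreasing q_gt1 q_lt_p uS f10.
  apply/eqP; rewrite eq_le; apply/andP; split; rewrite leNgt; apply/negP => h.
    by have := decr _ _ dy h x31; rewrite hl ltxx.
  by have := decr _ _ dx3 h y1; rewrite hl ltxx.
move=> lambda lambda0 l.
have lE : l = (p - 1) / (p * F) * lambda by exact: kappaE.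
have l0 : 0 < l by rewrite lE mulr_gt0.
have le_kap t : (lambda <= p / (p - 1) * F * t) = (l <= t).
  have -> : p / (p - 1) * F = ((p - 1) / (p * F))^-1 by field; rewrite !gt_eqF.
  by rewrite ler_pdivlMl// lE.
have lt_kap t : (p / (p - 1) * F * t < lambda) = (t < l) by rewrite !ltNge le_kap.
have lt_f : (f < lambda) = (f1 < l) by rewrite f1E lE ltr_pM2l.
have hA' := hA; rewrite /d0 f1E in hA'.
have f11' := f11; rewrite f1E in f11'.
have x3d' := x3d; rewrite /d0 f1E in x3d'.
have x1d' := x1d; rewrite /d0 f1E in x1d'.
have h3' := h3; rewrite f1E in h3'.
have h1' := h1; rewrite f1E in h1'.
split.
- exact: (B1_small q_gt1 q_lt_p treeT f0 F0 hA' f11' lambda0).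
- rewrite le_kap lt_f => /andP[fl ll3].
  have -> : f / lambda = (p - 1) / (p * F) * f / ((p - 1) / (p * F) * lambda).
    by field; rewrite !gt_eqF.
  apply: (B1_linear q_gt1 q_lt_p treeT f0 F0 lambda0 _ x3d' h3').
    by rewrite -f1E -lE.
  by rewrite -f1E -lE ler_pdivlMr// mulrC -ler_pdivlMr.
- rewrite lt_kap le_kap => /andP[l3l ll1].
  have fl : f1 < l := le_lt_trans fl3 l3l.
  have := B1_middle q_gt1 q_lt_p treeT f0 F0 hA' f11' lambda0.
  rewrite -f1E -lE; apply => //.
  have := Ev_max q_gt1 q_lt_p treeT f0 F0 f11' lambda0.
  rewrite -f1E -lE; move=> /(_ _ _ _ fl x3d h3 _ x1d h1); apply.
    by rewrite ltr_pdivrMr// mulrC -ltr_pdivrMr.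
  by rewrite -l1x (level_le q_gt1 q_lt_p).
- rewrite lt_kap => l1l.
  have -> : (p * F / (p - 1) / lambda) `^ p = (l `^ p)^-1.
    have -> : p * F / (p - 1) / lambda = l^-1 by rewrite lE; field; rewrite !gt_eqF.
    by rewrite -(powR_inv1 (ltW l0)) -powRrM mulN1r powRN.
  have := B1_level q_gt1 q_lt_p treeT f0 F0 f11' lambda0 x1d' h1'.
  by rewrite -lE; apply; rewrite -l1x (level_le q_gt1 q_lt_p)// ltW.
Qed.
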